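(* Let $f$ be analytic in a punctured neighborhood $\{0<|z-z_0|<r\}$ of $z_0$, so that $z_0$ is an isolated singularity of $f$. Then $z_0$ is an essential singularity of $f$ if and only if there exists a color $c\in\mathbb{T}$ such that every neighborhood of $z_0$ intersects infinitely many distinct isochromatic lines of color $c$ of the phase plot of $f$.
   Context: $\mathbb{T}$ denotes the unit circle in $\mathbb{C}$. For $f$ analytic on a domain $U$, the phase plot is $P(z)=f(z)/|f(z)|$ on $U_0=\{z\in U: f(z)\neq 0\}$. For $c\in\mathbb{T}$, an isochromatic line of color $c$ is a connected component of the set $\{z\in U_0: f'(z)\neq 0,\ P(z)=c\}$ (here $U=\{0<|z-z_0|<r\}$). *)

(* Defs.v *)
From Stdlib Require Import Reals.
Open Scope R_scope.

Definition Cplx : Type := (R * R)%type.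

Definition RtoC (x : R) : Cplx := (x, 0).
Definition Cadd (z w : Cplx) : Cplx := (fst z + fst w, snd z + snd w).
Definition Copp (z : Cplx) : Cplx := (- fst z, - snd z).
Definition Csub (z w : Cplx) : Cplx := Cadd z (Copp w).
Definition Cmul (z w : Cplx) : Cplx :=
  (fst z * fst w - snd z * snd w, fst z * snd w + snd z * fst w).
Definition Cinv (z : Cplx) : Cplx :=
  (fst z / (fst z ^ 2 + snd z ^ 2), - snd z / (fst z ^ 2 + snd z ^ 2)).
Definition Cdiv (z w : Cplx) : Cplx := Cmul z (Cinv w).
Definition Cnorm (z : Cplx) : R := sqrt (fst z ^ 2 + snd z ^ 2).
Fixpoint Cpow (z : Cplx) (n : nat) : Cplx :=
  match n with O => RtoC 1 | S m => Cmul z (Cpow z m) end.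

Definition is_cderiv (f : Cplx -> Cplx) (z l : Cplx) : Prop :=
  forall eps, 0 < eps -> exists delta, 0 < delta /\
    forall h : Cplx, 0 < Cnorm h < delta ->
      Cnorm (Csub (Cdiv (Csub (f (Cadd z h)) (f z)) h) l) < eps.

(* analytic (holomorphic) on a set U (U will always be open here) *)
Definition analytic_on (U : Cplx -> Prop) (f : Cplx -> Cplx) : Prop :=
  forall z, U z -> exists l, is_cderiv f z l.

Definition cdisc (z0 : Cplx) (r : R) : Cplx -> Prop := fun z => Cnorm (Csub z z0) < r.
Definition punctured_disc (z0 : Cplx) (r : R) : Cplx -> Prop :=
  fun z => 0 < Cnorm (Csub z z0) < r.

Definition removable_or_pole (f : Cplx -> Cplx) (z0 : Cplx) (r : R) : Prop :=
  exists (m : nat) (h : Cplx -> Cplx), analytic_on (cdisc z0 r) h /\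
    forall z, punctured_disc z0 r z -> h z = Cmul (Cpow (Csub z z0) m) (f z).

Definition essential_singularity (f : Cplx -> Cplx) (z0 : Cplx) (r : R) : Prop :=
  ~ removable_or_pole f z0 r.

Definition Copen (O : Cplx -> Prop) : Prop :=
  forall z, O z -> exists d, 0 < d /\ forall w, Cnorm (Csub w z) < d -> O w.

Definition Cconnected (A : Cplx -> Prop) : Prop :=
  forall O1 O2 : Cplx -> Prop, Copen O1 -> Copen O2 ->
    (forall z, A z -> O1 z \/ O2 z) ->
    (exists z, A z /\ O1 z) -> (exists z, A z /\ O2 z) ->
    exists z, A z /\ O1 z /\ O2 z.

Definition connected_component_of (S L : Cplx -> Prop) : Prop :=
  (exists z, L z) /\ (forall z, L z -> S z) /\ Cconnected L /\
  (forall M : Cplx -> Prop, (forall z, L z -> M z) -> (forall z, M z -> S z) ->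
     Cconnected M -> forall z, M z -> L z).

Definition phase (f : Cplx -> Cplx) (z : Cplx) : Cplx := Cdiv (f z) (RtoC (Cnorm (f z))).

Definition color_set (f : Cplx -> Cplx) (z0 : Cplx) (r : R) (c : Cplx) : Cplx -> Prop :=
  fun z => punctured_disc z0 r z /\ f z <> RtoC 0 /\
    (exists l, is_cderiv f z l /\ l <> RtoC 0) /\ phase f z = c.

Definition isochromatic_line (f : Cplx -> Cplx) (z0 : Cplx) (r : R) (c : Cplx)
    (L : Cplx -> Prop) : Prop :=
  connected_component_of (color_set f z0 r c) L.

Definition infinitely_many_sets (P : (Cplx -> Prop) -> Prop) : Prop :=
  forall n : nat, exists Ls : nat -> (Cplx -> Prop),
    (forall i, (i < n)%nat -> P (Ls i)) /\
    (forall i j, (i < n)%nat -> (j < n)%nat -> i <> j -> Ls i <> Ls j).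

(* Main.v *)
Require Import Defs.
From Stdlib Require Import ZArith Reals Lra Lia List FinFun.
From Stdlib Require Import Classical ClassicalEpsilon FunctionalExtensionality PropExtensionality.
From Coquelicot Require Import Coquelicot.
Open Scope R_scope.

(** An essential singularity.  By the Casorati-Weierstrass theorem the images under [f] of the
    noncritical points of small punctured discs are dense, and by the inverse function theorem
    they are open; Baire's theorem yields a value [w <> 0] attained at noncritical points
    arbitrarily close to [z0].  On the coloured set [|f|] is a local coordinate, and therefore
    injective on each isochromatic line; so these points lie on pairwise distinct lines of colour
    [w / |w|].

    A removable singularity or a pole.  Unless [f] is constant, near [z0] either [f] or [1 / f] has
    the form [a + g0 * phi^k] in a local chart [phi].  In this chart the coloured set consists of
    finitely many straight rays, each of which lies on one isochromatic line.

    Cauchy's integral formula is obtained from Goursat's theorem for triangles.  Cauchy-type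
    integrals are strictly differentiable, which gives the inverse function theorem, and
    stable under taking difference quotients, which gives the order of zeros and the removability
    of bounded singularities without power series. *)


(** Baire's theorem stands in for Picard's great theorem: one suitable value recurring near [z0] is
    enough, so nothing has to be known about the exceptional values. The recurrence of a value, and
    not only of a colour, is essential, because points of one colour may well lie on a single line.
    Noncritical points are required from the start, since critical points belong to no line. In the
    tame case the obstacle is that a line is a component of a set in the whole punctured disc, of
    which nothing is known away from [z0]. It is overcome by pigeonhole: every line that comes close
    to [z0] meets one of finitely many connected coloured sets, and two lines meeting the same one
    coincide. If the limit [a] of [f] is nonzero and has the colour in question, the modulus may
    increase or decrease along a ray leaving [z0], so roots for both signs have to be listed. If [f]
    is constant, there are no noncritical points and hence no lines. Strict differentiability lets
    both points of a difference vary; this makes a Newton iteration contract without any appeal to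
    continuity of the derivative. *)

(** * The modulus and neighbourhoods in the plane *)

Lemma Cmod_sub_sym (x y : C) : Cmod (x - y) = Cmod (y - x).
Proof. rewrite <- Cmod_opp. f_equal. ring. Qed.

Lemma Cmod_tri (x y z : C) : Cmod (x - z) <= Cmod (x - y) + Cmod (y - z).
Proof. replace (x - z)%C with ((x - y) + (y - z))%C by ring. apply Cmod_triangle. Qed.

Lemma Cmod_minus_le (x y : C) : Cmod (x - y) <= Cmod x + Cmod y.
Proof.
  replace (x - y)%C with (x + - y)%C by ring.
  rewrite <- (Cmod_opp y). apply Cmod_triangle.
Qed.

Lemma Cmod_rev_tri (x y : C) : Cmod x - Cmod y <= Cmod (x - y).
Proof.
  assert (H := Cmod_triangle (x - y) y).
  replace (x - y + y)%C with x in H by ring. lra.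
Qed.

Lemma Cmod_sub_pos (x y : C) : x <> y -> 0 < Cmod (x - y).
Proof. intros H. apply Cmod_gt_0. now apply Cminus_eq_contra. Qed.

Lemma Cmod_sub_0 (x : C) : Cmod (x - x) = 0.
Proof. replace (x - x)%C with (RtoC 0) by ring. apply Cmod_0. Qed.

Lemma Cmod_sub_eq (x y : C) : Cmod (x - y) <= 0 -> x = y.
Proof.
  intros H. apply Ceq_minus. apply Cmod_eq_0. assert (h := Cmod_ge_0 (x - y)). lra.
Qed.

Lemma Cmod_fst (x : C) : Rabs (fst x) <= Cmod x.
Proof. eapply Rle_trans; [apply Rmax_l | apply Rmax_Cmod]. Qed.

Lemma Cmod_snd (x : C) : Rabs (snd x) <= Cmod x.
Proof. eapply Rle_trans; [apply Rmax_r | apply Rmax_Cmod]. Qed.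

Lemma Cmod_le_sum (x : C) : Cmod x <= Rabs (fst x) + Rabs (snd x).
Proof.
  destruct x as [a b]. cbn [fst snd].
  replace (a, b) with (RtoC a + Ci * RtoC b)%C
    by (unfold RtoC, Ci, Cplus, Cmult; simpl; f_equal; ring).
  eapply Rle_trans; [apply Cmod_triangle|].
  rewrite Cmod_mult, Cmod_Ci, !Cmod_R. lra.
Qed.

Lemma Cmod_pos_neq (x : C) : 0 < Cmod x -> x <> 0.
Proof. intros H. now apply Cmod_gt_0. Qed.

Lemma Cmult_cancel_l (x y z : C) : x <> 0 -> (x * y = x * z)%C -> y = z.
Proof.
  intros Hx H. replace y with (/ x * (x * y))%C by (field; exact Hx).
  rewrite H. field. exact Hx.
Qed.

(** The uniform structure on [C] is that of a product, whose balls are squares; they compare with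
    discs up to the factor [sqrt 2]. This allows all later neighbourhoods to be discs. *)
Lemma locally_Cmod (z : C) (P : C -> Prop) :
  locally (T := C_UniformSpace) z P <->
  exists d, 0 < d /\ forall w, Cmod (w - z) < d -> P w.
Proof.
  split.
  - intros [d Hd]. exists d. split; [apply cond_pos|].
    intros w Hw. apply Hd. apply C_NormedModule_mixin_compat1. exact Hw.
  - intros [d [Hd H]].
    assert (h2 : 0 < sqrt 2) by (apply sqrt_lt_R0; lra).
    assert (hp : 0 < d / sqrt 2) by (apply Rdiv_lt_0_compat; lra).
    exists (mkposreal _ hp). intros w Hw. apply H.
    apply (C_NormedModule_mixin_compat2 z w (mkposreal _ hp)) in Hw.
    simpl in Hw. replace (sqrt 2 * (d / sqrt 2)) with d in Hw by (field; lra).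
    exact Hw.
Qed.

Lemma locally_Rabs (t : R) (P : R -> Prop) :
  locally t P <-> exists d, 0 < d /\ forall s, Rabs (s - t) < d -> P s.
Proof.
  split.
  - intros [d Hd]. exists d. split; [apply cond_pos|]. intros s Hs. apply Hd. exact Hs.
  - intros [d [Hd H]]. exists (mkposreal _ Hd). intros s Hs. apply H. exact Hs.
Qed.

(** * Continuity *)

(** The domain is kept abstract so that the same rules serve functions of a real parameter and of a
    complex variable. *)
Definition cts {U : UniformSpace} (f : U -> C) (x : U) : Prop :=
  forall eps, 0 < eps -> locally x (fun y => Cmod (f y - f x) < eps).

Lemma cts_const {U : UniformSpace} (k : C) (x : U) : cts (fun _ => k) x.
Proof. intros e He. apply filter_forall. intros _. rewrite Cmod_sub_0. exact He. Qed.

Lemma cts_plus {U : UniformSpace} (f g : U -> C) (x : U) :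
  cts f x -> cts g x -> cts (fun y => (f y + g y)%C) x.
Proof.
  intros Hf Hg e He.
  assert (He2 : 0 < e / 2) by lra.
  generalize (filter_and _ _ (Hf (e/2) He2) (Hg (e/2) He2)).
  apply filter_imp. intros y [H1 H2].
  replace (f y + g y - (f x + g x))%C with ((f y - f x) + (g y - g x))%C by ring.
  eapply Rle_lt_trans; [apply Cmod_triangle|]. lra.
Qed.

Lemma cts_mult {U : UniformSpace} (f g : U -> C) (x : U) :
  cts f x -> cts g x -> cts (fun y => (f y * g y)%C) x.
Proof.
  intros Hf Hg e He.
  assert (Ha := Cmod_ge_0 (f x)). assert (Hb := Cmod_ge_0 (g x)).
  set (d := Rmin 1 (e / (2 + Cmod (f x) + Cmod (g x)))).
  assert (Hq : 0 < e / (2 + Cmod (f x) + Cmod (g x))) by (apply Rdiv_lt_0_compat; lra).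
  assert (Hd : 0 < d) by (apply Rmin_pos; lra).
  assert (Hd1 : d <= 1) by apply Rmin_l.
  assert (Hde : d * (2 + Cmod (f x) + Cmod (g x)) <= e).
  { eapply Rle_trans; [apply Rmult_le_compat_r; [lra|apply Rmin_r]|].
    right. field. lra. }
  generalize (filter_and _ _ (Hf d Hd) (Hg d Hd)).
  apply filter_imp. intros y [H1 H2].
  replace (f y * g y - f x * g x)%C
    with ((f y - f x) * (g y - g x) + (f y - f x) * g x + f x * (g y - g x))%C by ring.
  eapply Rle_lt_trans; [apply Cmod_triangle|].
  eapply Rle_lt_trans; [apply Rplus_le_compat_r; apply Cmod_triangle|].
  rewrite !Cmod_mult.
  assert (h1 := Cmod_ge_0 (f y - f x)). assert (h2 := Cmod_ge_0 (g y - g x)).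
  nra.
Qed.

Lemma cts_opp {U : UniformSpace} (f : U -> C) (x : U) :
  cts f x -> cts (fun y => (- f y)%C) x.
Proof.
  intros Hf e He. generalize (Hf e He). apply filter_imp. intros y H.
  replace (- f y - - f x)%C with (- (f y - f x))%C by ring. now rewrite Cmod_opp.
Qed.

Lemma cts_minus {U : UniformSpace} (f g : U -> C) (x : U) :
  cts f x -> cts g x -> cts (fun y => (f y - g y)%C) x.
Proof. intros Hf Hg. apply cts_plus; [exact Hf | now apply cts_opp]. Qed.

Lemma cts_inv {U : UniformSpace} (f : U -> C) (x : U) :
  cts f x -> f x <> 0 -> cts (fun y => (/ f y)%C) x.
Proof.
  intros Hf Hx e He. assert (Hm := proj1 (Cmod_gt_0 _) Hx).
  set (m := Cmod (f x)) in *.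
  set (d := Rmin (m / 2) (e * (m * m / 2))).
  assert (Hd : 0 < d) by (apply Rmin_pos; [lra | apply Rmult_lt_0_compat; nra]).
  assert (Hd1 : d <= m / 2) by apply Rmin_l.
  assert (Hd2 : d <= e * (m * m / 2)) by apply Rmin_r.
  generalize (Hf d Hd). apply filter_imp. intros y H.
  assert (Hy : m / 2 < Cmod (f y)).
  { assert (h := Cmod_rev_tri (f x) (f y)). rewrite Cmod_sub_sym in h. fold m in h. lra. }
  assert (Hy0 : f y <> 0) by (apply Cmod_pos_neq; lra).
  replace (/ f y - / f x)%C with (- (f y - f x) * (/ (f y * f x)))%C
    by (field; split; assumption).
  rewrite Cmod_mult, Cmod_opp, Cmod_inv by (now apply Cmult_neq_0).
  rewrite Cmod_mult. fold m.
  assert (Hp : 0 < Cmod (f y) * m) by nra.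
  apply Rmult_lt_reg_r with (Cmod (f y) * m); [exact Hp|].
  rewrite Rmult_assoc, Rinv_l by lra. nra.
Qed.

Lemma cts_div {U : UniformSpace} (f g : U -> C) (x : U) :
  cts f x -> cts g x -> g x <> 0 -> cts (fun y => (f y / g y)%C) x.
Proof. intros Hf Hg H. apply cts_mult; [exact Hf | now apply cts_inv]. Qed.

Lemma cts_pow {U : UniformSpace} (f : U -> C) (n : nat) (x : U) :
  cts f x -> cts (fun y => (f y ^ n)%C) x.
Proof.
  intros Hf. induction n as [|n IH]; [exact (cts_const (RtoC 1) x)|].
  exact (cts_mult _ _ _ Hf IH).
Qed.

Lemma cts_comp {U : UniformSpace} (f : C_UniformSpace -> C) (g : U -> C) (x : U) :
  cts f (g x) -> cts g x -> cts (fun y => f (g y)) x.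
Proof.
  intros Hf Hg e He. destruct (proj1 (locally_Cmod _ _) (Hf e He)) as [d [Hd H]].
  generalize (Hg d Hd). apply filter_imp. intros y Hy. now apply H.
Qed.

Lemma cts_id (z : C) : cts (U := C_UniformSpace) (fun w => w) z.
Proof. intros e He. apply locally_Cmod. exists e. auto. Qed.

Lemma cts_RtoC (t : R) : cts (U := R_UniformSpace) RtoC t.
Proof.
  intros e He. apply locally_Rabs. exists e. split; [exact He|]. intros s Hs.
  now rewrite <- RtoC_minus, Cmod_R.
Qed.

Lemma cts_ext_loc {U : UniformSpace} (f g : U -> C) (x : U) :
  locally x (fun y => f y = g y) -> cts f x -> cts g x.
Proof.
  intros H Hf e He. assert (Hx := locally_singleton _ _ H). simpl in Hx.
  generalize (filter_and _ _ H (Hf e He)). apply filter_imp.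
  intros y [H1 H2]. now rewrite <- H1, <- Hx.
Qed.

Lemma cts_fst {U : UniformSpace} (g : U -> C) (x : U) :
  cts g x -> continuous (fun y => fst (g y)) x.
Proof.
  intros Hg. apply filterlim_locally. intros e.
  generalize (Hg e (cond_pos e)). apply filter_imp. intros y Hy.
  eapply Rle_lt_trans; [|exact Hy]. apply (Cmod_fst (g y - g x)).
Qed.

Lemma cts_snd {U : UniformSpace} (g : U -> C) (x : U) :
  cts g x -> continuous (fun y => snd (g y)) x.
Proof.
  intros Hg. apply filterlim_locally. intros e.
  generalize (Hg e (cond_pos e)). apply filter_imp. intros y Hy.
  eapply Rle_lt_trans; [|exact Hy]. apply (Cmod_snd (g y - g x)).
Qed.

(** * Integrals of complex-valued functions *)

Definition CInt (g : R -> C) (a b : R) : C :=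
  (RInt (fun t => fst (g t)) a b, RInt (fun t => snd (g t)) a b).

Definition cts_on (g : R -> C) (a b : R) : Prop :=
  forall t, a <= t <= b -> cts (U := R_UniformSpace) g t.

Section Integral.
Variables (a b : R).
Hypothesis Hab : a <= b.

Lemma ex_RInt_fst (g : R -> C) : cts_on g a b -> ex_RInt (fun t => fst (g t)) a b.
Proof.
  intros H. apply (ex_RInt_continuous (V := R_CompleteNormedModule)). intros t Ht.
  rewrite Rmin_left, Rmax_right in Ht by exact Hab. apply (cts_fst g). now apply H.
Qed.

Lemma ex_RInt_snd (g : R -> C) : cts_on g a b -> ex_RInt (fun t => snd (g t)) a b.
Proof.
  intros H. apply (ex_RInt_continuous (V := R_CompleteNormedModule)). intros t Ht.
  rewrite Rmin_left, Rmax_right in Ht by exact Hab. apply (cts_snd g). now apply H.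
Qed.

Lemma CInt_ext (f g : R -> C) :
  (forall t, a <= t <= b -> f t = g t) -> CInt f a b = CInt g a b.
Proof.
  intros H. unfold CInt. f_equal; apply RInt_ext; intros t Ht;
    rewrite Rmin_left, Rmax_right in Ht by exact Hab; rewrite H; auto; lra.
Qed.

Lemma CInt_plus (f g : R -> C) : cts_on f a b -> cts_on g a b ->
  CInt (fun t => f t + g t)%C a b = (CInt f a b + CInt g a b)%C.
Proof.
  intros Hf Hg. unfold CInt, Cplus. cbn [fst snd]. f_equal.
  - apply (RInt_plus (V := R_CompleteNormedModule)); now apply ex_RInt_fst.
  - apply (RInt_plus (V := R_CompleteNormedModule)); now apply ex_RInt_snd.
Qed.

Lemma CInt_scal (k : C) (g : R -> C) : cts_on g a b ->
  CInt (fun t => k * g t)%C a b = (k * CInt g a b)%C.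
Proof.
  intros Hg. assert (H1 := ex_RInt_fst g Hg). assert (H2 := ex_RInt_snd g Hg).
  unfold CInt, Cmult. cbn [fst snd]. f_equal.
  - rewrite <- !(RInt_scal (V := R_CompleteNormedModule)) by assumption.
    apply (RInt_minus (V := R_CompleteNormedModule) (fun t => scal (fst k) (fst (g t)))
      (fun t => scal (snd k) (snd (g t))));
      now apply (ex_RInt_scal (V := R_CompleteNormedModule)).
  - rewrite <- !(RInt_scal (V := R_CompleteNormedModule)) by assumption.
    apply (RInt_plus (V := R_CompleteNormedModule) (fun t => scal (fst k) (snd (g t)))
      (fun t => scal (snd k) (fst (g t))));
      now apply (ex_RInt_scal (V := R_CompleteNormedModule)).
Qed.

Lemma CInt_minus (f g : R -> C) : cts_on f a b -> cts_on g a b ->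
  CInt (fun t => f t - g t)%C a b = (CInt f a b - CInt g a b)%C.
Proof.
  intros Hf Hg.
  rewrite (CInt_ext _ (fun t => f t + (-1)%R * g t)%C) by (intros; ring).
  rewrite CInt_plus, CInt_scal; auto; [ring|].
  intros t Ht. apply cts_mult; [apply cts_const | now apply Hg].
Qed.

(* The constant 2 is not optimal: it comes from integrating real and imaginary parts
   separately. *)
Lemma CInt_bound (g : R -> C) (M : R) : cts_on g a b ->
  (forall t, a <= t <= b -> Cmod (g t) <= M) -> Cmod (CInt g a b) <= 2 * ((b - a) * M).
Proof.
  intros Hg HM. eapply Rle_trans; [apply Cmod_le_sum|]. unfold CInt. cbn [fst snd].
  assert (H1 : Rabs (RInt (fun t => fst (g t)) a b) <= (b - a) * M).
  { apply abs_RInt_le_const; [exact Hab | now apply ex_RInt_fst|].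
    intros t Ht. eapply Rle_trans; [apply Cmod_fst | now apply HM]. }
  assert (H2 : Rabs (RInt (fun t => snd (g t)) a b) <= (b - a) * M).
  { apply abs_RInt_le_const; [exact Hab | now apply ex_RInt_snd|].
    intros t Ht. eapply Rle_trans; [apply Cmod_snd | now apply HM]. }
  lra.
Qed.

End Integral.

(** * Complex derivatives *)

(** The remainder form avoids division, so the base point is no exception and the rules for sums,
    products and compositions become identities between remainders. *)
Definition cdiff (f : C -> C) (z l : C) : Prop :=
  forall eps, 0 < eps -> locally (T := C_UniformSpace) z
    (fun w => Cmod (f w - f z - l * (w - z)) <= eps * Cmod (w - z)).

Definition rdiff (g : R -> C) (t : R) (l : C) : Prop :=
  forall eps, 0 < eps -> locally t
    (fun s => Cmod (g s - g t - l * RtoC (s - t)) <= eps * Rabs (s - t)).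

Lemma cdiff_cts (f : C -> C) (z l : C) : cdiff f z l -> cts (U := C_UniformSpace) f z.
Proof.
  intros H e He. destruct (proj1 (locally_Cmod _ _) (H 1 Rlt_0_1)) as [d [Hd Hw]].
  assert (Hl := Cmod_ge_0 l).
  assert (Hq : 0 < e / (2 + Cmod l)) by (apply Rdiv_lt_0_compat; lra).
  apply locally_Cmod. exists (Rmin d (e / (2 + Cmod l))). split; [now apply Rmin_pos|].
  intros w Hwz. specialize (Hw w (Rlt_le_trans _ _ _ Hwz (Rmin_l _ _))).
  assert (H2 := Rlt_le_trans _ _ _ Hwz (Rmin_r _ _)).
  replace (f w - f z)%C with ((f w - f z - l * (w - z)) + l * (w - z))%C by ring.
  eapply Rle_lt_trans; [apply Cmod_triangle|]. rewrite Cmod_mult.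
  apply (Rmult_lt_compat_r (2 + Cmod l)) in H2; [|lra].
  unfold Rdiv in H2. rewrite Rmult_assoc, Rinv_l in H2 by lra.
  assert (h := Cmod_ge_0 (w - z)). nra.
Qed.

Lemma cdiff_ext_loc (f g : C -> C) (z l : C) :
  locally (T := C_UniformSpace) z (fun w => f w = g w) -> cdiff f z l -> cdiff g z l.
Proof.
  intros H Hf e He. assert (Hx := locally_singleton _ _ H). simpl in Hx.
  generalize (filter_and _ _ H (Hf e He)). apply filter_imp.
  intros y [H1 H2]. now rewrite <- H1, <- Hx.
Qed.

Lemma cdiff_const (k z : C) : cdiff (fun _ => k) z 0.
Proof.
  intros e He. apply filter_forall. intros w.
  replace (k - k - 0 * (w - z))%C with (RtoC 0) by ring. rewrite Cmod_0.
  apply Rmult_le_pos; [lra | apply Cmod_ge_0].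
Qed.

Lemma cdiff_id (z : C) : cdiff (fun w => w) z 1.
Proof.
  intros e He. apply filter_forall. intros w.
  replace (w - z - 1 * (w - z))%C with (RtoC 0) by ring. rewrite Cmod_0.
  apply Rmult_le_pos; [lra | apply Cmod_ge_0].
Qed.

Lemma cdiff_plus (f g : C -> C) (z l m : C) :
  cdiff f z l -> cdiff g z m -> cdiff (fun w => f w + g w)%C z (l + m)%C.
Proof.
  intros Hf Hg e He.
  assert (He2 : 0 < e / 2) by lra.
  generalize (filter_and _ _ (Hf (e/2) He2) (Hg (e/2) He2)).
  apply filter_imp. intros w [H1 H2].
  replace (f w + g w - (f z + g z) - (l + m) * (w - z))%C
    with ((f w - f z - l * (w - z)) + (g w - g z - m * (w - z)))%C by ring.
  eapply Rle_trans; [apply Cmod_triangle|]. lra.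
Qed.

Lemma cdiff_mult (f g : C -> C) (z l m : C) :
  cdiff f z l -> cdiff g z m -> cdiff (fun w => f w * g w)%C z (l * g z + f z * m)%C.
Proof.
  intros Hf Hg e He.
  assert (h1 := Cmod_ge_0 (f z)). assert (h2 := Cmod_ge_0 (g z)). assert (h3 := Cmod_ge_0 l).
  set (d := e / (2 + Cmod (f z) + Cmod (g z) + Cmod l)).
  assert (Hd : 0 < d) by (apply Rdiv_lt_0_compat; lra).
  assert (Hde : d * (2 + Cmod (f z) + Cmod (g z) + Cmod l) = e) by (unfold d; field; lra).
  generalize (filter_and _ _ (filter_and _ _ (Hf d Hd) (Hg d Hd))
    (filter_and _ _ (cdiff_cts _ _ _ Hg d Hd) (cdiff_cts _ _ _ Hg 1 Rlt_0_1))).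
  apply filter_imp. intros w [[H1 H2] [H3 H4]].
  replace (f w * g w - f z * g z - (l * g z + f z * m) * (w - z))%C
    with ((f w - f z - l * (w - z)) * (g w - g z) + (f w - f z - l * (w - z)) * g z
          + f z * (g w - g z - m * (w - z)) + l * (w - z) * (g w - g z))%C by ring.
  eapply Rle_trans; [apply Cmod_triangle|].
  eapply Rle_trans; [apply Rplus_le_compat_r; apply Cmod_triangle|].
  eapply Rle_trans; [apply Rplus_le_compat_r; apply Rplus_le_compat_r; apply Cmod_triangle|].
  rewrite !Cmod_mult.
  assert (h4 := Cmod_ge_0 (f w - f z - l * (w - z))).
  assert (h5 := Cmod_ge_0 (g w - g z - m * (w - z))).
  assert (h6 := Cmod_ge_0 (w - z)). assert (h7 := Cmod_ge_0 (g w - g z)).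
  set (A := Cmod (f w - f z - l * (w - z))) in *.
  set (B := Cmod (g w - g z - m * (w - z))) in *.
  set (W := Cmod (w - z)) in *. set (G := Cmod (g w - g z)) in *.
  assert (A * G <= d * W * 1) by (apply Rmult_le_compat; lra).
  assert (A * Cmod (g z) <= d * W * Cmod (g z)) by (apply Rmult_le_compat_r; lra).
  assert (Cmod (f z) * B <= Cmod (f z) * (d * W)) by (apply Rmult_le_compat_l; lra).
  assert (Cmod l * W * G <= Cmod l * W * d) by (apply Rmult_le_compat_l; nra).
  rewrite <- Hde. nra.
Qed.

Lemma cdiff_scal (k : C) (f : C -> C) (z l : C) :
  cdiff f z l -> cdiff (fun w => k * f w)%C z (k * l)%C.
Proof.
  intros Hf. assert (H := cdiff_mult (fun _ => k) f z 0 l (cdiff_const k z) Hf). cbv beta in H.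
  replace (k * l)%C with (0 * f z + k * l)%C by ring. exact H.
Qed.

Lemma cdiff_lin (k z : C) : cdiff (fun w => k * w)%C z k.
Proof.
  assert (H := cdiff_scal k (fun w => w) z 1 (cdiff_id z)). rewrite Cmult_1_r in H. exact H.
Qed.

Lemma cdiff_inv (f : C -> C) (z l : C) :
  cdiff f z l -> f z <> 0 -> cdiff (fun w => / f w)%C z (- l / (f z * f z))%C.
Proof.
  intros Hf Hz e He. assert (Hm := proj1 (Cmod_gt_0 _) Hz).
  assert (Hc := cdiff_cts _ _ _ Hf).
  assert (Hi := cts_inv _ _ Hc Hz).
  assert (h3 := Cmod_ge_0 l). set (m := Cmod (f z)) in *.
  set (k := / m) in *. assert (Hk : 0 < k) by now apply Rinv_0_lt_compat.
  set (d := e / (1 + (1 + k) * k + Cmod l * k)).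
  assert (Hden : 0 < 1 + (1 + k) * k + Cmod l * k) by nra.
  assert (Hd : 0 < d) by now apply Rdiv_lt_0_compat.
  assert (Hde : d * (1 + (1 + k) * k + Cmod l * k) = e) by (unfold d; field; lra).
  generalize (filter_and _ _ (filter_and _ _ (Hf d Hd) (Hi d Hd))
    (filter_and _ _ (Hi 1 Rlt_0_1) (Hc m Hm))).
  apply filter_imp. intros w [[H1 H2] [H3 H4]].
  assert (Hw : f w <> 0).
  { intros E. rewrite E in H4. replace (0 - f z)%C with (- f z)%C in H4 by ring.
    rewrite Cmod_opp in H4. fold m in H4. lra. }
  replace (/ f w - / f z - - l / (f z * f z) * (w - z))%C
    with (- (f w - f z - l * (w - z)) * / f w * / f z
          + - (l * (w - z)) * (/ f w - / f z) * / f z)%C by (field; auto).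
  eapply Rle_trans; [apply Cmod_triangle|].
  rewrite !Cmod_mult, !Cmod_opp, Cmod_mult, (Cmod_inv (f z)) by assumption. fold m k.
  assert (h4 := Cmod_ge_0 (f w - f z - l * (w - z))).
  assert (h5 := Cmod_ge_0 (/ f w - / f z)).
  assert (h6 := Cmod_ge_0 (w - z)). assert (h7 := Cmod_ge_0 (/ f w)).
  assert (h8 : Cmod (/ f w) <= 1 + k).
  { assert (h := Cmod_rev_tri (/ f w) (/ f z)). rewrite (Cmod_inv (f z)) in h by assumption.
    fold m k in h. lra. }
  set (A := Cmod (f w - f z - l * (w - z))) in *.
  set (B := Cmod (/ f w - / f z)) in *. set (W := Cmod (w - z)) in *.
  assert (A * Cmod (/ f w) <= d * W * (1 + k)) by (apply Rmult_le_compat; lra).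
  assert (Cmod l * W * B <= Cmod l * W * d) by (apply Rmult_le_compat_l; nra).
  assert (A * Cmod (/ f w) * k <= d * W * (1 + k) * k) by (apply Rmult_le_compat_r; lra).
  assert (Cmod l * W * B * k <= Cmod l * W * d * k) by (apply Rmult_le_compat_r; lra).
  rewrite <- Hde. assert (0 <= d * W) by nra. nra.
Qed.

Lemma cdiff_unique (f : C -> C) (z l m : C) : cdiff f z l -> cdiff f z m -> l = m.
Proof.
  intros H1 H2. apply NNPP. intros Hn. assert (Hp := Cmod_sub_pos _ _ Hn).
  set (e := Cmod (l - m) / 4).
  assert (He : 0 < e) by (unfold e; lra).
  destruct (proj1 (locally_Cmod _ _) (filter_and _ _ (H1 e He) (H2 e He))) as [d [Hd H]].
  set (h := RtoC (d / 2)).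
  assert (Eh : (z + h - z)%C = h) by ring.
  assert (Mh : Cmod h = d / 2) by (unfold h; rewrite Cmod_R; apply Rabs_pos_eq; lra).
  specialize (H (z + h)%C). rewrite Eh, Mh in H. destruct H as [A B]; [lra|].
  assert (T := Cmod_minus_le (f (z + h)%C - f z - m * h) (f (z + h)%C - f z - l * h)).
  replace (f (z + h)%C - f z - m * h - (f (z + h)%C - f z - l * h))%C
    with ((l - m) * h)%C in T by ring.
  rewrite Cmod_mult, Mh in T. unfold e in *. nra.
Qed.

Lemma rdiff_comp (f : C -> C) (g : R -> C) (t : R) (l m : C) :
  cdiff f (g t) l -> rdiff g t m -> rdiff (fun s => f (g s)) t (l * m)%C.
Proof.
  intros Hf Hg e He. assert (hl := Cmod_ge_0 l). assert (hm := Cmod_ge_0 m).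
  set (d := Rmin 1 (e / (2 + Cmod l + Cmod m))).
  assert (Hq : 0 < e / (2 + Cmod l + Cmod m)) by (apply Rdiv_lt_0_compat; lra).
  assert (Hd : 0 < d) by (apply Rmin_pos; lra).
  assert (Hd1 : d <= 1) by apply Rmin_l.
  assert (Hde : d * (2 + Cmod l + Cmod m) <= e).
  { eapply Rle_trans; [apply Rmult_le_compat_r; [lra|apply Rmin_r]|]. right. field. lra. }
  destruct (proj1 (locally_Cmod _ _) (Hf d Hd)) as [d1 [Hd1p H1]].
  destruct (proj1 (locally_Rabs _ _) (Hg d Hd)) as [d2 [Hd2p H2]].
  assert (Hq2 : 0 < d1 / (1 + Cmod m)) by (apply Rdiv_lt_0_compat; lra).
  apply locally_Rabs. exists (Rmin d2 (d1 / (1 + Cmod m))). split; [now apply Rmin_pos|].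
  intros s Hs. specialize (H2 s (Rlt_le_trans _ _ _ Hs (Rmin_l _ _))).
  assert (Hs2 := Rlt_le_trans _ _ _ Hs (Rmin_r _ _)).
  assert (hS := Rabs_pos (s - t)).
  assert (Hg1 : Cmod (g s - g t) <= (d + Cmod m) * Rabs (s - t)).
  { replace (g s - g t)%C with ((g s - g t - m * RtoC (s - t)) + m * RtoC (s - t))%C by ring.
    eapply Rle_trans; [apply Cmod_triangle|]. rewrite Cmod_mult, Cmod_R. lra. }
  apply (Rmult_lt_compat_r (1 + Cmod m)) in Hs2; [|lra].
  unfold Rdiv in Hs2. rewrite Rmult_assoc, Rinv_l in Hs2 by lra.
  specialize (H1 (g s)). assert (Hlt : Cmod (g s - g t) < d1) by nra. specialize (H1 Hlt).
  replace (f (g s) - f (g t) - l * m * RtoC (s - t))%C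
    with ((f (g s) - f (g t) - l * (g s - g t)) + l * (g s - g t - m * RtoC (s - t)))%C by ring.
  eapply Rle_trans; [apply Cmod_triangle|]. rewrite Cmod_mult.
  assert (h1 := Cmod_ge_0 (g s - g t)).
  assert (Cmod l * Cmod (g s - g t - m * RtoC (s - t)) <= Cmod l * (d * Rabs (s - t)))
    by (apply Rmult_le_compat_l; lra).
  assert (d * Cmod (g s - g t) <= d * ((d + Cmod m) * Rabs (s - t)))
    by (apply Rmult_le_compat_l; lra).
  assert (d * (d + Cmod m + Cmod l) * Rabs (s - t) <= e * Rabs (s - t)).
  { apply Rmult_le_compat_r; nra. }
  nra.
Qed.

Lemma rdiff_fst (g : R -> C) (t : R) (l : C) :
  rdiff g t l -> is_derive (fun s => fst (g s)) t (fst l).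
Proof.
  intros H. split; [apply is_linear_scal_l|]. intros x Hx.
  apply (is_filter_lim_locally_unique (V := R_NormedModule)) in Hx. subst x. intros e.
  generalize (H e (cond_pos e)). apply filter_imp. intros s Hs.
  eapply Rle_trans; [|exact Hs].
  eapply Rle_trans; [|apply Cmod_fst]. right.
  unfold norm, minus, plus, opp, scal; simpl. unfold abs, mult; simpl. f_equal. ring.
Qed.

Lemma rdiff_snd (g : R -> C) (t : R) (l : C) :
  rdiff g t l -> is_derive (fun s => snd (g s)) t (snd l).
Proof.
  intros H. split; [apply is_linear_scal_l|]. intros x Hx.
  apply (is_filter_lim_locally_unique (V := R_NormedModule)) in Hx. subst x. intros e.
  generalize (H e (cond_pos e)). apply filter_imp. intros s Hs.
  eapply Rle_trans; [|exact Hs].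
  eapply Rle_trans; [|apply Cmod_snd]. right.
  unfold norm, minus, plus, opp, scal; simpl. unfold abs, mult; simpl. f_equal. ring.
Qed.

Lemma CInt_FTC (G g : R -> C) (a b : R) : a <= b ->
  (forall t, a <= t <= b -> rdiff G t (g t)) -> cts_on g a b ->
  CInt g a b = (G b - G a)%C.
Proof.
  intros Hab HG Hg. unfold CInt.
  assert (E1 : RInt (fun t => fst (g t)) a b = fst (G b) - fst (G a)).
  { apply (is_RInt_unique (V := R_CompleteNormedModule)).
    apply (is_RInt_derive (V := R_CompleteNormedModule) (fun t => fst (G t)));
      intros t Ht; rewrite Rmin_left, Rmax_right in Ht by exact Hab.
    - now apply rdiff_fst, HG.
    - apply (cts_fst g). now apply Hg. }
  assert (E2 : RInt (fun t => snd (g t)) a b = snd (G b) - snd (G a)).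
  { apply (is_RInt_unique (V := R_CompleteNormedModule)).
    apply (is_RInt_derive (V := R_CompleteNormedModule) (fun t => snd (G t)));
      intros t Ht; rewrite Rmin_left, Rmax_right in Ht by exact Hab.
    - now apply rdiff_snd, HG.
    - apply (cts_snd g). now apply Hg. }
  rewrite E1, E2. reflexivity.
Qed.

Lemma CInt_path_FTC (F f : C -> C) (p dp : R -> C) (a b : R) : a <= b ->
  (forall t, a <= t <= b -> cdiff F (p t) (f (p t))) ->
  (forall t, a <= t <= b -> rdiff p t (dp t)) ->
  cts_on (fun t => f (p t) * dp t)%C a b ->
  CInt (fun t => f (p t) * dp t)%C a b = (F (p b) - F (p a))%C.
Proof.
  intros Hab HF Hp Hc. apply (CInt_FTC (fun t => F (p t))); auto.
  intros t Ht. apply rdiff_comp; auto.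
Qed.

(** * Completeness of the plane *)

Lemma pow2_small (K d : R) : 0 <= K -> 0 < d -> exists N, K / 2 ^ N < d.
Proof.
  intros HK Hd.
  destruct (pow_lt_1_zero (/2) ltac:(rewrite Rabs_pos_eq; lra)
    (d / (K + 1)) ltac:(apply Rdiv_lt_0_compat; lra)) as [N HN].
  exists N. specialize (HN N (le_n _)). rewrite Rabs_pos_eq in HN by (apply pow_le; lra).
  rewrite pow_inv in HN.
  apply (Rmult_lt_compat_r (K + 1)) in HN; [|lra].
  unfold Rdiv in HN. rewrite Rmult_assoc, Rinv_l in HN by lra.
  assert (0 < / 2 ^ N) by (apply Rinv_0_lt_compat, pow_lt; lra). unfold Rdiv. lra.
Qed.

(** The tail of the geometric series is [2 * K / 2 ^ n]. The explicit rate is used three times: for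
    nested triangles, for Newton iteration and for nested discs in Baire's theorem. *)
Lemma geometric_limit (z : nat -> C) (K : R) :
  (forall n, Cmod (z (S n) - z n) <= K / 2 ^ n) ->
  exists l, forall n, Cmod (z n - l) <= 2 * K / 2 ^ n.
Proof.
  intros H.
  assert (Hp : forall n, 0 < 2 ^ n) by (intros; apply pow_lt; lra).
  assert (HK : 0 <= K).
  { assert (h := H O). simpl in h. assert (h' := Cmod_ge_0 (z 1%nat - z 0%nat)). lra. }
  (* The subtracted term makes the bound telescope; without it the induction on [m] would not
     close. *)
  assert (Hm : forall m n, Cmod (z (n + m)%nat - z n) <= 2 * K / 2 ^ n - 2 * K / 2 ^ (n + m)).
  { induction m as [|m IH]; intros n.
    - rewrite Nat.add_0_r, Cmod_sub_0. lra.
    - rewrite Nat.add_succ_r.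
      eapply Rle_trans; [apply (Cmod_tri _ (z (n + m)%nat))|].
      specialize (IH n). specialize (H (n + m)%nat).
      replace (2 * K / 2 ^ S (n + m)) with (K / 2 ^ (n + m)).
      2:{ simpl. field. apply Rgt_not_eq, Hp. }
      assert (2 * K / 2 ^ (n + m) = K / 2 ^ (n + m) + K / 2 ^ (n + m)) by (unfold Rdiv; ring).
      lra. }
  assert (Hb : forall n m, (n <= m)%nat -> Cmod (z m - z n) <= 2 * K / 2 ^ n).
  { intros n m Hnm. replace m with (n + (m - n))%nat by lia. eapply Rle_trans; [apply Hm|].
    assert (0 <= 2 * K / 2 ^ (n + (m - n))); [|lra].
    apply Rmult_le_pos; [lra|]. left. apply Rinv_0_lt_compat, Hp. }
  assert (Hz : forall e : posreal, exists N, 2 * (2 * K / 2 ^ N) < e).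
  { intros e. destruct (pow2_small (4 * K) e ltac:(lra) (cond_pos e)) as [N HN]. exists N.
    unfold Rdiv in *. lra. }
  assert (Hcau : forall e : posreal, exists N, forall n m, (N <= n)%nat -> (N <= m)%nat ->
    Cmod (z n - z m) < e).
  { intros e. destruct (Hz e) as [N HN]. exists N. intros n m Hn Hm'.
    eapply Rle_lt_trans; [apply (Cmod_tri _ (z N))|].
    rewrite (Cmod_sub_sym (z N)). assert (h1 := Hb N n Hn). assert (h2 := Hb N m Hm'). lra. }
  assert (C1 : ex_finite_lim_seq (fun n => fst (z n))).
  { apply ex_lim_seq_cauchy_corr. intros e. destruct (Hcau e) as [N HN]. exists N.
    intros n m Hn Hm'. eapply Rle_lt_trans; [apply (Cmod_fst (z n - z m)) | now apply HN]. }
  assert (C2 : ex_finite_lim_seq (fun n => snd (z n))).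
  { apply ex_lim_seq_cauchy_corr. intros e. destruct (Hcau e) as [N HN]. exists N.
    intros n m Hn Hm'. eapply Rle_lt_trans; [apply (Cmod_snd (z n - z m)) | now apply HN]. }
  destruct C1 as [l1 L1], C2 as [l2 L2]. exists (l1, l2). intros n.
  apply Rnot_lt_le. intros Hlt.
  set (e := Cmod (z n - (l1, l2)) - 2 * K / 2 ^ n) in *.
  assert (He : 0 < e / 2) by (unfold e; lra).
  apply is_lim_seq_spec in L1. apply is_lim_seq_spec in L2.
  destruct (L1 (mkposreal _ He)) as [N1 HN1]. destruct (L2 (mkposreal _ He)) as [N2 HN2].
  set (m := (n + N1 + N2)%nat). specialize (HN1 m ltac:(lia)). specialize (HN2 m ltac:(lia)).
  simpl in HN1, HN2.
  assert (h1 := Hb n m ltac:(lia)). assert (h2 := Cmod_tri (z n) (z m) (l1, l2)).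
  rewrite (Cmod_sub_sym (z n) (z m)) in h2.
  assert (h3 := Cmod_le_sum (z m - (l1, l2))).
  change (fst (z m - (l1, l2))%C) with (fst (z m) - l1) in h3.
  change (snd (z m - (l1, l2))%C) with (snd (z m) - l2) in h3.
  unfold e in *. lra.
Qed.

(** * Substitution and splitting of integrals *)

(** The factor [u] may be negative, whence the unordered endpoints: [u = -1] reverses a segment, and
    positive factors cut it in two. *)
Lemma CInt_comp_lin (g : R -> C) (u v : R) :
  (forall t, Rmin v (u + v) <= t <= Rmax v (u + v) -> cts (U := R_UniformSpace) g t) ->
  (RtoC u * CInt (fun t => g (u * t + v)%R) 0 1)%C = CInt g v (u + v).
Proof.
  intros Hg.
  assert (Hc : cts_on (fun t => g (u * t + v)) 0 1).
  { intros t Ht e He.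
    assert (Hr : Rmin v (u + v) <= u * t + v <= Rmax v (u + v)).
    { unfold Rmin, Rmax. destruct (Rle_dec v (u + v)); nra. }
    destruct (proj1 (locally_Rabs _ _) (Hg _ Hr e He)) as [d [Hd H]].
    assert (Hu := Rabs_pos u).
    assert (Hq : 0 < d / (1 + Rabs u)) by (apply Rdiv_lt_0_compat; lra).
    apply locally_Rabs. exists (d / (1 + Rabs u)). split; [exact Hq|].
    intros s Hs. apply H. replace (u * s + v - (u * t + v)) with (u * (s - t)) by ring.
    rewrite Rabs_mult. apply (Rmult_lt_compat_r (1 + Rabs u)) in Hs; [|lra].
    unfold Rdiv in Hs. rewrite Rmult_assoc, Rinv_l in Hs by lra.
    assert (h := Rabs_pos (s - t)). nra. }
  assert (H1 : RInt (fun t => fst (g t)) v (u + v) = u * RInt (fun t => fst (g (u * t + v))) 0 1).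
  { assert (E := RInt_comp_lin (V := R_CompleteNormedModule) (fun t => fst (g t)) u v 0 1).
    rewrite Rmult_0_r, Rplus_0_l, Rmult_1_r in E. rewrite <- E.
    - apply (RInt_scal (V := R_CompleteNormedModule)). apply (ex_RInt_fst 0 1 Rle_0_1 _ Hc).
    - apply (ex_RInt_continuous (V := R_CompleteNormedModule)). intros t Ht.
      apply (cts_fst g). now apply Hg. }
  assert (H2 : RInt (fun t => snd (g t)) v (u + v) = u * RInt (fun t => snd (g (u * t + v))) 0 1).
  { assert (E := RInt_comp_lin (V := R_CompleteNormedModule) (fun t => snd (g t)) u v 0 1).
    rewrite Rmult_0_r, Rplus_0_l, Rmult_1_r in E. rewrite <- E.
    - apply (RInt_scal (V := R_CompleteNormedModule)). apply (ex_RInt_snd 0 1 Rle_0_1 _ Hc).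
    - apply (ex_RInt_continuous (V := R_CompleteNormedModule)). intros t Ht.
      apply (cts_snd g). now apply Hg. }
  unfold CInt. rewrite H1, H2. unfold Cmult, RtoC. simpl. f_equal; ring.
Qed.

Lemma CInt_swap (g : R -> C) (a b : R) : a <= b -> cts_on g a b ->
  CInt g b a = (- CInt g a b)%C.
Proof.
  intros Hab Hg. unfold CInt, Copp. cbn [fst snd].
  f_equal; symmetry; apply (opp_RInt_swap (V := R_CompleteNormedModule)).
  - now apply (ex_RInt_fst a b).
  - now apply (ex_RInt_snd a b).
Qed.

Lemma CInt_Chasles (g : R -> C) (a b c : R) : a <= b <= c -> cts_on g a c ->
  CInt g a c = (CInt g a b + CInt g b c)%C.
Proof.
  intros Hab Hg.
  assert (H1 : cts_on g a b) by (intros t Ht; apply Hg; lra).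
  assert (H2 : cts_on g b c) by (intros t Ht; apply Hg; lra).
  unfold CInt, Cplus. cbn [fst snd].
  f_equal; symmetry; apply (RInt_Chasles (V := R_CompleteNormedModule)).
  - apply ex_RInt_fst; [lra | exact H1].
  - apply ex_RInt_fst; [lra | exact H2].
  - apply ex_RInt_snd; [lra | exact H1].
  - apply ex_RInt_snd; [lra | exact H2].
Qed.

(** * Goursat's theorem for triangles *)

Definition segpt (a b : C) (t : R) : C := (a + RtoC t * (b - a))%C.

(** The contour integral of [f] along the segment from [a] to [b], with the constant velocity taken
    out of the integral. *)
Definition seg (f : C -> C) (a b : C) : C :=
  ((b - a) * CInt (fun t => f (segpt a b t)) 0 1)%C.

Definition tri (f : C -> C) (a b c : C) : C := (seg f a b + seg f b c + seg f c a)%C.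

Definition convexC (U : C -> Prop) : Prop :=
  forall a b t, U a -> U b -> 0 <= t <= 1 -> U (segpt a b t).

Definition closedC (U : C -> Prop) : Prop :=
  forall z, (forall e, 0 < e -> exists x, U x /\ Cmod (x - z) < e) -> U z.

Definition ctsC (f : C -> C) (z : C) : Prop := cts (U := C_UniformSpace) f z.

Definition cts_seg (f : C -> C) (a b : C) : Prop :=
  forall t, 0 <= t <= 1 -> ctsC f (segpt a b t).

Lemma segpt_0 (a b : C) : segpt a b 0 = a.
Proof. unfold segpt. ring. Qed.

Lemma segpt_1 (a b : C) : segpt a b 1 = b.
Proof. unfold segpt. ring. Qed.

Lemma cts_segpt (a b : C) (t : R) : cts (U := R_UniformSpace) (segpt a b) t.
Proof.
  apply cts_plus; [apply cts_const|]. apply cts_mult; [apply cts_RtoC | apply cts_const].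
Qed.

Lemma rdiff_segpt (a b : C) (t : R) : rdiff (segpt a b) t (b - a)%C.
Proof.
  intros e He. apply filter_forall. intros s. unfold segpt.
  replace (a + RtoC s * (b - a) - (a + RtoC t * (b - a)) - (b - a) * RtoC (s - t))%C with (RtoC 0)
    by (rewrite RtoC_minus; ring).
  rewrite Cmod_0. apply Rmult_le_pos; [lra | apply Rabs_pos].
Qed.

Lemma Cmod_segpt_l (a b : C) (t : R) : 0 <= t -> Cmod (segpt a b t - a) = t * Cmod (b - a).
Proof.
  intros Ht. unfold segpt. replace (a + RtoC t * (b - a) - a)%C with (RtoC t * (b - a))%C by ring.
  rewrite Cmod_mult, Cmod_R, Rabs_pos_eq by exact Ht. reflexivity.
Qed.

Lemma cts_seg_on (f : C -> C) (a b : C) :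
  cts_seg f a b -> cts_on (fun t => f (segpt a b t)) 0 1.
Proof.
  intros H t Ht. apply (cts_comp f); [now apply H | apply cts_segpt].
Qed.

Lemma cts_seg_in (U : C -> Prop) (f : C -> C) (a b : C) : convexC U -> U a -> U b ->
  (forall z, U z -> ctsC f z) -> cts_seg f a b.
Proof. intros HU Ha Hb Hf t Ht. apply Hf. now apply HU. Qed.

Lemma seg_FTC (F f : C -> C) (a b : C) : cts_seg f a b ->
  (forall t, 0 <= t <= 1 -> cdiff F (segpt a b t) (f (segpt a b t))) ->
  seg f a b = (F b - F a)%C.
Proof.
  intros Hc HF. unfold seg. rewrite <- CInt_scal; [|lra|now apply cts_seg_on].
  rewrite (CInt_ext 0 1 Rle_0_1 _ (fun t => f (segpt a b t) * (b - a))%C) by (intros; ring).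
  rewrite (CInt_path_FTC F f (segpt a b) (fun _ => b - a)%C 0 1 Rle_0_1 HF).
  - now rewrite segpt_0, segpt_1.
  - intros t _. apply rdiff_segpt.
  - intros t Ht. apply cts_mult; [now apply (cts_seg_on f) | apply cts_const].
Qed.

Lemma seg_bound (f : C -> C) (a b : C) (M : R) : cts_seg f a b ->
  (forall t, 0 <= t <= 1 -> Cmod (f (segpt a b t)) <= M) ->
  Cmod (seg f a b) <= 2 * M * Cmod (b - a).
Proof.
  intros Hc HM. unfold seg. rewrite Cmod_mult.
  assert (h := CInt_bound 0 1 Rle_0_1 _ M (cts_seg_on _ _ _ Hc) HM).
  assert (h1 := Cmod_ge_0 (b - a)). nra.
Qed.

Lemma seg_minus (f g : C -> C) (a b : C) : cts_seg f a b -> cts_seg g a b ->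
  seg (fun z => f z - g z)%C a b = (seg f a b - seg g a b)%C.
Proof.
  intros Hf Hg. unfold seg. rewrite CInt_minus; [ring|lra| |]; now apply cts_seg_on.
Qed.

Lemma seg_rev (f : C -> C) (a b : C) : cts_seg f a b -> seg f b a = (- seg f a b)%C.
Proof.
  intros Hf. assert (Hc := cts_seg_on _ _ _ Hf).
  assert (E := CInt_comp_lin (fun t => f (segpt a b t)) (-1) 1).
  replace (-1 + 1) with 0 in E by ring. rewrite Rmin_right, Rmax_left in E by lra.
  specialize (E Hc). rewrite (CInt_swap _ _ _ Rle_0_1 Hc) in E.
  unfold seg.
  rewrite (CInt_ext 0 1 Rle_0_1 (fun t => f (segpt b a t)) (fun t => f (segpt a b (-1 * t + 1)))).
  - replace (a - b)%C with ((b - a) * RtoC (-1))%C by ring. rewrite <- Cmult_assoc, E. ring.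
  - intros t _. f_equal. unfold segpt. rewrite RtoC_plus, RtoC_mult. ring.
Qed.

Lemma seg_split (f : C -> C) (a b : C) (s : R) : 0 <= s <= 1 -> cts_seg f a b ->
  seg f a b = (seg f a (segpt a b s) + seg f (segpt a b s) b)%C.
Proof.
  intros Hs Hf. assert (Hc := cts_seg_on _ _ _ Hf).
  unfold seg at 1. rewrite (CInt_Chasles _ 0 s 1) by (auto; lra).
  assert (E1 := CInt_comp_lin (fun t => f (segpt a b t)) s 0).
  rewrite Rplus_0_r, Rmin_left, Rmax_right in E1 by lra.
  rewrite <- E1 by (intros t Ht; apply Hc; lra).
  assert (E2 := CInt_comp_lin (fun t => f (segpt a b t)) (1 - s) s).
  replace (1 - s + s) with 1 in E2 by ring. rewrite Rmin_left, Rmax_right in E2 by lra.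
  rewrite <- E2 by (intros t Ht; apply Hc; lra).
  unfold seg.
  rewrite (CInt_ext 0 1 Rle_0_1 (fun t => f (segpt a (segpt a b s) t))
             (fun t => f (segpt a b (s * t + 0)))).
  - rewrite (CInt_ext 0 1 Rle_0_1 (fun t => f (segpt (segpt a b s) b t))
             (fun t => f (segpt a b ((1 - s) * t + s)))).
    + replace (segpt a b s - a)%C with (RtoC s * (b - a))%C by (unfold segpt; ring).
      replace (b - segpt a b s)%C with (RtoC (1 - s) * (b - a))%C
        by (unfold segpt; rewrite RtoC_minus; ring).
      ring.
    + intros t _. f_equal. unfold segpt. rewrite RtoC_plus, RtoC_mult, RtoC_minus. ring.
  - intros t _. f_equal. unfold segpt. rewrite RtoC_plus, RtoC_mult. ring.
Qed.

(** Affine functions have an explicit quadratic primitive. In Goursat's argument this disposes of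
    the linear approximation of [f]. *)
Lemma tri_affine (al be a b c : C) : tri (fun z => al + be * z)%C a b c = 0.
Proof.
  set (F := fun z : C => (al * z + be / RtoC 2 * (z * z))%C).
  assert (H2 : RtoC 2 <> 0) by (intros E; apply RtoC_inj in E; lra).
  assert (Hd : forall z, cdiff F z (al + be * z)%C).
  { intros z. unfold F.
    replace (al + be * z)%C with ((0 * z + al * 1) + (0 * (z * z) + be / RtoC 2 * (1 * z + z * 1)))%C
      by (field; exact H2).
    apply cdiff_plus.
    - apply (cdiff_mult (fun _ => al) (fun z => z)); [apply cdiff_const | apply cdiff_id].
    - apply (cdiff_mult (fun _ => be / RtoC 2)%C (fun z => z * z)%C); [apply cdiff_const|].
      apply (cdiff_mult (fun z => z) (fun z => z)); apply cdiff_id. }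
  assert (Hc : forall z, ctsC (fun z => al + be * z)%C z).
  { intros z. apply (cts_plus (U := C_UniformSpace)); [apply cts_const|].
    apply (cts_mult (U := C_UniformSpace)); [apply cts_const | apply cts_id]. }
  unfold tri. rewrite !(seg_FTC F) by (intros t Ht; auto). ring.
Qed.

Lemma tri_minus (f g : C -> C) (a b c : C) :
  cts_seg f a b -> cts_seg f b c -> cts_seg f c a ->
  cts_seg g a b -> cts_seg g b c -> cts_seg g c a ->
  tri (fun z => f z - g z)%C a b c = (tri f a b c - tri g a b c)%C.
Proof. intros. unfold tri. rewrite !seg_minus by assumption. ring. Qed.

Definition mid (a b : C) : C := segpt a b (1/2).

Lemma Cmod_half (x : C) : Cmod (RtoC (1/2) * x) = Cmod x / 2.
Proof. rewrite Cmod_mult, Cmod_R, Rabs_pos_eq by lra. lra. Qed.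

Definition tri_small (a b c : C) (L : R) : Prop :=
  Cmod (b - a) <= L /\ Cmod (c - b) <= L /\ Cmod (a - c) <= L.

Section Goursat.
Variables (U : C -> Prop) (f : C -> C).
Hypothesis U_convex : convexC U.
Hypothesis U_closed : closedC U.
Hypothesis f_diff : forall z, U z -> exists l, cdiff f z l.

Lemma diff_on_cts (z : C) : U z -> ctsC f z.
Proof. intros Hz. destruct (f_diff z Hz) as [l Hl]. exact (cdiff_cts _ _ _ Hl). Qed.

Lemma diff_on_cts_seg (a b : C) : U a -> U b -> cts_seg f a b.
Proof. intros Ha Hb. apply (cts_seg_in U); auto using diff_on_cts. Qed.

(** Each side of the medial triangle is traversed once in either direction, so these contributions
    cancel. *)
Lemma tri_subdivide (a b c : C) : U a -> U b -> U c ->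
  tri f a b c = (tri f a (mid a b) (mid c a) + tri f (mid a b) b (mid b c)
    + tri f (mid c a) (mid b c) c + tri f (mid b c) (mid c a) (mid a b))%C.
Proof.
  intros Ha Hb Hc.
  assert (Hm : forall x y, U x -> U y -> U (mid x y)) by (intros; apply U_convex; auto; lra).
  assert (H1 := Hm _ _ Ha Hb). assert (H2 := Hm _ _ Hb Hc). assert (H3 := Hm _ _ Hc Ha).
  unfold tri.
  rewrite (seg_split f a b (1/2)), (seg_split f b c (1/2)), (seg_split f c a (1/2))
    by (auto using diff_on_cts_seg; lra).
  fold (mid a b) (mid b c) (mid c a).
  rewrite (seg_rev f (mid a b) (mid c a)), (seg_rev f (mid b c) (mid a b)),
    (seg_rev f (mid c a) (mid b c)) by auto using diff_on_cts_seg.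
  ring.
Qed.

Lemma tri_step (a b c : C) (L : R) : U a -> U b -> U c -> tri_small a b c L ->
  exists a' b' c', (U a' /\ U b' /\ U c') /\ tri_small a' b' c' (L / 2) /\
    Cmod (a' - a) <= L /\ Cmod (tri f a b c) <= 4 * Cmod (tri f a' b' c').
Proof.
  intros Ha Hb Hc [S1 [S2 S3]].
  assert (Hm : forall x y, U x -> U y -> U (mid x y)) by (intros; apply U_convex; auto; lra).
  assert (H1 := Hm _ _ Ha Hb). assert (H2 := Hm _ _ Hb Hc). assert (H3 := Hm _ _ Hc Ha).
  assert (E := tri_subdivide a b c Ha Hb Hc).
  assert (T := f_equal Cmod E).
  set (t1 := tri f a (mid a b) (mid c a)) in *. set (t2 := tri f (mid a b) b (mid b c)) in *.
  set (t3 := tri f (mid c a) (mid b c) c) in *.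
  set (t4 := tri f (mid b c) (mid c a) (mid a b)) in *.
  assert (T' : Cmod (tri f a b c) <= Cmod t1 + Cmod t2 + Cmod t3 + Cmod t4).
  { rewrite T. eapply Rle_trans; [apply Cmod_triangle|]. apply Rplus_le_compat_r.
    eapply Rle_trans; [apply Cmod_triangle|]. apply Rplus_le_compat_r. apply Cmod_triangle. }
  assert (h0 := Cmod_ge_0 (b - a)).
  assert (K : forall x y z w : C, (x - y = RtoC (1/2) * (z - w))%C ->
    Cmod (z - w) <= L -> Cmod (x - y) <= L / 2).
  { intros x y z w Ez Hz. rewrite Ez, Cmod_half. lra. }
  assert (Eh : RtoC (1/2) = (RtoC 1 / RtoC 2)%C)
    by (rewrite <- RtoC_div by lra; reflexivity).
  assert (H2n : RtoC 2 <> 0) by (intros E2; apply RtoC_inj in E2; lra).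
  assert (S1' := S1). rewrite Cmod_sub_sym in S1'.
  assert (S2' := S2). rewrite Cmod_sub_sym in S2'.
  assert (S3' := S3). rewrite Cmod_sub_sym in S3'.
  destruct (Rle_lt_dec (Cmod (tri f a b c)) (4 * Cmod t1)) as [D1|D1].
  { exists a, (mid a b), (mid c a). split; [auto|].
    split; [|split; [rewrite Cmod_sub_0; lra | exact D1]].
    split; [|split]; unfold mid, segpt.
    - apply (K _ _ b a); [rewrite Eh; field; exact H2n | exact S1].
    - apply (K _ _ c b); [rewrite Eh; field; exact H2n | exact S2].
    - apply (K _ _ a c); [rewrite Eh; field; exact H2n | exact S3]. }
  destruct (Rle_lt_dec (Cmod (tri f a b c)) (4 * Cmod t2)) as [D2|D2].
  { exists (mid a b), b, (mid b c). split; [auto|].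
    split; [|split; [|exact D2]].
    - split; [|split]; unfold mid, segpt.
      + apply (K _ _ b a); [rewrite Eh; field; exact H2n | exact S1].
      + apply (K _ _ c b); [rewrite Eh; field; exact H2n | exact S2].
      + apply (K _ _ a c); [rewrite Eh; field; exact H2n | exact S3].
    - unfold mid. rewrite Cmod_segpt_l by lra. lra. }
  destruct (Rle_lt_dec (Cmod (tri f a b c)) (4 * Cmod t3)) as [D3|D3].
  { exists (mid c a), (mid b c), c. split; [auto|].
    split; [|split; [|exact D3]].
    - split; [|split]; unfold mid, segpt.
      + apply (K _ _ b a); [rewrite Eh; field; exact H2n | exact S1].
      + apply (K _ _ c b); [rewrite Eh; field; exact H2n | exact S2].
      + apply (K _ _ a c); [rewrite Eh; field; exact H2n | exact S3].
    - assert (h := K (mid c a) a c a). assert (Cmod (mid c a - a) <= L / 2); [|lra].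
      apply h; [unfold mid, segpt; rewrite Eh; field; exact H2n | exact S3']. }
  destruct (Rle_lt_dec (Cmod (tri f a b c)) (4 * Cmod t4)) as [D4|D4]; [|exfalso; lra].
  exists (mid b c), (mid c a), (mid a b). split; [auto|].
  split; [|split; [|exact D4]].
  - split; [|split]; unfold mid, segpt.
    + apply (K _ _ a b); [rewrite Eh; field; exact H2n | exact S1'].
    + apply (K _ _ b c); [rewrite Eh; field; exact H2n | exact S2'].
    + apply (K _ _ c a); [rewrite Eh; field; exact H2n | exact S3'].
  - eapply Rle_trans; [apply (Cmod_tri _ (mid a b))|].
    assert (Cmod (mid b c - mid a b) <= L / 2).
    { apply (K _ _ c a); [unfold mid, segpt; rewrite Eh; field; exact H2n | exact S3']. }
    assert (Cmod (mid a b - a) <= L / 2); [|lra].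
    apply (K _ _ b a); [unfold mid, segpt; rewrite Eh; field; exact H2n | exact S1].
Qed.

Lemma tri_bound (g : C -> C) (a b c : C) (L M : R) : 0 <= M -> tri_small a b c L ->
  cts_seg g a b -> cts_seg g b c -> cts_seg g c a ->
  (forall t, 0 <= t <= 1 -> Cmod (g (segpt a b t)) <= M) ->
  (forall t, 0 <= t <= 1 -> Cmod (g (segpt b c t)) <= M) ->
  (forall t, 0 <= t <= 1 -> Cmod (g (segpt c a t)) <= M) ->
  Cmod (tri g a b c) <= 6 * M * L.
Proof.
  intros HM [S1 [S2 S3]] C1 C2 C3 M1 M2 M3. unfold tri.
  assert (B1 := seg_bound _ _ _ _ C1 M1). assert (B2 := seg_bound _ _ _ _ C2 M2).
  assert (B3 := seg_bound _ _ _ _ C3 M3).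
  eapply Rle_trans; [apply Cmod_triangle|].
  eapply Rle_trans; [apply Rplus_le_compat_r; apply Cmod_triangle|].
  nra.
Qed.

(** Convexity keeps all midpoints in [U]; closedness keeps in [U] the limit of the vertices, where
    differentiability is then used. *)
Theorem goursat (a b c : C) : U a -> U b -> U c -> tri f a b c = 0.
Proof.
  intros Ha Hb Hc.
  set (L := Cmod (b - a) + Cmod (c - b) + Cmod (a - c)).
  assert (h1 := Cmod_ge_0 (b - a)). assert (h2 := Cmod_ge_0 (c - b)).
  assert (h3 := Cmod_ge_0 (a - c)).
  assert (HL : 0 <= L) by (unfold L; lra).
  assert (HS : tri_small a b c L) by (unfold tri_small, L; repeat split; lra).
  set (T := (C * C * C)%type).
  set (good := fun (n : nat) (p : T) => let '(x, y, z) := p in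
     (U x /\ U y /\ U z) /\ tri_small x y z (L / 2 ^ n) /\
     Cmod (tri f a b c) <= 4 ^ n * Cmod (tri f x y z)).
  (* The hypothesis stands inside the existential so that choice yields a total successor function;
     triples that are not good are simply kept. *)
  assert (step : forall n (p : T), exists q : T, good n p ->
     good (S n) q /\ Cmod (fst (fst q) - fst (fst p)) <= L / 2 ^ n).
  { intros n [[x y] z]. destruct (classic (good n (x, y, z))) as [G|G].
    - destruct G as [[Ux [Uy Uz]] [Sm Tb]].
      destruct (tri_step x y z _ Ux Uy Uz Sm) as [x' [y' [z' [HU [HS' [Hd Ht]]]]]].
      exists (x', y', z'). intros _. split; [|exact Hd]. split; [exact HU|]. split.
      + replace (L / 2 ^ S n) with (L / 2 ^ n / 2); [exact HS'|].
        simpl. field. apply pow_nonzero. lra.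
      + eapply Rle_trans; [exact Tb|]. simpl.
        assert (0 < 4 ^ n) by (apply pow_lt; lra). nra.
    - exists (x, y, z). intros G'. contradiction. }
  set (nxt := fun n p => proj1_sig (constructive_indefinite_description _ (step n p))).
  set (sq := fix sq (n : nat) : T := match n with O => (a, b, c) | S m => nxt m (sq m) end).
  assert (Hg : forall n, good n (sq n)).
  { induction n as [|n IH].
    - simpl. split; [auto|]. split; [|lra]. replace (L / 1) with L by field. exact HS.
    - simpl. unfold nxt. destruct (constructive_indefinite_description _ (step n (sq n))) as [q Hq].
      simpl. now apply Hq. }
  assert (Hst : forall n, Cmod (fst (fst (sq (S n))) - fst (fst (sq n))) <= L / 2 ^ n).
  { intros n. simpl. unfold nxt.
    destruct (constructive_indefinite_description _ (step n (sq n))) as [q Hq].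
    simpl. now apply Hq. }
  destruct (geometric_limit (fun n => fst (fst (sq n))) L Hst) as [z Hz].
  assert (Hp : forall n, 0 < 2 ^ n) by (intros; apply pow_lt; lra).
  assert (Uz : U z).
  { apply U_closed. intros e He. destruct (pow2_small (2 * L) e ltac:(lra) He) as [n Hn].
    exists (fst (fst (sq n))). split; [|specialize (Hz n); simpl in Hz; lra].
    generalize (Hg n). destruct (sq n) as [[x y] w]. intros [[Ux _] _]. exact Ux. }
  destruct (f_diff z Uz) as [l Hl].
  (* On the [n]-th triangle all points are within [3 * Ln] of [z], so the remainder is at most
     [e * (3 * Ln)]; with the factor 6 of [tri_bound] this gives 18, and [4 ^ n] cancels against
     [Ln * Ln]. *)
  assert (Hsmall : forall e, 0 < e -> Cmod (tri f a b c) <= 18 * e * (L * L)).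
  { intros e He. destruct (proj1 (locally_Cmod _ _) (Hl e He)) as [d [Hd Hw]].
    destruct (pow2_small (3 * L) d ltac:(lra) Hd) as [n Hn].
    specialize (Hg n). specialize (Hz n). cbv beta in Hz.
    destruct (sq n) as [[x y] w]. simpl in Hz. destruct Hg as [[Ux [Uy Uw]] [Sm Tb]].
    set (Ln := L / 2 ^ n) in *.
    assert (HLn : 0 <= Ln) by (apply Rmult_le_pos; [lra | left; apply Rinv_0_lt_compat, Hp]).
    assert (E3 : 3 * L / 2 ^ n = 3 * Ln) by (unfold Ln, Rdiv; ring).
    assert (E2 : 2 * L / 2 ^ n = 2 * Ln) by (unfold Ln, Rdiv; ring).
    rewrite E3 in Hn. rewrite E2 in Hz.
    (* The affine approximation of [f] at [z], whose integral over every triangle vanishes. *)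
    set (g := fun v => ((f z - l * z) + l * v)%C).
    assert (Cg : forall v, ctsC g v).
    { intros v. apply (cts_plus (U := C_UniformSpace)); [apply cts_const|].
      apply (cts_mult (U := C_UniformSpace)); [apply cts_const | apply cts_id]. }
    assert (E : tri f x y w = tri (fun v => f v - g v)%C x y w).
    { rewrite tri_minus; try (now apply diff_on_cts_seg); try (intros t Ht; apply Cg).
      unfold g. rewrite (tri_affine (f z - l * z) l). ring. }
    destruct Sm as [S1 [S2 S3]].
    assert (Hpt : forall v, Cmod (v - x) <= Ln -> Cmod (f v - g v) <= e * (3 * Ln)).
    { intros v Hv. assert (Hvz : Cmod (v - z) <= 3 * Ln).
      { eapply Rle_trans; [apply (Cmod_tri _ x)|]. lra. }
      assert (h := Hw v ltac:(lra)). unfold g.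
      replace (f v - (f z - l * z + l * v))%C with (f v - f z - l * (v - z))%C by ring.
      eapply Rle_trans; [exact h|]. apply Rmult_le_compat_l; lra. }
    assert (Cfg : forall p q, U p -> U q -> cts_seg (fun v => f v - g v)%C p q).
    { intros p q Up Uq t Ht. apply (cts_minus (U := C_UniformSpace)); [|apply Cg].
      now apply diff_on_cts_seg. }
    assert (B : Cmod (tri (fun v => f v - g v)%C x y w) <= 6 * (e * (3 * Ln)) * Ln).
    { apply tri_bound; try (now apply Cfg); try (repeat split; assumption); try nra.
      - intros t Ht. apply Hpt. rewrite Cmod_segpt_l by lra.
        assert (h := Cmod_ge_0 (y - x)). nra.
      - intros t Ht. apply Hpt.
        replace (segpt y w t - x)%C with (RtoC (1 - t) * (y - x) + RtoC t * (w - x))%C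
          by (unfold segpt; rewrite RtoC_minus; ring).
        eapply Rle_trans; [apply Cmod_triangle|].
        rewrite !Cmod_mult, !Cmod_R, !Rabs_pos_eq by lra.
        rewrite (Cmod_sub_sym w x). nra.
      - intros t Ht. apply Hpt.
        replace (segpt w x t - x)%C with (RtoC (1 - t) * (w - x))%C
          by (unfold segpt; rewrite RtoC_minus; ring).
        rewrite Cmod_mult, Cmod_R, Rabs_pos_eq by lra.
        rewrite (Cmod_sub_sym w x). assert (h := Cmod_ge_0 (x - w)). nra. }
    rewrite E in Tb. eapply Rle_trans; [exact Tb|].
    assert (P4 : 0 < 4 ^ n) by (apply pow_lt; lra).
    eapply Rle_trans; [apply Rmult_le_compat_l; [lra | exact B]|].
    assert (E4 : 4 ^ n = 2 ^ n * 2 ^ n) by (rewrite <- Rpow_mult_distr; f_equal; lra).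
    right. rewrite E4. unfold Ln. field. apply Rgt_not_eq, Hp. }
  apply Cmod_eq_0. apply Rle_antisym; [|apply Cmod_ge_0].
  apply Rnot_lt_le. intros Hlt.
  set (X := Cmod (tri f a b c)) in *.
  assert (HLL : 0 <= L * L) by nra.
  assert (Hden : 0 < 18 * (L * L) + 1) by lra.
  assert (h := Hsmall (X / (18 * (L * L) + 1)) ltac:(now apply Rdiv_lt_0_compat)).
  apply (Rmult_le_compat_r (18 * (L * L) + 1)) in h; [|lra].
  replace (18 * (X / (18 * (L * L) + 1)) * (L * L) * (18 * (L * L) + 1))
    with (18 * (L * L) * X) in h by (field; lra).
  nra.
Qed.

End Goursat.

(** * Cauchy's integral formula *)

Definition hol (f : C -> C) (z0 : C) (rad : R) : Prop :=
  forall z, Cmod (z - z0) < rad -> exists l, cdiff f z l.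

Lemma Cmod_segpt (a b z : C) (t : R) : 0 <= t <= 1 ->
  Cmod (segpt a b t - z) <= (1 - t) * Cmod (a - z) + t * Cmod (b - z).
Proof.
  intros Ht.
  replace (segpt a b t - z)%C with (RtoC (1 - t) * (a - z) + RtoC t * (b - z))%C
    by (unfold segpt; rewrite RtoC_minus; ring).
  eapply Rle_trans; [apply Cmod_triangle|].
  rewrite !Cmod_mult, !Cmod_R, !Rabs_pos_eq by lra. lra.
Qed.

Lemma disc_convex (z0 : C) (rad : R) : convexC (fun z => Cmod (z - z0) < rad).
Proof.
  intros a b t Ha Hb Ht. eapply Rle_lt_trans; [now apply Cmod_segpt|].
  destruct (Req_dec t 0) as [->|Hn]; [lra|].
  assert ((1 - t) * Cmod (a - z0) <= (1 - t) * rad) by (apply Rmult_le_compat_l; lra).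
  assert (t * Cmod (b - z0) < t * rad) by (apply Rmult_lt_compat_l; lra). lra.
Qed.

(* [cut_disc] is the part of a closed disc on the far side of a line separating it from [w]. *)
Definition cut_disc (z0 w z : C) (rho k : R) (x : C) : Prop :=
  Cmod (x - z0) <= rho /\ k <= fst ((x - w) * Cconj (z - w))%C.

Lemma fst_conj_self (z w : C) : fst ((z - w) * Cconj (z - w))%C = Cmod (z - w) * Cmod (z - w).
Proof.
  assert (H := Cmod2_conj (z - w)). rewrite <- H. simpl. ring.
Qed.

Lemma fst_le_mod (x y : C) : fst (x * Cconj y)%C <= Cmod x * Cmod y.
Proof.
  rewrite <- (Cmod_conj y), <- Cmod_mult. eapply Rle_trans; [apply Rle_abs | apply Cmod_fst].
Qed.

Lemma cut_disc_convex (z0 w z : C) (rho k : R) : convexC (cut_disc z0 w z rho k).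
Proof.
  intros a b t [Ha1 Ha2] [Hb1 Hb2] Ht. split.
  - eapply Rle_trans; [now apply Cmod_segpt|]. nra.
  - replace (fst ((segpt a b t - w) * Cconj (z - w))%C)
      with ((1 - t) * fst ((a - w) * Cconj (z - w))%C + t * fst ((b - w) * Cconj (z - w))%C)
      by (unfold segpt; simpl; ring).
    nra.
Qed.

Lemma cut_disc_closed (z0 w z : C) (rho k : R) : closedC (cut_disc z0 w z rho k).
Proof.
  intros x Hx. split.
  - apply Rnot_lt_le. intros Hlt. destruct (Hx (Cmod (x - z0) - rho)) as [y [[Hy _] Hxy]]; [lra|].
    assert (h := Cmod_tri x y z0). rewrite Cmod_sub_sym in Hxy. lra.
  - apply Rnot_lt_le. intros Hlt. assert (hD := Cmod_ge_0 (z - w)).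
    set (g := k - fst ((x - w) * Cconj (z - w))%C).
    assert (Hg : 0 < g) by (unfold g; lra).
    destruct (Hx (g / (1 + Cmod (z - w)))) as [y [[_ Hy] Hxy]].
    { apply Rdiv_lt_0_compat; lra. }
    assert (h := fst_le_mod (y - x) (z - w)).
    replace (fst ((y - x) * Cconj (z - w))%C)
      with (fst ((y - w) * Cconj (z - w))%C - fst ((x - w) * Cconj (z - w))%C) in h
      by (simpl; ring).
    apply (Rmult_lt_compat_r (1 + Cmod (z - w))) in Hxy; [|lra].
    unfold Rdiv in Hxy. rewrite Rmult_assoc, Rinv_l in Hxy by lra.
    assert (h1 := Cmod_ge_0 (y - x)). unfold g in *. nra.
Qed.

Section Primitive.
Variables (q : C -> C) (z0 w : C) (rad : R).
Hypothesis w_in : Cmod (w - z0) < rad.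
Hypothesis q_cts : forall z, Cmod (z - z0) < rad -> ctsC q z.
Hypothesis q_diff : forall z, Cmod (z - z0) < rad -> z <> w -> exists l, cdiff q z l.

Lemma disc_cts_seg (a b : C) : Cmod (a - z0) < rad -> Cmod (b - z0) < rad -> cts_seg q a b.
Proof.
  intros Ha Hb. apply (cts_seg_in (fun z => Cmod (z - z0) < rad)); auto using disc_convex.
Qed.

(* Truncating the triangle near its vertex [w] leaves a trapezoid on which Goursat's theorem
   applies. *)
Lemma tri_vertex (z z' : C) : Cmod (z - z0) < rad -> Cmod (z' - z0) < rad -> z <> w ->
  Cmod (z' - z) <= Cmod (z - w) / 2 ->
  (seg q w z + seg q z z' - seg q w z' = 0)%C.
Proof.
  intros Hz Hz' Hzw Hclose.
  assert (HD := Cmod_sub_pos _ _ Hzw). set (D := Cmod (z - w)) in *.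
  set (rho := Rmax (Cmod (w - z0)) (Rmax (Cmod (z - z0)) (Cmod (z' - z0)))).
  assert (Hrho : rho < rad) by (unfold rho; repeat apply Rmax_lub_lt; assumption).
  assert (Hr1 : Cmod (w - z0) <= rho) by apply Rmax_l.
  assert (Hr2 : Cmod (z - z0) <= rho)
    by (unfold rho; eapply Rle_trans; [apply Rmax_l | apply Rmax_r]).
  assert (Hr3 : Cmod (z' - z0) <= rho)
    by (unfold rho; eapply Rle_trans; [apply Rmax_r | apply Rmax_r]).
  (* Up to the factor [D], this is the coordinate of [x - w] in the direction of [z - w]. It is at
     least [D * D / 2] at [z'] because [z'] is close to [z], so a line [lam = const] can separate
     both points from [w]. *)
  set (lam := fun x => fst ((x - w) * Cconj (z - w))%C).
  assert (Lz : lam z = D * D) by apply fst_conj_self.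
  assert (Lz' : D * D / 2 <= lam z').
  { assert (h := fst_le_mod (z - z') (z - w)). rewrite Cmod_sub_sym in h. fold D in h.
    replace (fst ((z - z') * Cconj (z - w))%C) with (lam z - lam z') in h
      by (unfold lam; simpl; ring).
    rewrite Lz in h. nra. }
  assert (Le : forall x e, lam (segpt w x e) = e * lam x)
    by (intros; unfold lam, segpt; simpl; ring).
  set (X := (seg q w z + seg q z z' - seg q w z')%C).
  (* The diagonal from [ze] to [z'] cuts the trapezoid into two triangles inside the convex set [U],
     which avoids [w]; only the small triangle at [w] survives. *)
  assert (EX : forall e, 0 < e < 1 ->
    X = (seg q w (segpt w z e) + seg q (segpt w z e) (segpt w z' e) - seg q w (segpt w z' e))%C).
  { intros e He. set (ze := segpt w z e). set (ze' := segpt w z' e).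
    set (U := cut_disc z0 w z rho (e * (D * D / 2))).
    assert (U1 : U z) by (split; [exact Hr2|]; fold (lam z); rewrite Lz; nra).
    assert (U2 : U z') by (split; [exact Hr3|]; fold (lam z'); nra).
    assert (Ule : forall x, Cmod (x - z0) <= rho -> Cmod (segpt w x e - z0) <= rho).
    { intros x Hx. eapply Rle_trans; [apply Cmod_segpt; lra|]. nra. }
    assert (U3 : U ze) by (split; [now apply Ule|]; fold (lam ze); unfold ze; rewrite Le, Lz; nra).
    assert (U4 : U ze') by (split; [now apply Ule|]; fold (lam ze'); unfold ze'; rewrite Le;
      apply Rmult_le_compat_l; lra).
    assert (UD : forall x, U x -> exists l, cdiff q x l).
    { intros x [Hx1 Hx2]. apply q_diff; [exact (Rle_lt_trans _ _ _ Hx1 Hrho)|]. intros ->.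
      replace (fst ((w - w) * Cconj (z - w))%C) with 0 in Hx2 by (simpl; ring).
      assert (0 < e * (D * D / 2)) by (repeat apply Rmult_lt_0_compat; lra). lra. }
    assert (G1 := goursat U q (cut_disc_convex _ _ _ _ _) (cut_disc_closed _ _ _ _ _) UD
      ze z z' U3 U1 U2).
    assert (G2 := goursat U q (cut_disc_convex _ _ _ _ _) (cut_disc_closed _ _ _ _ _) UD
      ze z' ze' U3 U2 U4).
    assert (UR : forall x, U x -> Cmod (x - z0) < rad) by (intros x [Hx _]; lra).
    unfold X. rewrite (seg_split q w z e), (seg_split q w z' e)
      by (try lra; now apply disc_cts_seg). fold ze ze'.
    unfold tri in G1, G2.
    rewrite (seg_rev q ze z') in G1 by (apply disc_cts_seg; auto).
    rewrite (seg_rev q ze' z'), (seg_rev q ze ze') in G2 by (apply disc_cts_seg; auto).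
    replace (seg q w ze + seg q ze z + seg q z z' - (seg q w ze' + seg q ze' z'))%C
      with ((seg q ze z + seg q z z' + - seg q ze z')
            + (seg q ze z' + - seg q ze' z' + - seg q ze ze')
            + (seg q w ze + seg q ze ze' - seg q w ze'))%C by ring.
    rewrite G1, G2. ring. }
  destruct (proj1 (locally_Cmod _ _) (q_cts w w_in 1 Rlt_0_1)) as [d [Hd Hq]].
  set (M := Cmod (q w) + 1).
  assert (HM : forall x, Cmod (x - w) < d -> Cmod (q x) <= M).
  { intros x Hx. assert (h := Cmod_rev_tri (q x) (q w)). specialize (Hq x Hx). unfold M. lra. }
  assert (HM0 : 0 < M) by (unfold M; assert (h := Cmod_ge_0 (q w)); lra).
  set (P := Cmod (z - w) + Cmod (z' - w) + Cmod (z' - z)).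
  assert (p1 := Cmod_ge_0 (z - w)). assert (p2 := Cmod_ge_0 (z' - w)).
  assert (p3 := Cmod_ge_0 (z' - z)).
  (* The small triangle has perimeter [e * P], and continuity at [w] bounds [q] by [M] on it, so its
     integral tends to 0 with [e]. *)
  assert (HX : forall e, 0 < e < 1 -> e * P < d -> Cmod X <= 2 * M * (e * P)).
  { intros e He HeP. rewrite (EX e He).
    set (ze := segpt w z e). set (ze' := segpt w z' e).
    assert (N1 : Cmod (ze - w) = e * Cmod (z - w)) by (apply Cmod_segpt_l; lra).
    assert (N2 : Cmod (ze' - w) = e * Cmod (z' - w)) by (apply Cmod_segpt_l; lra).
    assert (N3 : Cmod (ze' - ze) = e * Cmod (z' - z)).
    { replace (ze' - ze)%C with (RtoC e * (z' - z))%C by (unfold ze, ze', segpt; ring).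
      rewrite Cmod_mult, Cmod_R, Rabs_pos_eq by lra. reflexivity. }
    assert (Hwin : forall x, Cmod (x - z0) <= rho -> Cmod (segpt w x e - z0) < rad).
    { intros x Hx. eapply Rle_lt_trans; [apply Cmod_segpt; lra|]. nra. }
    assert (I1 := Hwin z Hr2). assert (I2 := Hwin z' Hr3). fold ze in I1. fold ze' in I2.
    assert (hb : forall a b, Cmod (a - z0) < rad -> Cmod (b - z0) < rad ->
       Cmod (a - w) < d -> Cmod (b - w) < d -> Cmod (seg q a b) <= 2 * M * Cmod (b - a)).
    { intros a b Ha Hb Ha' Hb'. apply seg_bound; [now apply disc_cts_seg|].
      intros t Ht. apply HM. now apply (disc_convex w d). }
    assert (W0 : Cmod (w - w) < d) by (rewrite Cmod_sub_0; exact Hd).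
    assert (W1 : Cmod (ze - w) < d) by (rewrite N1; unfold P in HeP; nra).
    assert (W2 : Cmod (ze' - w) < d) by (rewrite N2; unfold P in HeP; nra).
    assert (B1 := hb w ze w_in I1 W0 W1). assert (B2 := hb ze ze' I1 I2 W1 W2).
    assert (B3 := hb w ze' w_in I2 W0 W2). rewrite N1 in B1. rewrite N3 in B2. rewrite N2 in B3.
    eapply Rle_trans; [apply Cmod_minus_le|].
    eapply Rle_trans; [apply Rplus_le_compat_r; apply Cmod_triangle|].
    unfold P. lra. }
  apply Cmod_eq_0. apply Rle_antisym; [|apply Cmod_ge_0]. apply Rnot_lt_le. intros Hlt.
  assert (HP : 0 < P) by (unfold P; fold D; fold D in p1; lra).
  set (e := Rmin (1/2) (Rmin (d / (2 * P)) (Cmod X / (4 * M * P)))).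
  assert (a1 : 0 < d / (2 * P)) by (apply Rdiv_lt_0_compat; lra).
  assert (a2 : 0 < Cmod X / (4 * M * P)) by (apply Rdiv_lt_0_compat; [lra | nra]).
  assert (He : 0 < e) by (unfold e; repeat apply Rmin_pos; lra).
  assert (e1 : e <= 1/2) by apply Rmin_l.
  assert (e2 : e <= d / (2 * P))
    by (unfold e; eapply Rle_trans; [apply Rmin_r | apply Rmin_l]).
  assert (e3 : e <= Cmod X / (4 * M * P))
    by (unfold e; eapply Rle_trans; [apply Rmin_r | apply Rmin_r]).
  apply (Rmult_le_compat_r P) in e2; [|lra].
  replace (d / (2 * P) * P) with (d / 2) in e2 by (field; lra).
  apply (Rmult_le_compat_r (2 * M * P)) in e3; [|nra].
  replace (Cmod X / (4 * M * P) * (2 * M * P)) with (Cmod X / 2) in e3 by (field; lra).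
  assert (e4 : 0 < e < 1) by lra. assert (e5 : e * P < d) by lra.
  assert (h := HX e e4 e5). nra.
Qed.

(** Integrating from the exceptional point [w] itself means that every triangle to be considered has
    [w] as a vertex, which is exactly the case settled by [tri_vertex]. *)
Lemma primitive_star (z : C) : Cmod (z - z0) < rad -> cdiff (fun x => seg q w x) z (q z).
Proof.
  intros Hz e He.
  (* Near [z] the increment of the primitive is the integral over the segment from [z] to [x]. At
     [z = w] this is immediate, since the integral from [w] to [w] is 0. *)
  assert (Hloc : exists d, 0 < d /\ forall x, Cmod (x - z) < d ->
    Cmod (x - z0) < rad /\ (seg q w x - seg q w z)%C = seg q z x).
  { destruct (classic (z = w)) as [->|Hn].
    - exists (rad - Cmod (w - z0)). split; [lra|]. intros x Hx. split.
      + assert (h := Cmod_tri x w z0). lra.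
      + unfold seg at 2. ring.
    - assert (HD := Cmod_sub_pos _ _ Hn).
      exists (Rmin (rad - Cmod (z - z0)) (Cmod (z - w) / 2)). split; [apply Rmin_pos; lra|].
      intros x Hx. assert (H1 := Rlt_le_trans _ _ _ Hx (Rmin_l _ _)).
      assert (H2 := Rlt_le_trans _ _ _ Hx (Rmin_r _ _)).
      assert (Hx0 : Cmod (x - z0) < rad) by (assert (h := Cmod_tri x z z0); lra).
      split; [exact Hx0|].
      assert (Hc2 : Cmod (x - z) <= Cmod (z - w) / 2) by lra.
      assert (h := tri_vertex z x Hz Hx0 Hn Hc2).
      replace (seg q w x - seg q w z)%C
        with (seg q z x - (seg q w z + seg q z x - seg q w x))%C by ring.
      rewrite h. ring. }
  destruct Hloc as [d [Hd Hloc]].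
  assert (He2 : 0 < e / 2) by lra.
  destruct (proj1 (locally_Cmod _ _) (q_cts z Hz (e / 2) He2)) as [d' [Hd' Hq]].
  apply locally_Cmod. exists (Rmin d d'). split; [now apply Rmin_pos|]. intros x Hx.
  assert (H1 := Rlt_le_trans _ _ _ Hx (Rmin_l _ _)).
  assert (H2 := Rlt_le_trans _ _ _ Hx (Rmin_r _ _)).
  destruct (Hloc x H1) as [Hx0 E]. rewrite E.
  assert (Cc : cts_seg (fun _ => q z) z x).
  { intros t _. apply (cts_const (U := C_UniformSpace)). }
  assert (Ec : seg (fun _ => q z) z x = (q z * (x - z))%C).
  { rewrite (seg_FTC (fun y => q z * y)%C); [ring | exact Cc |]. intros t _.
    apply cdiff_lin. }
  rewrite <- Ec, <- seg_minus; [|now apply disc_cts_seg | exact Cc].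
  replace (e * Cmod (x - z)) with (2 * (e / 2) * Cmod (x - z)) by field.
  apply seg_bound.
  - intros t Ht. apply (cts_minus (U := C_UniformSpace)); [now apply disc_cts_seg | now apply Cc].
  - intros t Ht. left. apply Hq. rewrite Cmod_segpt_l by lra.
    assert (h := Cmod_ge_0 (x - z)). nra.
Qed.

End Primitive.

(** * Difference quotients *)

Definition slope (f : C -> C) (w l z : C) : C :=
  if Ceq_dec z w then l else ((f z - f w) / (z - w))%C.

Lemma slope_neq (f : C -> C) (w l z : C) : z <> w -> slope f w l z = ((f z - f w) / (z - w))%C.
Proof. intros H. unfold slope. destruct (Ceq_dec z w); [contradiction | reflexivity]. Qed.

Lemma slope_eq (f : C -> C) (w l : C) : slope f w l w = l.
Proof. unfold slope. destruct (Ceq_dec w w); [reflexivity | contradiction]. Qed.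

Lemma slope_loc (f : C -> C) (w l z : C) : z <> w ->
  locally (T := C_UniformSpace) z (fun x => ((f x - f w) * / (x - w))%C = slope f w l x).
Proof.
  intros H. apply locally_Cmod. exists (Cmod (z - w)). split; [now apply Cmod_sub_pos|].
  intros x Hx. rewrite slope_neq; [reflexivity|]. intros ->. rewrite Cmod_sub_sym in Hx. lra.
Qed.

Lemma cdiff_minus_const (f : C -> C) (k z l : C) : cdiff f z l -> cdiff (fun x => f x - k)%C z l.
Proof.
  intros Hf. replace l with (l + 0)%C by ring.
  apply (cdiff_plus f (fun _ => - k)%C); [exact Hf | apply cdiff_const].
Qed.

Lemma slope_diff (f : C -> C) (w l z m : C) : z <> w -> cdiff f z m ->
  exists m', cdiff (slope f w l) z m'.
Proof.
  intros Hn Hf. eexists. apply (cdiff_ext_loc (fun x => (f x - f w) * / (x - w))%C).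
  - now apply slope_loc.
  - apply (cdiff_mult (fun x => f x - f w)%C (fun x => / (x - w))%C).
    + apply cdiff_minus_const. exact Hf.
    + apply (cdiff_inv (fun x => x - w)%C); [apply cdiff_minus_const; apply cdiff_id|].
      now apply Cminus_eq_contra.
Qed.

Lemma slope_cts (f : C -> C) (w l : C) : cdiff f w l -> ctsC (slope f w l) w.
Proof.
  intros Hf e He. assert (He2 : 0 < e / 2) by lra.
  destruct (proj1 (locally_Cmod _ _) (Hf (e / 2) He2)) as [d [Hd H]].
  apply locally_Cmod. exists d. split; [exact Hd|]. intros x Hx. rewrite slope_eq.
  destruct (classic (x = w)) as [->|Hn]; [rewrite slope_eq, Cmod_sub_0; exact He|].
  rewrite slope_neq by exact Hn. specialize (H x Hx).
  assert (Hp := Cmod_sub_pos _ _ Hn).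
  assert (Hn0 : (x - w)%C <> 0) by now apply Cminus_eq_contra.
  replace ((f x - f w) / (x - w) - l)%C with ((f x - f w - l * (x - w)) / (x - w))%C
    by (field; exact Hn0).
  rewrite Cmod_div by exact Hn0.
  apply (Rmult_lt_reg_r (Cmod (x - w))); [exact Hp|].
  unfold Rdiv. rewrite Rmult_assoc, Rinv_l by lra. nra.
Qed.

(** * Circles *)

Definition ei (t : R) : C := (cos t, sin t).

Definition circ (z0 : C) (rho t : R) : C := (z0 + RtoC rho * ei t)%C.
(** The velocity of [circ]. Its quotient by [circ z0 rho t - z0] is the constant [Ci], which yields
    the index of the circle about its centre. *)
Definition dcirc (rho t : R) : C := (RtoC rho * (Ci * ei t))%C.

Lemma Cmod_ei (t : R) : Cmod (ei t) = 1.
Proof.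
  unfold Cmod, ei. simpl fst. simpl snd. rewrite <- sqrt_1. f_equal.
  assert (h := sin2_cos2 t). unfold Rsqr in h. lra.
Qed.

Lemma is_derive_eps (f : R -> R) (t l : R) : is_derive f t l ->
  forall eps, 0 < eps -> locally t (fun s => Rabs (f s - f t - (s - t) * l) <= eps * Rabs (s - t)).
Proof.
  intros [_ H] e He.
  exact (H t (fun P HP => HP) (mkposreal e He)).
Qed.

Lemma rdiff_pair (u v : R -> R) (t a b : R) : is_derive u t a -> is_derive v t b ->
  rdiff (fun s => (u s, v s)) t (a, b).
Proof.
  intros Hu Hv e He. assert (He2 : 0 < e / 2) by lra.
  generalize (filter_and _ _ (is_derive_eps u t a Hu (e/2) He2)
    (is_derive_eps v t b Hv (e/2) He2)).
  apply filter_imp. intros s [H1 H2]. eapply Rle_trans; [apply Cmod_le_sum|].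
  replace (fst ((u s, v s) - (u t, v t) - (a, b) * RtoC (s - t))%C) with (u s - u t - (s - t) * a)
    by (simpl; ring).
  replace (snd ((u s, v s) - (u t, v t) - (a, b) * RtoC (s - t))%C) with (v s - v t - (s - t) * b)
    by (simpl; ring).
  lra.
Qed.

Lemma rdiff_ei (t : R) : rdiff ei t (Ci * ei t)%C.
Proof.
  replace (Ci * ei t)%C with (- sin t, cos t) by (unfold Ci, ei, Cmult; simpl; f_equal; ring).
  apply rdiff_pair; [apply is_derive_cos | apply is_derive_sin].
Qed.

Lemma rdiff_circ (z0 : C) (rho t : R) : rdiff (circ z0 rho) t (dcirc rho t).
Proof.
  unfold circ, dcirc.
  apply (rdiff_comp (fun z => z0 + RtoC rho * z)%C ei t (RtoC rho)); [|apply rdiff_ei].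
  rewrite <- (Cplus_0_l (RtoC rho)) at 1.
  apply (cdiff_plus (fun _ => z0) (fun z => RtoC rho * z)%C); [apply cdiff_const | apply cdiff_lin].
Qed.

Lemma cts_ei (t : R) : cts (U := R_UniformSpace) ei t.
Proof.
  intros e He. destruct (proj1 (locally_Rabs _ _) (rdiff_ei t 1 Rlt_0_1)) as [d [Hd H]].
  apply locally_Rabs. exists (Rmin d (e / 2)). split; [apply Rmin_pos; lra|]. intros s Hs.
  specialize (H s (Rlt_le_trans _ _ _ Hs (Rmin_l _ _))).
  assert (H2 := Rlt_le_trans _ _ _ Hs (Rmin_r _ _)).
  replace (ei s - ei t)%C with ((ei s - ei t - Ci * ei t * RtoC (s - t)) + Ci * ei t * RtoC (s - t))%C
    by ring.
  eapply Rle_lt_trans; [apply Cmod_triangle|].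
  rewrite !Cmod_mult, Cmod_Ci, Cmod_ei, Cmod_R. lra.
Qed.

Lemma cts_circ (z0 : C) (rho t : R) : cts (U := R_UniformSpace) (circ z0 rho) t.
Proof. apply cts_plus; [apply cts_const|]. apply cts_mult; [apply cts_const | apply cts_ei]. Qed.

Lemma cts_dcirc (rho t : R) : cts (U := R_UniformSpace) (dcirc rho) t.
Proof.
  apply cts_mult; [apply cts_const|]. apply cts_mult; [apply cts_const | apply cts_ei].
Qed.

Lemma Cmod_circ (z0 : C) (rho t : R) : 0 <= rho -> Cmod (circ z0 rho t - z0) = rho.
Proof.
  intros H. unfold circ. replace (z0 + RtoC rho * ei t - z0)%C with (RtoC rho * ei t)%C by ring.
  rewrite Cmod_mult, Cmod_ei, Cmod_R, Rabs_pos_eq by exact H. ring.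
Qed.

Lemma Cmod_circ_sub (z0 z : C) (rho t : R) : 0 <= rho ->
  rho - Cmod (z - z0) <= Cmod (circ z0 rho t - z).
Proof.
  intros H. assert (h := Cmod_tri (circ z0 rho t) z z0). rewrite Cmod_circ in h by exact H. lra.
Qed.

Lemma circ_neq (z0 z : C) (rho t : R) : 0 <= rho -> Cmod (z - z0) < rho ->
  (circ z0 rho t - z)%C <> 0.
Proof.
  intros H Hz. apply Cmod_pos_neq. assert (h := Cmod_circ_sub z0 z rho t H). lra.
Qed.

Lemma circ_2PI (z0 : C) (rho : R) : circ z0 rho (2 * PI) = circ z0 rho 0.
Proof. unfold circ, ei. rewrite cos_2PI, sin_2PI, cos_0, sin_0. reflexivity. Qed.

Lemma PI2_ge_0 : 0 <= 2 * PI.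
Proof. assert (h := PI_RGT_0). lra. Qed.

Lemma cts_on_bounded (g : R -> C) (a b : R) : a <= b -> cts_on g a b ->
  exists M, 0 < M /\ forall t, a <= t <= b -> Cmod (g t) <= M.
Proof.
  intros Hab Hg. destruct (continuity_ab_maj (fun t => Cmod (g t)) a b Hab) as [t0 [Ht0 _]].
  - intros c Hc. apply continuity_pt_filterlim. apply filterlim_locally. intros e.
    generalize (Hg c Hc e (cond_pos e)). apply filter_imp. intros s Hs.
    apply Rabs_def1.
    + eapply Rle_lt_trans; [apply Cmod_rev_tri | exact Hs].
    + assert (h := Cmod_rev_tri (g c) (g s)). rewrite Cmod_sub_sym in h. 
      unfold minus, plus, opp; simpl. lra.
  - exists (Cmod (g t0) + 1). split; [assert (h := Cmod_ge_0 (g t0)); lra|].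
    intros t Ht. specialize (Ht0 t Ht). simpl in Ht0. lra.
Qed.

(** * Cauchy-type integrals *)

(** Strict differentiability: both points vary near [x]. It provides local Lipschitz bounds, the
    inverse function theorem, and closeness of the derivatives at nearby points to [l]. *)
Definition sdiff (f : C -> C) (x l : C) : Prop :=
  forall eps, 0 < eps -> exists d, 0 < d /\ forall z w, Cmod (z - x) < d -> Cmod (w - x) < d ->
    Cmod (f z - f w - l * (z - w)) <= eps * Cmod (z - w).

Lemma sdiff_cdiff (f : C -> C) (x l : C) : sdiff f x l -> cdiff f x l.
Proof.
  intros H e He. destruct (H e He) as [d [Hd Hz]]. apply locally_Cmod. exists d.
  split; [exact Hd|]. intros w Hw. apply Hz; [exact Hw|]. rewrite Cmod_sub_0. exact Hd.
Qed.

(** The density [u] absorbs the velocity of the circle and need not come from a function on the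
    plane; this freedom makes the class stable under difference quotients. *)
Definition cauchy_int (z0 : C) (rho : R) (u : R -> C) (z : C) : C :=
  CInt (fun t => u t / (circ z0 rho t - z))%C 0 (2 * PI).

Section CauchyType.
Variables (z0 : C) (rho : R) (u : R -> C).
Hypothesis rho_pos : 0 < rho.
Hypothesis u_cts : cts_on u 0 (2 * PI).

Lemma cauchy_kernel_cts (z : C) : Cmod (z - z0) < rho ->
  cts_on (fun t => u t / (circ z0 rho t - z))%C 0 (2 * PI).
Proof.
  intros Hz t Ht. apply cts_div; [now apply u_cts| |apply circ_neq; lra].
  apply cts_minus; [apply cts_circ | apply cts_const].
Qed.

Lemma cauchy_int_sdiff (x : C) : Cmod (x - z0) < rho ->
  sdiff (cauchy_int z0 rho u) x
    (CInt (fun t => u t / ((circ z0 rho t - x) * (circ z0 rho t - x)))%C 0 (2 * PI)).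
Proof.
  intros Hx e He. set (del := rho - Cmod (x - z0)). assert (Hdel : 0 < del) by (unfold del; lra).
  destruct (cts_on_bounded u 0 (2 * PI) PI2_ge_0 u_cts) as [M [HM0 HM]].
  (* Within [del / 2] of [x] the kernel is bounded by [k]. The remainder of the kernel is then at
     most [2 * d * k^3 + d^2 * k^4] times [Cmod (z - w)], hence at most [3 * d * k^3] times it,
     since [d * k <= 1]. The factor [4 * PI] in [A] comes from [CInt_bound] on an interval of length
     [2 * PI]. *)
  set (k := 2 / del). assert (Hk : 0 < k) by (apply Rdiv_lt_0_compat; lra).
  assert (HPI := PI_RGT_0).
  set (A := 4 * PI * (M * (3 * (k * k * k)))).
  assert (Hk3 : 0 < k * k * k) by exact (Rmult_lt_0_compat _ _ (Rmult_lt_0_compat _ _ Hk Hk) Hk).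
  assert (HA : 0 < A).
  { unfold A. apply Rmult_lt_0_compat; [lra|]. apply Rmult_lt_0_compat; lra. }
  exists (Rmin (del / 2) (e / A)). split; [apply Rmin_pos; [lra | now apply Rdiv_lt_0_compat]|].
  set (d := Rmin (del / 2) (e / A)).
  assert (Hd1 : d <= del / 2) by apply Rmin_l.
  assert (Hd2 : d * A <= e).
  { apply Rle_trans with (e / A * A); [apply Rmult_le_compat_r; [lra | apply Rmin_r]|].
    right. field. lra. }
  intros z w Hz Hw.
  assert (Hin : forall y, Cmod (y - x) < d -> Cmod (y - z0) < rho).
  { intros y Hy. assert (h := Cmod_tri y x z0). unfold del in *. lra. }
  assert (Hn : forall y t, Cmod (y - x) < d -> (circ z0 rho t - y)%C <> 0).
  { intros y t Hy. apply circ_neq; [lra | now apply Hin]. }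
  assert (Hd0 : 0 < d) by (unfold d; apply Rmin_pos; [lra | now apply Rdiv_lt_0_compat]).
  assert (Hxx : Cmod (x - x) < d) by (rewrite Cmod_sub_0; exact Hd0).
  assert (Hi : forall y t, Cmod (y - x) < d -> Cmod (/ (circ z0 rho t - y)) <= k).
  { intros y t Hy. rewrite Cmod_inv by now apply Hn.
    assert (h1 := Cmod_circ_sub z0 y rho t (Rlt_le _ _ rho_pos)).
    assert (h2 := Cmod_tri y x z0).
    unfold k. replace (2 / del) with (/ (del / 2)) by (field; lra).
    apply Rinv_le_contravar; [lra|]. unfold del in *. lra. }
  assert (Cx : cts_on (fun t => u t / ((circ z0 rho t - x) * (circ z0 rho t - x)))%C 0 (2 * PI)).
  { intros t Ht. apply cts_div; [now apply u_cts| |].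
    - apply cts_mult; apply cts_minus; (apply cts_circ || apply cts_const).
    - apply Cmult_neq_0; now apply Hn. }
  assert (Cz := cauchy_kernel_cts z (Hin z Hz)). assert (Cw := cauchy_kernel_cts w (Hin w Hw)).
  unfold cauchy_int.
  rewrite Cmult_comm, <- CInt_scal, <- CInt_minus, <- CInt_minus; auto using PI2_ge_0.
  2:{ intros t Ht. apply cts_minus; [now apply Cz | now apply Cw]. }
  2:{ intros t Ht. apply cts_mult; [apply cts_const | now apply Cx]. }
  apply Rle_trans with (2 * ((2 * PI - 0) * (M * (Cmod (z - w) * (3 * (k * k * k) * d))))).
  - apply CInt_bound; [apply PI2_ge_0 | |].
    { intros t Ht. apply cts_minus; [apply cts_minus; [now apply Cz | now apply Cw]|].
      apply cts_mult; [apply cts_const | now apply Cx]. }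
    intros t Ht. set (c := circ z0 rho t).
    assert (Nz := Hn z t Hz). assert (Nw := Hn w t Hw). assert (Nx := Hn x t Hxx).
    fold c in Nz, Nw, Nx.
    replace (u t / (c - z) - u t / (c - w) - (z - w) * (u t / ((c - x) * (c - x))))%C
      with (u t * ((z - w) * (((z - x) + (w - x)) * (/ (c - z) * / (c - w) * / (c - x))
        - ((z - x) * (w - x)) * (/ (c - z) * / (c - w) * / (c - x) * / (c - x)))))%C
      by (field; auto).
    rewrite !Cmod_mult.
    apply Rmult_le_compat; [apply Cmod_ge_0 | apply Rmult_le_pos; apply Cmod_ge_0 | now apply HM|].
    apply Rmult_le_compat_l; [apply Cmod_ge_0|].
    eapply Rle_trans; [apply Cmod_minus_le|]. rewrite !Cmod_mult.
    assert (iz := Hi z t Hz). assert (iw := Hi w t Hw). assert (ix := Hi x t Hxx).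
    fold c in iz, iw, ix.
    assert (gz := Cmod_ge_0 (/ (c - z))). assert (gw := Cmod_ge_0 (/ (c - w))).
    assert (gx := Cmod_ge_0 (/ (c - x))).
    assert (m1 : Cmod (z - x + (w - x)) <= 2 * d).
    { eapply Rle_trans; [apply Cmod_triangle|]. lra. }
    assert (m2 : Cmod (z - x) * Cmod (w - x) <= d * d).
    { apply Rmult_le_compat; try apply Cmod_ge_0; lra. }
    assert (m3 : Cmod (/ (c - z)) * Cmod (/ (c - w)) <= k * k) by (apply Rmult_le_compat; lra).
    assert (m4 : Cmod (/ (c - z)) * Cmod (/ (c - w)) * Cmod (/ (c - x)) <= k * k * k)
      by (apply Rmult_le_compat; try lra; apply Rmult_le_pos; lra).
    assert (m5 : Cmod (/ (c - z)) * Cmod (/ (c - w)) * Cmod (/ (c - x)) * Cmod (/ (c - x))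
      <= k * k * k * k)
      by (apply Rmult_le_compat; try lra; repeat apply Rmult_le_pos; lra).
    assert (m6 : Cmod (z - x + (w - x)) * (Cmod (/ (c - z)) * Cmod (/ (c - w)) * Cmod (/ (c - x)))
      <= 2 * d * (k * k * k))
      by (apply Rmult_le_compat; try lra; try apply Cmod_ge_0; repeat apply Rmult_le_pos; lra).
    assert (m7 : Cmod (z - x) * Cmod (w - x) *
       (Cmod (/ (c - z)) * Cmod (/ (c - w)) * Cmod (/ (c - x)) * Cmod (/ (c - x)))
      <= d * d * (k * k * k * k))
      by (apply Rmult_le_compat; try lra; repeat apply Rmult_le_pos; try apply Cmod_ge_0; lra).
    assert (dk : d * k <= 1).
    { unfold k. apply Rle_trans with (del / 2 * (2 / del));
        [apply Rmult_le_compat_r; [left; exact Hk | exact Hd1] | right; field; lra]. }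
    assert (d * d * (k * k * k * k) <= d * (k * k * k)).
    { replace (d * d * (k * k * k * k)) with (d * (k * k * k) * (d * k)) by ring.
      rewrite <- (Rmult_1_r (d * (k * k * k))) at 2. apply Rmult_le_compat_l; [|exact dk].
      apply Rmult_le_pos; lra. }
    lra.
  - replace (2 * ((2 * PI - 0) * (M * (Cmod (z - w) * (3 * (k * k * k) * d)))))
      with (d * A * Cmod (z - w)) by (unfold A; ring).
    apply Rmult_le_compat_r; [apply Cmod_ge_0 | exact Hd2].
Qed.

End CauchyType.

Lemma cdiff_zero_const (F : C -> C) (z0 : C) (rad : R) :
  (forall z, Cmod (z - z0) < rad -> cdiff F z 0) ->
  forall z, Cmod (z - z0) < rad -> F z = F z0.
Proof.
  intros HF z Hz.
  assert (Cc : cts_seg (fun _ => RtoC 0) z0 z)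
    by (intros t _; apply (cts_const (U := C_UniformSpace))).
  assert (E1 : seg (fun _ => RtoC 0) z0 z = (F z - F z0)%C).
  { apply seg_FTC; [exact Cc|]. intros t Ht. apply HF.
    apply (disc_convex z0 rad); [|exact Hz|exact Ht].
    rewrite Cmod_sub_0. assert (h := Cmod_ge_0 (z - z0)). lra. }
  assert (E2 : seg (fun _ => RtoC 0) z0 z = (RtoC 0 - RtoC 0)%C).
  { apply (seg_FTC (fun _ => RtoC 0)); [exact Cc|]. intros t Ht. apply cdiff_const. }
  rewrite E1 in E2. apply Ceq_minus. rewrite E2. ring.
Qed.

(** The derivative in [w] integrates [1 / (z - x)^2], which has a primitive, around a closed curve
    and hence vanishes. So the index equals its value at the centre, where the integrand is the
    constant [Ci]. *)
Lemma circle_index (z0 : C) (rho : R) (w : C) : 0 < rho -> Cmod (w - z0) < rho ->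
  cauchy_int z0 rho (dcirc rho) w = (RtoC (2 * PI) * Ci)%C.
Proof.
  intros Hr Hw.
  assert (Hu : cts_on (dcirc rho) 0 (2 * PI)) by (intros t _; apply cts_dcirc).
  rewrite (cdiff_zero_const _ z0 rho) with (z := w); [| |exact Hw].
  - unfold cauchy_int.
    rewrite (CInt_ext 0 (2 * PI) PI2_ge_0 _ (fun _ => Ci)).
    + rewrite (CInt_FTC (fun t => Ci * RtoC t)%C).
      * ring.
      * apply PI2_ge_0.
      * intros t _ e He. apply filter_forall. intros s.
        replace (Ci * RtoC s - Ci * RtoC t - Ci * RtoC (s - t))%C with (RtoC 0)
          by (rewrite RtoC_minus; ring).
        rewrite Cmod_0. apply Rmult_le_pos; [lra | apply Rabs_pos].
      * intros t _. apply cts_const.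
    + intros t _. unfold dcirc, circ.
      assert (N1 : ei t <> 0).
      { intros E. assert (h := Cmod_ei t). rewrite E, Cmod_0 in h. lra. }
      assert (N2 : RtoC rho <> 0) by (intros E; apply RtoC_inj in E; lra).
      replace (z0 + RtoC rho * ei t - z0)%C with (RtoC rho * ei t)%C by ring.
      field. auto.
  - intros x Hx. apply sdiff_cdiff.
    replace (RtoC 0) with
      (CInt (fun t => dcirc rho t / ((circ z0 rho t - x) * (circ z0 rho t - x)))%C 0 (2 * PI)).
    { apply cauchy_int_sdiff; assumption. }
    assert (Nx : forall t, (circ z0 rho t - x)%C <> 0) by (intros t; apply circ_neq; lra).
    rewrite (CInt_ext 0 (2 * PI) PI2_ge_0 _
      (fun t => (fun z => 1 / ((z - x) * (z - x))) (circ z0 rho t) * dcirc rho t)%C).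
    + rewrite (CInt_path_FTC (fun z => - / (z - x))%C (fun z => 1 / ((z - x) * (z - x)))%C
        (circ z0 rho) (dcirc rho)).
      * rewrite circ_2PI. ring.
      * apply PI2_ge_0.
      * intros t _.
        assert (Hd : cdiff (fun z => z - x)%C (circ z0 rho t) 1)
          by (apply cdiff_minus_const, cdiff_id).
        assert (Hi := cdiff_scal (RtoC (-1)) _ _ _ (cdiff_inv _ _ _ Hd (Nx t))).
        replace (1 / ((circ z0 rho t - x) * (circ z0 rho t - x)))%C
          with (RtoC (-1) * (- (1) / ((circ z0 rho t - x) * (circ z0 rho t - x))))%C
          by (field; apply Nx).
        eapply cdiff_ext_loc; [|exact Hi]. apply filter_forall. intros y. ring.
      * intros t _. apply rdiff_circ.
      * intros t _. apply cts_mult; [|apply cts_dcirc].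
        apply cts_div; [apply cts_const| |apply Cmult_neq_0; apply Nx].
        apply cts_mult; apply cts_minus; (apply cts_circ || apply cts_const).
    + intros t _. field. apply Nx.
Qed.

Lemma twoPIi_neq : (RtoC (2 * PI) * Ci)%C <> 0.
Proof.
  apply Cmult_neq_0; [|apply Ci_nz]. intros E. apply RtoC_inj in E.
  assert (h := PI_RGT_0). lra.
Qed.

Lemma hol_circ_cts (f : C -> C) (z0 : C) (rad rho : R) : 0 <= rho < rad -> hol f z0 rad ->
  cts_on (fun t => f (circ z0 rho t)) 0 (2 * PI).
Proof.
  intros Hr Hf t _. destruct (Hf (circ z0 rho t)) as [l Hl].
  - rewrite Cmod_circ; lra.
  - apply (cts_comp f); [exact (cdiff_cts _ _ _ Hl) | apply cts_circ].
Qed.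

(** The difference quotient of [f] at [w], completed by the derivative, is continuous, and
    differentiable away from [w]. It therefore has a primitive and integrates to 0 around the
    circle; expanding the quotient gives the formula. *)
Theorem cauchy_formula (f : C -> C) (z0 : C) (rad rho : R) (w : C) : 0 < rho < rad -> hol f z0 rad ->
  Cmod (w - z0) < rho ->
  cauchy_int z0 rho (fun t => f (circ z0 rho t) * dcirc rho t)%C w
    = (RtoC (2 * PI) * Ci * f w)%C.
Proof.
  intros Hr Hf Hw. destruct (Hf w ltac:(lra)) as [l Hl].
  set (q := slope f w l).
  assert (Nq : forall t, circ z0 rho t <> w).
  { intros t E. apply (circ_neq z0 w rho t); [lra | exact Hw|]. rewrite E. ring. }
  assert (q_diff : forall z, Cmod (z - z0) < rad -> z <> w -> exists l, cdiff q z l).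
  { intros z Hz Hn. destruct (Hf z Hz) as [m Hm]. exact (slope_diff f w l z m Hn Hm). }
  assert (q_cts : forall z, Cmod (z - z0) < rad -> ctsC q z).
  { intros z Hz. destruct (classic (z = w)) as [->|Hn].
    - now apply slope_cts.
    - destruct (q_diff z Hz Hn) as [m Hm]. exact (cdiff_cts _ _ _ Hm). }
  assert (Hp := primitive_star q z0 w rad ltac:(lra) q_cts q_diff).
  assert (Hin : forall t, Cmod (circ z0 rho t - z0) < rad) by (intros t; rewrite Cmod_circ; lra).
  assert (I0 : CInt (fun t => q (circ z0 rho t) * dcirc rho t)%C 0 (2 * PI) = 0).
  { rewrite (CInt_path_FTC (fun x => seg q w x)).
    - rewrite circ_2PI. ring.
    - apply PI2_ge_0.
    - intros t _. apply Hp, Hin.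
    - intros t _. apply rdiff_circ.
    - intros t _. apply cts_mult; [|apply cts_dcirc].
      apply (cts_comp q); [apply q_cts, Hin | apply cts_circ]. }
  assert (Cu : cts_on (fun t => f (circ z0 rho t) * dcirc rho t)%C 0 (2 * PI)).
  { intros t Ht. apply cts_mult; [|apply cts_dcirc]. apply (hol_circ_cts f z0 rad); auto; lra. }
  assert (Cd : cts_on (dcirc rho) 0 (2 * PI)) by (intros t _; apply cts_dcirc).
  assert (E : CInt (fun t => q (circ z0 rho t) * dcirc rho t)%C 0 (2 * PI) =
    (cauchy_int z0 rho (fun t => f (circ z0 rho t) * dcirc rho t)%C w
      - f w * cauchy_int z0 rho (dcirc rho) w)%C).
  { unfold cauchy_int. rewrite <- CInt_scal, <- CInt_minus; try apply PI2_ge_0.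
    - apply CInt_ext; [apply PI2_ge_0|]. intros t _. unfold q. rewrite slope_neq by apply Nq.
      field. apply Cminus_eq_contra, Nq.
    - apply cauchy_kernel_cts; [lra | exact Cu | exact Hw].
    - intros t Ht. apply cts_mult; [apply cts_const|].
      apply cauchy_kernel_cts; [lra | exact Cd | exact Hw | exact Ht].
    - apply cauchy_kernel_cts; [lra | exact Cd | exact Hw]. }
  rewrite circle_index in E by lra. rewrite I0 in E.
  symmetry in E. apply Ceq_minus in E. rewrite E. ring.
Qed.

(** * Strict differentiability, zeros and removable singularities *)

Lemma sdiff_scal (k : C) (f : C -> C) (x l : C) :
  sdiff f x l -> sdiff (fun z => k * f z)%C x (k * l)%C.
Proof.
  intros H e He. assert (hk := Cmod_ge_0 k).
  assert (Hq : 0 < e / (1 + Cmod k)) by (apply Rdiv_lt_0_compat; lra).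
  destruct (H _ Hq) as [d [Hd Hz]]. exists d. split; [exact Hd|]. intros z w H1 H2.
  replace (k * f z - k * f w - k * l * (z - w))%C with (k * (f z - f w - l * (z - w)))%C by ring.
  rewrite Cmod_mult. specialize (Hz z w H1 H2).
  apply Rle_trans with ((1 + Cmod k) * (e / (1 + Cmod k) * Cmod (z - w))).
  - apply Rmult_le_compat; try apply Cmod_ge_0; lra.
  - right. field. lra.
Qed.

Lemma sdiff_ext_loc (f g : C -> C) (x l : C) (d : R) : 0 < d ->
  (forall z, Cmod (z - x) < d -> f z = g z) -> sdiff f x l -> sdiff g x l.
Proof.
  intros Hd E H e He. destruct (H e He) as [d' [Hd' Hz]].
  exists (Rmin d d'). split; [now apply Rmin_pos|]. intros z w H1 H2.
  rewrite <- !E by (eapply Rlt_le_trans; [eassumption | apply Rmin_l]).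
  apply Hz; (eapply Rlt_le_trans; [eassumption | apply Rmin_r]).
Qed.

(** Near [z0] the function is a constant multiple of a Cauchy-type integral, and these are strictly
    differentiable. *)
Lemma hol_sdiff (f : C -> C) (z0 : C) (rad : R) : 0 < rad -> hol f z0 rad ->
  exists l, sdiff f z0 l.
Proof.
  intros Hr Hf. set (rho := rad / 2). assert (Hrho : 0 < rho < rad) by (unfold rho; lra).
  set (u := fun t => (f (circ z0 rho t) * dcirc rho t)%C).
  assert (Cu : cts_on u 0 (2 * PI)).
  { intros t Ht. apply cts_mult; [|apply cts_dcirc]. apply (hol_circ_cts f z0 rad); auto; lra. }
  eexists.
  apply (sdiff_ext_loc (fun z => / (RtoC (2 * PI) * Ci) * cauchy_int z0 rho u z)%C _ _ _ rho).
  - lra.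
  - intros z Hz. unfold u. rewrite (cauchy_formula f z0 rad rho z Hrho Hf Hz).
    rewrite Cmult_assoc, Cinv_l by apply twoPIi_neq. ring.
  - apply sdiff_scal. apply cauchy_int_sdiff; [lra | exact Cu |].
    rewrite Cmod_sub_0. lra.
Qed.

Lemma cts_eq_punctured (f g : C -> C) (z : C) (d : R) : 0 < d -> ctsC f z -> ctsC g z ->
  (forall w, 0 < Cmod (w - z) < d -> f w = g w) -> f z = g z.
Proof.
  intros Hd Hf Hg E. apply NNPP. intros Hn. assert (Hp := Cmod_sub_pos _ _ Hn).
  set (e := Cmod (f z - g z) / 2). assert (He : 0 < e) by (unfold e; lra).
  destruct (proj1 (locally_Cmod _ _) (filter_and _ _ (Hf e He) (Hg e He))) as [d' [Hd' H]].
  set (m := Rmin d d' / 2). assert (Hm : 0 < Rmin d d') by now apply Rmin_pos.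
  assert (Em : Cmod (z + RtoC m - z) = m).
  { replace (z + RtoC m - z)%C with (RtoC m) by ring. rewrite Cmod_R.
    apply Rabs_pos_eq. unfold m. lra. }
  assert (h1 := Rmin_l d d'). assert (h2 := Rmin_r d d').
  destruct (H (z + RtoC m)%C) as [A B]; [rewrite Em; unfold m; lra|].
  rewrite E in A by (rewrite Em; unfold m; lra).
  assert (T := Cmod_tri (f z) (g (z + RtoC m)%C) (g z)).
  rewrite (Cmod_sub_sym (f z) (g (z + RtoC m)%C)) in T. unfold e in *. lra.
Qed.

(** Only differentiability at [z0] is in question. There the difference quotient of a Cauchy-type
    integral is again one, which makes repeated division by [z - z0] possible without power
    series. *)
Lemma slope_hol (f : C -> C) (z0 l : C) (rad : R) : 0 < rad -> hol f z0 rad ->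
  cdiff f z0 l -> hol (slope f z0 l) z0 rad.
Proof.
  intros Hr Hf Hl z Hz. destruct (classic (z = z0)) as [->|Hn].
  2:{ destruct (Hf z Hz) as [m Hm]. exact (slope_diff f z0 l z m Hn Hm). }
  set (rho := rad / 2). assert (Hrho : 0 < rho < rad) by (unfold rho; lra).
  set (u := fun t => (f (circ z0 rho t) * dcirc rho t)%C).
  assert (Cu : cts_on u 0 (2 * PI)).
  { intros t Ht. apply cts_mult; [|apply cts_dcirc]. apply (hol_circ_cts f z0 rad); auto; lra. }
  (* The new density arises from [1 / (c - w) - 1 / (c - z0) = (w - z0) / ((c - w) (c - z0))]. *)
  set (v := fun t => (u t / (circ z0 rho t - z0))%C).
  assert (Hz0 : Cmod (z0 - z0) < rho) by (rewrite Cmod_sub_0; lra).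
  assert (Cv : cts_on v 0 (2 * PI)) by (apply cauchy_kernel_cts; [lra | exact Cu | exact Hz0]).
  set (K := fun z => (/ (RtoC (2 * PI) * Ci) * cauchy_int z0 rho v z)%C).
  assert (HK : exists m, cdiff K z0 m).
  { eexists. apply cdiff_scal. apply sdiff_cdiff. apply cauchy_int_sdiff; [lra | exact Cv | exact Hz0]. }
  assert (E : forall w, 0 < Cmod (w - z0) < rho -> K w = slope f z0 l w).
  { intros w [Hw0 Hw]. assert (Hwn : (w - z0)%C <> 0) by now apply Cmod_pos_neq.
    rewrite slope_neq by (intros ->; rewrite Cmod_sub_0 in Hw0; lra).
    assert (E1 := cauchy_formula f z0 rad rho w Hrho Hf Hw).
    assert (E0 := cauchy_formula f z0 rad rho z0 Hrho Hf Hz0). fold u in E1, E0.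
    assert (Ev : (cauchy_int z0 rho u w - cauchy_int z0 rho u z0)%C
      = ((w - z0) * cauchy_int z0 rho v w)%C).
    { unfold cauchy_int.
      rewrite <- CInt_scal, <- CInt_minus; try apply PI2_ge_0;
        try (apply cauchy_kernel_cts; auto; lra).
      apply CInt_ext; [apply PI2_ge_0|]. intros t _. unfold v. field.
      split; apply circ_neq; lra. }
    unfold K. apply (Cmult_cancel_l (RtoC (2 * PI) * Ci * (w - z0))%C).
    - apply Cmult_neq_0; [apply twoPIi_neq | exact Hwn].
    - transitivity (cauchy_int z0 rho u w - cauchy_int z0 rho u z0)%C.
      + rewrite Ev. field. split; [apply Ci_nz|]. intros E2. apply RtoC_inj in E2.
        assert (h := PI_RGT_0). lra.
      + rewrite E1, E0. field. exact Hwn. }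
  destruct HK as [m Hm]. exists m. apply (cdiff_ext_loc K); [|exact Hm].
  apply locally_Cmod. exists rho. split; [lra|]. intros w Hw.
  destruct (classic (w = z0)) as [->|Hwn].
  - apply (cts_eq_punctured K (slope f z0 l) z0 rho); [lra| |now apply slope_cts|exact E].
    exact (cdiff_cts _ _ _ Hm).
  - apply E. split; [now apply Cmod_sub_pos | exact Hw].
Qed.

Lemma slope_decomp (f : C -> C) (w l z : C) : f z = (f w + (z - w) * slope f w l z)%C.
Proof.
  destruct (classic (z = w)) as [->|Hn]; [ring|]. rewrite slope_neq by exact Hn.
  field. now apply Cminus_eq_contra.
Qed.

(** A crude substitute for the maximum principle. It degenerates near the circle, but its constant
    does not depend on [f], so it can be applied to all quotients of [f] by powers at once. *)
Lemma cauchy_bound (f : C -> C) (z0 w : C) (rad rho M : R) : 0 < rho < rad -> hol f z0 rad ->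
  (forall t, Cmod (f (circ z0 rho t)) <= M) -> Cmod (w - z0) < rho ->
  Cmod (f w) <= 2 * M * rho / (rho - Cmod (w - z0)).
Proof.
  intros Hr Hf HM Hw. assert (E := cauchy_formula f z0 rad rho w Hr Hf Hw).
  apply (f_equal Cmod) in E. rewrite !Cmod_mult, Cmod_Ci, Cmod_R in E.
  assert (HPI := PI_RGT_0). rewrite Rabs_pos_eq in E by lra.
  set (del := rho - Cmod (w - z0)) in *. assert (Hdel : 0 < del) by (unfold del; lra).
  set (u := fun t => (f (circ z0 rho t) * dcirc rho t)%C) in *.
  assert (Cu : cts_on u 0 (2 * PI)).
  { intros t Ht. apply cts_mult; [|apply cts_dcirc]. apply (hol_circ_cts f z0 rad); auto; lra. }
  assert (B : Cmod (cauchy_int z0 rho u w) <= 2 * ((2 * PI - 0) * (M * rho / del))).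
  { apply CInt_bound; [apply PI2_ge_0 | now apply cauchy_kernel_cts|].
    intros t _. rewrite Cmod_div by (apply circ_neq; lra).
    assert (h := Cmod_circ_sub z0 w rho t ltac:(lra)). fold del in h.
    unfold u, dcirc. rewrite !Cmod_mult, Cmod_Ci, Cmod_ei, Cmod_R, Rabs_pos_eq by lra.
    rewrite !Rmult_1_l, Rmult_1_r. specialize (HM t). assert (hf := Cmod_ge_0 (f (circ z0 rho t))).
    unfold Rdiv. apply Rmult_le_compat.
    - apply Rmult_le_pos; lra.
    - left. apply Rinv_0_lt_compat. lra.
    - apply Rmult_le_compat_r; lra.
    - apply Rinv_le_contravar; lra. }
  rewrite E in B.
  apply (Rmult_le_reg_l (2 * PI)); [lra|].
  replace (2 * PI * (2 * M * rho / del)) with (2 * ((2 * PI - 0) * (M * rho / del)))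
    by (field; lra).
  lra.
Qed.

(** If division by [z - z0] never stops, then [cauchy_bound] for the [k]-th quotient gives
    [Cmod (f z) <= A * x ^ k] with [x < 1] for all [k]. The radius [rad / 2] leaves room for the
    circle of radius [3 * rad / 4]. The factorisation holds at every [z], because [slope_decomp] is
    an identity. *)
Lemma zero_order (f : C -> C) (z0 : C) (rad : R) : 0 < rad -> hol f z0 rad ->
  (forall z, Cmod (z - z0) < rad / 2 -> f z = 0) \/
  exists (k : nat) (g : C -> C), hol g z0 rad /\ g z0 <> 0 /\
    forall z, f z = ((z - z0) ^ k * g z)%C.
Proof.
  intros Hr Hf.
  destruct (classic (exists (k : nat) (g : C -> C), hol g z0 rad /\ g z0 <> 0 /\
    forall z, f z = ((z - z0) ^ k * g z)%C)) as [H|Hno]; [now right|]. left.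
  assert (Hall : forall k, exists g, hol g z0 rad /\ forall z, f z = ((z - z0) ^ k * g z)%C).
  { induction k as [|k [g [Hg E]]].
    - exists f. split; [exact Hf|]. intros z. simpl. ring.
    - destruct (classic (g z0 = 0)) as [E0|Hn]; [|exfalso; apply Hno; now exists k, g].
      destruct (Hg z0) as [l Hl]; [rewrite Cmod_sub_0; exact Hr|].
      exists (slope g z0 l). split; [now apply slope_hol|].
      intros z. rewrite E, (slope_decomp g z0 l z), E0. simpl. ring. }
  intros z Hz. set (rho := 3 * rad / 4). assert (Hrho : 0 < rho < rad) by (unfold rho; lra).
  destruct (cts_on_bounded _ 0 (2 * PI) PI2_ge_0 (hol_circ_cts f z0 rad rho ltac:(lra) Hf))
    as [M [HM0 HM]].
  (* Compactness bounds [f] for parameters in one period only, while [cauchy_bound] asks for all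
     [t]; the arc cosine supplies the reduced parameter. *)
  assert (Hper : forall t, exists s, 0 <= s <= 2 * PI /\ circ z0 rho s = circ z0 rho t).
  { intros t. assert (HPI := PI_RGT_0).
    assert (Hcos : -1 <= cos t <= 1) by apply COS_bound.
    assert (Hac := acos_bound (cos t)). assert (Hc := cos_acos (cos t) Hcos).
    assert (Hs : sin (acos (cos t)) = sin t \/ sin (acos (cos t)) = - sin t).
    { assert (h1 := sin2_cos2 t). assert (h2 := sin2_cos2 (acos (cos t))). unfold Rsqr in *.
      rewrite Hc in h2.
      assert (h3 : (sin (acos (cos t)) - sin t) * (sin (acos (cos t)) + sin t) = 0) by nra.
      apply Rmult_integral in h3. destruct h3; [left|right]; lra. }
    destruct Hs as [Hs|Hs].
    - exists (acos (cos t)). split; [lra|]. unfold circ, ei. rewrite Hc, Hs. reflexivity.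
    - exists (2 * PI - acos (cos t)). split; [lra|]. unfold circ, ei.
      rewrite cos_minus, sin_minus, cos_2PI, sin_2PI, Hc, Hs.
      do 2 f_equal. f_equal; ring. }
  assert (HMt : forall t, Cmod (f (circ z0 rho t)) <= M).
  { intros t. destruct (Hper t) as [s [Hs <-]]. now apply HM. }
  set (x := Cmod (z - z0) / rho). assert (hz := Cmod_ge_0 (z - z0)).
  assert (Hx : 0 <= x < 1).
  { unfold x. split; [apply Rmult_le_pos; [lra | left; apply Rinv_0_lt_compat; lra]|].
    apply (Rmult_lt_reg_r rho); [lra|]. unfold Rdiv. rewrite Rmult_assoc, Rinv_l by lra.
    unfold rho. lra. }
  set (A := 2 * M * rho / (rho - Cmod (z - z0))).
  assert (Hzr : Cmod (z - z0) < rho) by (unfold rho; lra).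
  assert (Hdec : forall k, Cmod (f z) <= A * x ^ k).
  { intros k. destruct (Hall k) as [g [Hg E]].
    assert (Hrk : 0 < rho ^ k) by (apply pow_lt; lra).
    assert (Bg : forall t, Cmod (g (circ z0 rho t)) <= M / rho ^ k).
    { intros t. specialize (HMt t). rewrite E, Cmod_mult, Cmod_pow, Cmod_circ in HMt by lra.
      apply (Rmult_le_reg_l (rho ^ k)); [exact Hrk|].
      replace (rho ^ k * (M / rho ^ k)) with M by (field; lra). exact HMt. }
    assert (B := cauchy_bound g z0 z rad rho _ Hrho Hg Bg Hzr).
    rewrite E, Cmod_mult, Cmod_pow.
    apply Rle_trans with (Cmod (z - z0) ^ k * (2 * (M / rho ^ k) * rho / (rho - Cmod (z - z0)))).
    - apply Rmult_le_compat_l; [apply pow_le; lra | exact B].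
    - right. unfold A, x. unfold Rdiv. rewrite Rpow_mult_distr, pow_inv. ring. }
  assert (HA : 0 < A).
  { unfold A. apply Rdiv_lt_0_compat; [|lra]. apply Rmult_lt_0_compat; lra. }
  apply Cmod_eq_0. apply Rle_antisym; [|apply Cmod_ge_0]. apply Rnot_lt_le. intros Hlt.
  destruct (pow_lt_1_zero x ltac:(rewrite Rabs_pos_eq; lra) (Cmod (f z) / A)
    ltac:(now apply Rdiv_lt_0_compat)) as [N HN].
  specialize (HN N (le_n _)). rewrite Rabs_pos_eq in HN by (apply pow_le; lra).
  specialize (Hdec N).
  apply (Rmult_lt_compat_l A) in HN; [|exact HA].
  replace (A * (Cmod (f z) / A)) with (Cmod (f z)) in HN by (field; lra). lra.
Qed.

(** Multiplication by the square of [z - z0] forces the derivative 0 at [z0], whatever [f z0] may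
    be; dividing twice by [z - z0] then gives the extension. *)
Theorem removable (f : C -> C) (z0 : C) (rad M : R) : 0 < rad ->
  (forall z, 0 < Cmod (z - z0) < rad -> exists l, cdiff f z l) ->
  (forall z, 0 < Cmod (z - z0) < rad -> Cmod (f z) <= M) ->
  exists g, hol g z0 rad /\ forall z, z <> z0 -> g z = f z.
Proof.
  intros Hr Hf HM. set (k := fun z => ((z - z0) * (z - z0) * f z)%C).
  assert (Hk0 : cdiff k z0 0).
  { intros e He.
    assert (HM0 : 0 <= M).
    { assert (h := HM (z0 + RtoC (rad / 2))%C).
      replace (z0 + RtoC (rad / 2) - z0)%C with (RtoC (rad / 2)) in h by ring.
      rewrite Cmod_R, Rabs_pos_eq in h by lra.
      eapply Rle_trans; [apply Cmod_ge_0 | apply h; lra]. }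
    assert (Hq : 0 < e / (1 + M)) by (apply Rdiv_lt_0_compat; lra).
    apply locally_Cmod. exists (Rmin rad (e / (1 + M))). split; [now apply Rmin_pos|].
    intros w Hw. assert (H1 := Rlt_le_trans _ _ _ Hw (Rmin_l _ _)).
    assert (H2 := Rlt_le_trans _ _ _ Hw (Rmin_r _ _)).
    unfold k. replace ((w - z0) * (w - z0) * f w - (z0 - z0) * (z0 - z0) * f z0 - 0 * (w - z0))%C
      with ((w - z0) * (w - z0) * f w)%C by ring.
    rewrite !Cmod_mult. assert (h := Cmod_ge_0 (w - z0)).
    destruct (Req_dec (Cmod (w - z0)) 0) as [E|E]; [rewrite E; lra|].
    specialize (HM w ltac:(lra)). assert (hf := Cmod_ge_0 (f w)).
    apply (Rmult_lt_compat_r (1 + M)) in H2; [|lra].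
    replace (e / (1 + M) * (1 + M)) with e in H2 by (field; lra).
    rewrite Rmult_comm, (Rmult_comm e), <- Rmult_assoc, Rmult_comm.
    apply Rmult_le_compat_l; [exact h|]. nra. }
  assert (Hk : hol k z0 rad).
  { intros z Hz. destruct (classic (z = z0)) as [->|Hn]; [now exists (RtoC 0)|].
    destruct (Hf z) as [l Hl]; [split; [now apply Cmod_sub_pos | exact Hz]|].
    eexists. apply (cdiff_mult (fun z => (z - z0) * (z - z0))%C f); [|exact Hl].
    apply (cdiff_mult (fun z => z - z0)%C (fun z => z - z0)%C);
      apply cdiff_minus_const, cdiff_id. }
  set (k1 := slope k z0 0). assert (Hk1 : hol k1 z0 rad) by now apply slope_hol.
  destruct (Hk1 z0) as [l Hl]; [rewrite Cmod_sub_0; exact Hr|].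
  exists (slope k1 z0 l). split; [now apply slope_hol|]. intros z Hz.
  rewrite slope_neq by exact Hz. unfold k1. rewrite slope_eq, slope_neq by exact Hz.
  unfold k. field. now apply Cminus_eq_contra.
Qed.

Lemma sdiff_lipschitz (f : C -> C) (x l : C) : sdiff f x l ->
  exists d, 0 < d /\ forall z w, Cmod (z - x) < d -> Cmod (w - x) < d ->
    Cmod (f z - f w) <= (Cmod l + 1) * Cmod (z - w).
Proof.
  intros H. destruct (H 1 Rlt_0_1) as [d [Hd Hz]]. exists d. split; [exact Hd|].
  intros z w H1 H2. specialize (Hz z w H1 H2).
  replace (f z - f w)%C with ((f z - f w - l * (z - w)) + l * (z - w))%C by ring.
  eapply Rle_trans; [apply Cmod_triangle|]. rewrite Cmod_mult. lra.
Qed.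

(** For a point [w] close enough to [z], the increment from [z] to [w] is approximated both by [m],
    through differentiability at [z], and by [l], through strict differentiability at [x]. *)
Lemma sdiff_near (f : C -> C) (x l : C) (eps : R) : 0 < eps -> sdiff f x l ->
  exists d, 0 < d /\ forall z m, Cmod (z - x) < d -> cdiff f z m -> Cmod (m - l) <= eps.
Proof.
  intros He H. assert (He2 : 0 < eps / 2) by lra.
  destruct (H _ He2) as [d [Hd Hz]]. exists d. split; [exact Hd|].
  intros z m Hzx Hm. destruct (proj1 (locally_Cmod _ _) (Hm _ He2)) as [d' [Hd' Hw]].
  set (s := Rmin d' (d - Cmod (z - x)) / 2).
  assert (Hmin : 0 < Rmin d' (d - Cmod (z - x))) by (apply Rmin_pos; lra).
  assert (m1 := Rmin_l d' (d - Cmod (z - x))). assert (m2 := Rmin_r d' (d - Cmod (z - x))).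
  assert (Es : Cmod (z + RtoC s - z) = s).
  { replace (z + RtoC s - z)%C with (RtoC s) by ring. rewrite Cmod_R.
    apply Rabs_pos_eq. unfold s. lra. }
  set (w := (z + RtoC s)%C) in *.
  assert (A := Hw w ltac:(rewrite Es; unfold s; lra)).
  assert (Hwx : Cmod (w - x) < d).
  { assert (h := Cmod_tri w z x). rewrite Es in h. unfold s in h. lra. }
  assert (B := Hz w z Hwx Hzx).
  assert (T := Cmod_minus_le (f w - f z - l * (w - z)) (f w - f z - m * (w - z))).
  replace (f w - f z - l * (w - z) - (f w - f z - m * (w - z)))%C
    with ((m - l) * (w - z))%C in T by ring.
  rewrite Cmod_mult, Es in T. rewrite Es in A, B.
  assert (Hs : 0 < s) by (unfold s; lra).
  apply (Rmult_le_reg_r s); [exact Hs|]. lra.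
Qed.

Lemma cdiff_pow (z0 z : C) (n : nat) :
  cdiff (fun x => (x - z0) ^ S n)%C z (RtoC (INR (S n)) * (z - z0) ^ n)%C.
Proof.
  induction n as [|n IH].
  - simpl INR. replace (RtoC 1 * (z - z0) ^ 0)%C with (1 * 1 + (z - z0) * 0)%C by (simpl; ring).
    apply (cdiff_mult (fun x => x - z0)%C (fun _ => RtoC 1)); [|apply cdiff_const].
    apply cdiff_minus_const, cdiff_id.
  - replace (RtoC (INR (S (S n))) * (z - z0) ^ S n)%C
      with (1 * (z - z0) ^ S n + (z - z0) * (RtoC (INR (S n)) * (z - z0) ^ n))%C.
    + apply (cdiff_mult (fun x => x - z0)%C (fun x => (x - z0) ^ S n)%C); [|exact IH].
      apply cdiff_minus_const, cdiff_id.
    + rewrite (S_INR (S n)), RtoC_plus. simpl Cpow. ring.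
Qed.

(** The derivative is [(z - z0)^k] times [(k + 1) g(z) + (z - z0) g'(z)], and the first summand
    dominates near [z0]. *)
Lemma noncritical_near (f g : C -> C) (a z0 : C) (rad : R) (k : nat) : 0 < rad ->
  hol g z0 rad -> g z0 <> 0 ->
  (forall z, 0 < Cmod (z - z0) < rad -> f z = (a + (z - z0) ^ S k * g z)%C) ->
  exists d, 0 < d <= rad /\ forall z, 0 < Cmod (z - z0) < d -> exists m, cdiff f z m /\ m <> 0.
Proof.
  intros Hr Hg Hg0 E. destruct (hol_sdiff g z0 rad Hr Hg) as [l Hl].
  destruct (sdiff_near g z0 l 1 Rlt_0_1 Hl) as [d1 [Hd1 H1]].
  assert (Hm := proj1 (Cmod_gt_0 _) Hg0). set (m0 := Cmod (g z0)) in *.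
  assert (Hm2 : 0 < m0 / 2) by lra.
  destruct (proj1 (locally_Cmod _ _) (cdiff_cts _ _ _ (sdiff_cdiff _ _ _ Hl) _ Hm2))
    as [d2 [Hd2 H2]].
  assert (hl := Cmod_ge_0 l). set (B := Cmod l + 1).
  assert (HB : 0 < B) by (unfold B; lra).
  (* Within this distance the term with [g'], bounded by [B] times the distance, stays below
     [m0 / 2], while [Cmod (g z)] exceeds [m0 / 2]. *)
  assert (Hq : 0 < m0 / (2 * B)) by (apply Rdiv_lt_0_compat; lra).
  exists (Rmin (Rmin rad (m0 / (2 * B))) (Rmin d1 d2)).
  split.
  { split; [repeat apply Rmin_pos; assumption|].
    eapply Rle_trans; [apply Rmin_l | apply Rmin_l]. }
  intros z [Hz0 Hz].
  assert (Z1 : Cmod (z - z0) < rad)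
    by (eapply Rlt_le_trans; [exact Hz|]; eapply Rle_trans; [apply Rmin_l | apply Rmin_l]).
  assert (Z2 : Cmod (z - z0) < m0 / (2 * B))
    by (eapply Rlt_le_trans; [exact Hz|]; eapply Rle_trans; [apply Rmin_l | apply Rmin_r]).
  assert (Z3 : Cmod (z - z0) < d1)
    by (eapply Rlt_le_trans; [exact Hz|]; eapply Rle_trans; [apply Rmin_r | apply Rmin_l]).
  assert (Z4 : Cmod (z - z0) < d2)
    by (eapply Rlt_le_trans; [exact Hz|]; eapply Rle_trans; [apply Rmin_r | apply Rmin_r]).
  destruct (Hg z Z1) as [g' Hg'].
  assert (Bg' : Cmod g' <= B).
  { assert (h := H1 z g' Z3 Hg'). assert (h' := Cmod_rev_tri g' l). unfold B. lra. }
  assert (Lg : m0 / 2 < Cmod (g z)).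
  { assert (h := H2 z Z4). assert (h' := Cmod_rev_tri (g z0) (g z)).
    rewrite Cmod_sub_sym in h'. fold m0 in h'. lra. }
  exists ((z - z0) ^ k * (RtoC (INR (S k)) * g z + (z - z0) * g'))%C. split.
  - apply (cdiff_ext_loc (fun x => a + (x - z0) ^ S k * g x)%C).
    + apply locally_Cmod. exists (Rmin (Cmod (z - z0)) (rad - Cmod (z - z0))).
      split; [apply Rmin_pos; lra|]. intros w Hw.
      assert (W1 := Rlt_le_trans _ _ _ Hw (Rmin_l _ _)).
      assert (W2 := Rlt_le_trans _ _ _ Hw (Rmin_r _ _)).
      symmetry. apply E. split.
      * assert (h := Cmod_tri z w z0). rewrite (Cmod_sub_sym z w) in h. lra.
      * assert (h := Cmod_tri w z z0). lra.
    + replace ((z - z0) ^ k * (RtoC (INR (S k)) * g z + (z - z0) * g'))%C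
        with (0 + (RtoC (INR (S k)) * (z - z0) ^ k * g z + (z - z0) ^ S k * g'))%C
        by (rewrite Cpow_S; ring).
      apply (cdiff_plus (fun _ => a) (fun x => (x - z0) ^ S k * g x)%C); [apply cdiff_const|].
      apply (cdiff_mult (fun x => (x - z0) ^ S k)%C g); [apply cdiff_pow | exact Hg'].
  - apply Cmult_neq_0; [apply Cpow_nz; now apply Cmod_pos_neq|].
    apply Cmod_pos_neq.
    assert (h := Cmod_rev_tri (RtoC (INR (S k)) * g z) (- ((z - z0) * g'))).
    replace (RtoC (INR (S k)) * g z - - ((z - z0) * g'))%C
      with (RtoC (INR (S k)) * g z + (z - z0) * g')%C in h by ring.
    rewrite Cmod_opp, !Cmod_mult, Cmod_R, Rabs_pos_eq in h by apply pos_INR.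
    assert (hk : 1 <= INR (S k)) by (rewrite S_INR; assert (h' := pos_INR k); lra).
    assert (hg := Cmod_ge_0 (g z)). assert (hg' := Cmod_ge_0 g').
    apply (Rmult_lt_compat_r (2 * B)) in Z2; [|lra].
    replace (m0 / (2 * B) * (2 * B)) with m0 in Z2 by (field; lra). nra.
Qed.

(** * The inverse function theorem *)

(** Newton iteration with the fixed slope [l] contracts by 1/2. The lower bound gives continuity of
    the inverse as well as injectivity; the free radius [d'] allows preimages to be found in
    prescribed smaller discs. *)
Theorem local_inverse (f : C -> C) (x l : C) : l <> 0 -> sdiff f x l ->
  exists d, 0 < d /\
    (forall z w, Cmod (z - x) < d -> Cmod (w - x) < d ->
       Cmod l / 2 * Cmod (z - w) <= Cmod (f z - f w)) /\
    (forall d' y, 0 < d' <= d -> Cmod (y - f x) < Cmod l * d' / 4 ->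
       exists z, Cmod (z - x) < d' /\ f z = y).
Proof.
  intros Hl Hf. assert (Hm := proj1 (Cmod_gt_0 _) Hl). set (m := Cmod l) in *.
  assert (Hm2 : 0 < m / 2) by lra.
  destruct (Hf _ Hm2) as [d [Hd H]]. exists d. split; [exact Hd|]. split.
  - intros z w Hz Hw. specialize (H z w Hz Hw).
    assert (h := Cmod_rev_tri (l * (z - w)) (f z - f w)). 
    rewrite (Cmod_sub_sym (l * (z - w)) (f z - f w)) in h.
    rewrite Cmod_mult in h. fold m in h. lra.
  - intros d' y Hd' Hy.
    set (T := fun z => (z + (y - f z) / l)%C).
    (* The length of the first Newton step. All later steps add up to a displacement of at most
       [2 * s], which is below [d' / 2]. *)
    set (s := Cmod (y - f x) / m).
    assert (Hs0 : 0 <= s) by (apply Rmult_le_pos; [apply Cmod_ge_0 | left; now apply Rinv_0_lt_compat]).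
    assert (Hs : s < d' / 4).
    { apply (Rmult_lt_reg_r m); [exact Hm|]. unfold s, Rdiv.
      rewrite Rmult_assoc, Rinv_l by lra. lra. }
    set (z := fix z (n : nat) : C := match n with O => x | S k => T (z k) end).
    assert (Hp : forall n, 0 < 2 ^ n) by (intros; apply pow_lt; lra).
    assert (Hst : forall a b, Cmod (a - x) < d -> Cmod (b - x) < d ->
      Cmod (T a - T b) <= Cmod (a - b) / 2).
    { intros a b Ha Hb. unfold T.
      replace (a + (y - f a) / l - (b + (y - f b) / l))%C
        with (- (f a - f b - l * (a - b)) / l)%C by (field; exact Hl).
      rewrite Cmod_div, Cmod_opp by exact Hl. fold m.
      apply (Rmult_le_reg_r m); [exact Hm|]. unfold Rdiv at 1.
      rewrite Rmult_assoc, Rinv_l by lra. assert (h := H a b Ha Hb). lra. }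
    assert (Hz : forall n, Cmod (z n - x) <= 2 * s - 2 * s / 2 ^ n /\
      Cmod (z (S n) - z n) <= s / 2 ^ n).
    { induction n as [|n [IH1 IH2]].
      - simpl. rewrite Cmod_sub_0. split; [lra|]. unfold T.
        replace (x + (y - f x) / l - x)%C with ((y - f x) / l)%C by ring.
        rewrite Cmod_div by exact Hl. fold m s. lra.
      - assert (Hpn := Hp n).
        assert (E1 : 2 * s / 2 ^ S n = s / 2 ^ n) by (simpl; field; lra).
        assert (E2 : s / 2 ^ S n = s / 2 ^ n / 2) by (simpl; field; lra).
        assert (E3 : 2 * s / 2 ^ n = 2 * (s / 2 ^ n)) by (field; lra).
        assert (Hsn : 0 <= s / 2 ^ n)
          by (apply Rmult_le_pos; [lra | left; now apply Rinv_0_lt_compat]).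
        assert (A1 : Cmod (z (S n) - x) <= 2 * s - 2 * s / 2 ^ S n).
        { assert (h := Cmod_tri (z (S n)) (z n) x). lra. }
        split; [exact A1|].
        change (z (S (S n))) with (T (z (S n))). change (z (S n)) with (T (z n)) at 2.
        eapply Rle_trans; [apply Hst; lra|]. lra. }
    destruct (geometric_limit z s (fun n => proj2 (Hz n))) as [zl Hzl].
    assert (Hzx : Cmod (zl - x) < d').
    { assert (h := Hzl O). simpl in h. rewrite Cmod_sub_sym in h. lra. }
    exists zl. split; [exact Hzx|].
    symmetry. apply Cmod_sub_eq. apply Rnot_lt_le. intros Hlt.
    set (e := Cmod (y - f zl)) in *.
    (* The two estimates that follow add up to [5 * m * s * i]; this stays below the bound chosen
       here, and hence below [e]. *)
    destruct (pow2_small (6 * m * (s + 1)) e) as [N HN]; [nra | exact Hlt|].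
    unfold Rdiv in HN. set (i := / 2 ^ N) in *.
    assert (Hi : 0 < i) by apply Rinv_0_lt_compat, Hp.
    destruct (Hz N) as [Z1 Z2]. specialize (Hzl N).
    unfold Rdiv in Z1, Z2, Hzl. fold i in Z1, Z2, Hzl.
    assert (B1 : Cmod (y - f (z N)) <= m * (s * i)).
    { change (z (S N)) with (T (z N)) in Z2. unfold T in Z2.
      replace (z N + (y - f (z N)) / l - z N)%C with ((y - f (z N)) / l)%C in Z2 by ring.
      rewrite Cmod_div in Z2 by exact Hl. fold m in Z2.
      apply (Rmult_le_compat_r m) in Z2; [|lra]. unfold Rdiv in Z2.
      rewrite Rmult_assoc, Rinv_l in Z2 by lra. lra. }
    assert (Hsi : 0 <= s * i) by (apply Rmult_le_pos; lra).
    assert (B2 : Cmod (f (z N) - f zl) <= 2 * m * (2 * s * i)).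
    { assert (h := H (z N) zl ltac:(lra) ltac:(lra)).
      replace (f (z N) - f zl)%C with ((f (z N) - f zl - l * (z N - zl)) + l * (z N - zl))%C by ring.
      eapply Rle_trans; [apply Cmod_triangle|]. rewrite Cmod_mult. fold m.
      assert (h' := Cmod_ge_0 (z N - zl)). nra. }
    assert (T1 := Cmod_tri y (f (z N)) (f zl)). fold e in T1.
    nra.
Qed.

(** * Connectedness *)

Definition open_in (a b : R) (P : R -> Prop) : Prop :=
  forall t, a <= t <= b -> P t ->
    exists d, 0 < d /\ forall s, a <= s <= b -> Rabs (s - t) < d -> P s.

Lemma interval_clopen (a b : R) (P : R -> Prop) : a <= b -> open_in a b P ->
  open_in a b (fun t => ~ P t) -> P a -> P b.
Proof.
  intros Hab Ho Hc Ha.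
  (* Requiring [P] on the whole initial interval makes every point below the supremum of [E] satisfy
     [P]. *)
  set (E := fun t => a <= t <= b /\ forall s, a <= s <= t -> P s).
  assert (Ea : E a) by (split; [lra|]; intros s Hs; replace s with a by lra; exact Ha).
  destruct (completeness E) as [m [Hub Hlub]].
  - exists b. intros t [Ht _]. lra.
  - now exists a.
  - assert (Hma : a <= m) by now apply Hub.
    assert (Hmb : m <= b) by (apply Hlub; intros t [Ht _]; lra).
    assert (Hbelow : forall s, a <= s < m -> P s).
    { intros s Hs. apply NNPP. intros Hn.
      assert (h : m <= s); [|lra]. apply Hlub. intros t [Ht Hall].
      apply Rnot_lt_le. intros Hlt. apply Hn, Hall. lra. }
    assert (Pm : P m).
    { apply NNPP. intros Hn. destruct (Hc m ltac:(lra) Hn) as [d [Hd H]].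
      destruct (Req_dec m a) as [Em|Em]; [subst m; contradiction|].
      set (s := Rmax a (m - d / 2)).
      assert (s1 : a <= s) by apply Rmax_l. assert (s2 : m - d / 2 <= s) by apply Rmax_r.
      assert (s3 : s < m) by (unfold s; apply Rmax_lub_lt; lra).
      apply (H s); [lra | rewrite Rabs_left by lra; lra | now apply Hbelow]. }
    destruct (Ho m ltac:(lra) Pm) as [d [Hd H]].
    destruct (Rle_lt_or_eq_dec m b Hmb) as [Hlt|Heq]; [|now subst m].
    exfalso. set (s := Rmin b (m + d / 2)).
    assert (s1 : s <= b) by apply Rmin_l. assert (s2 : s <= m + d / 2) by apply Rmin_r.
    assert (s3 : m < s) by (unfold s; apply Rmin_glb_lt; lra).
    assert (h : s <= m); [|lra]. apply Hub. split; [lra|]. intros t Ht.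
    destruct (Rlt_le_dec t m) as [h|h]; [apply Hbelow; lra|].
    apply H; [lra|]. rewrite Rabs_pos_eq by lra. lra.
Qed.

Lemma open_in_sub (a b a' b' : R) (P : R -> Prop) : a <= a' -> b' <= b ->
  open_in a b P -> open_in a' b' P.
Proof.
  intros Ha Hb H t Ht HP. destruct (H t ltac:(lra) HP) as [d [Hd Hs]].
  exists d. split; [exact Hd|]. intros s Hs1. apply Hs. lra.
Qed.

Lemma interval_clopen_all (a b : R) (P : R -> Prop) (t1 t2 : R) : open_in a b P ->
  open_in a b (fun t => ~ P t) -> a <= t1 <= b -> a <= t2 <= b -> P t1 -> P t2.
Proof.
  intros Ho Hc H1 H2 HP. destruct (Rle_lt_dec t1 t2) as [h|h].
  - apply (interval_clopen t1 t2 P h); try (apply (open_in_sub a b); auto; lra). exact HP.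
  - apply NNPP. intros Hn.
    apply (interval_clopen t2 t1 (fun t => ~ P t)); try lra; auto.
    + apply (open_in_sub a b); auto; lra.
    + apply (open_in_sub a b); try lra. intros t Ht HPt.
      destruct (Ho t Ht (NNPP _ HPt)) as [d [Hd Hs]]. exists d. split; [exact Hd|]. 
      intros s Hs1 Hs2 Hns. apply Hns. now apply Hs.
Qed.

Lemma Cconnected_union (A B : C -> Prop) (p : C) : Cconnected A -> Cconnected B ->
  A p -> B p -> Cconnected (fun z => A z \/ B z).
Proof.
  intros HA HB Ap Bp O1 O2 H1 H2 Hcov [x [Hx Ox]] [y [Hy Oy]].
  assert (KA : (exists z, A z /\ O1 z) -> (exists z, A z /\ O2 z) ->
    exists z, (A z \/ B z) /\ O1 z /\ O2 z).
  { intros E1 E2. destruct (HA O1 O2 H1 H2) as [z [Az Oz]]; auto. exists z. auto. }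
  assert (KB : (exists z, B z /\ O1 z) -> (exists z, B z /\ O2 z) ->
    exists z, (A z \/ B z) /\ O1 z /\ O2 z).
  { intros E1 E2. destruct (HB O1 O2 H1 H2) as [z [Az Oz]]; auto. exists z. auto. }
  destruct (Hcov p (or_introl Ap)) as [Op|Op].
  - destruct Hy as [Hy|Hy]; [apply KA | apply KB]; eauto.
  - destruct Hx as [Hx|Hx]; [apply KA | apply KB]; eauto.
Qed.

Definition component (S : C -> Prop) (p z : C) : Prop :=
  exists M, Cconnected M /\ (forall x, M x -> S x) /\ M p /\ M z.

Lemma component_refl (S : C -> Prop) (p : C) : S p -> component S p p.
Proof.
  intros Hp. exists (fun z => z = p). split; [|split; [|auto]].
  - intros O1 O2 _ _ _ [x [-> H1]] [y [-> H2]]. now exists p.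
  - intros x ->. exact Hp.
Qed.

Lemma component_correct (S : C -> Prop) (p : C) : S p ->
  connected_component_of S (component S p).
Proof.
  intros Hp. split; [exists p; now apply component_refl|]. split; [|split].
  - intros z [M [_ [HS [_ Mz]]]]. now apply HS.
  - intros O1 O2 H1 H2 Hcov [x [[Mx [CMx [SMx [Mxp Mxx]]]] Ox]] [y [[My [CMy [SMy [Myp Myy]]]] Oy]].
    assert (KM : forall M, Cconnected M -> (forall z, M z -> S z) -> M p ->
      (exists z, M z /\ O1 z) -> (exists z, M z /\ O2 z) ->
      exists z, component S p z /\ O1 z /\ O2 z).
    { intros M CM SM Mp E1 E2.
      destruct (CM O1 O2 H1 H2) as [z [Mz Oz]]; auto.
      - intros z Mz. apply Hcov. exists M. auto.
      - exists z. split; [|exact Oz]. exists M. auto. }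
    destruct (Hcov p (component_refl S p Hp)) as [Op|Op].
    + apply (KM My); eauto.
    + apply (KM Mx); eauto.
  - intros M HLM HMS CM z Mz. exists M. split; [exact CM|]. split; [exact HMS|].
    split; [|exact Mz]. apply HLM. now apply component_refl.
Qed.

(** The union of [A], [L1] and [L2] is connected, so each component contains the other by
    maximality. This is the pigeonhole tool: a connected coloured set meets only one line. *)
Lemma component_unique (S A L1 L2 : C -> Prop) (x y : C) :
  connected_component_of S L1 -> connected_component_of S L2 ->
  Cconnected A -> (forall z, A z -> S z) -> A x -> L1 x -> A y -> L2 y -> L1 = L2.
Proof.
  intros [_ [S1 [C1 M1]]] [_ [S2 [C2 M2]]] CA SA Ax L1x Ay L2y.
  assert (C1A := Cconnected_union A L1 x CA C1 Ax L1x).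
  assert (CU := Cconnected_union _ L2 y C1A C2 (or_introl Ay) L2y).
  assert (SU : forall z, (A z \/ L1 z) \/ L2 z -> S z) by (intros z [[H|H]|H]; auto).
  apply functional_extensionality. intros z. apply propositional_extensionality. split.
  - intros Hz. apply (M2 _ (fun w H => or_intror H) SU CU). auto.
  - intros Hz. apply (M1 _ (fun w H => or_introl (or_intror H)) SU CU). auto.
Qed.

Lemma curve_connected (s : R -> C) (a b : R) :
  (forall t, a < t < b -> cts (U := R_UniformSpace) s t) ->
  Cconnected (fun z => exists t, a < t < b /\ z = s t).
Proof.
  intros Hs O1 O2 H1 H2 Hcov [x [[t1 [Ht1 ->]] Ox]] [y [[t2 [Ht2 ->]] Oy]].
  apply NNPP. intros Hno.
  set (lo := Rmin t1 t2). set (hi := Rmax t1 t2).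
  assert (Hlo : lo <= t1 /\ lo <= t2 /\ a < lo).
  { unfold lo. split; [apply Rmin_l|]. split; [apply Rmin_r|]. apply Rmin_glb_lt; lra. }
  assert (Hhi : t1 <= hi /\ t2 <= hi /\ hi < b).
  { unfold hi. split; [apply Rmax_l|]. split; [apply Rmax_r|]. apply Rmax_lub_lt; lra. }
  assert (K : forall O : C -> Prop, Copen O -> open_in lo hi (fun t => O (s t))).
  { intros O HO t Ht Ot. destruct (HO (s t) Ot) as [e [He HOe]].
    destruct (proj1 (locally_Rabs _ _) (Hs t ltac:(lra) e He)) as [d [Hd H]].
    exists d. split; [exact Hd|]. intros u _ Hu. apply HOe. apply H. exact Hu. }
  assert (Hdis : forall t, lo <= t <= hi -> (~ O1 (s t) <-> O2 (s t))).
  { intros t Ht. split.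
    - intros Hn. destruct (Hcov (s t)) as [h|h]; [|contradiction|exact h].
      exists t. split; [lra | reflexivity].
    - intros h2 h1. apply Hno. exists (s t). split; [|auto]. exists t. split; [lra | reflexivity]. }
  apply (proj2 (Hdis t2 ltac:(lra)) Oy).
  apply (interval_clopen_all lo hi (fun t => O1 (s t)) t1 t2); auto; try lra.
  intros t Ht Hn. apply (Hdis t Ht) in Hn.
  destruct (K O2 H2 t Ht Hn) as [d [Hd H]]. exists d. split; [exact Hd|].
  intros u Hu Hut. apply (Hdis u Hu). now apply H.
Qed.

(** * Isochromatic arcs *)

(** The phase condition is written without division, so that it can be used to rewrite [f z]. *)
Definition colored (f : C -> C) (z0 : C) (r : R) (c z : C) : Prop :=
  0 < Cmod (z - z0) < r /\ f z <> 0 /\ (exists l, cdiff f z l /\ l <> 0) /\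
  f z = (c * RtoC (Cmod (f z)))%C.

Lemma hol_punctured (f : C -> C) (z0 : C) (r : R) (p : C) :
  (forall z, 0 < Cmod (z - z0) < r -> exists l, cdiff f z l) -> 0 < Cmod (p - z0) < r ->
  exists d, 0 < d /\ (forall z, Cmod (z - p) < d -> 0 < Cmod (z - z0) < r) /\ hol f p d.
Proof.
  intros Hf Hp. exists (Rmin (Cmod (p - z0)) (r - Cmod (p - z0))).
  assert (K : forall z, Cmod (z - p) < Rmin (Cmod (p - z0)) (r - Cmod (p - z0)) ->
    0 < Cmod (z - z0) < r).
  { intros w Hw. assert (W1 := Rlt_le_trans _ _ _ Hw (Rmin_l _ _)).
    assert (W2 := Rlt_le_trans _ _ _ Hw (Rmin_r _ _)). split.
    - assert (h := Cmod_tri p w z0). rewrite (Cmod_sub_sym p w) in h. lra.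
    - assert (h := Cmod_tri w p z0). lra. }
  split; [apply Rmin_pos; lra|]. split; [exact K|]. intros z Hz. now apply Hf, K.
Qed.

Lemma noncritical_sdiff (f : C -> C) (z0 : C) (r : R) (p l : C) :
  (forall z, 0 < Cmod (z - z0) < r -> exists l, cdiff f z l) -> 0 < Cmod (p - z0) < r ->
  cdiff f p l -> sdiff f p l.
Proof.
  intros Hf Hp Hl. destruct (hol_punctured f z0 r p Hf Hp) as [d [Hd [_ Hh]]].
  destruct (hol_sdiff f p d Hd Hh) as [m Hm].
  rewrite (cdiff_unique f p l m Hl (sdiff_cdiff _ _ _ Hm)). exact Hm.
Qed.

Section Arcs.
Variables (f : C -> C) (z0 c : C) (r : R).
Hypothesis f_diff : forall z, 0 < Cmod (z - z0) < r -> exists l, cdiff f z l.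
Hypothesis c_unit : Cmod c = 1.

Let S := colored f z0 r c.

(** The parameter is forced to be [Cmod (f (s t))], so two arcs through the same point reach it at
    the same parameter and can be glued without reparametrisation. *)
Definition is_arc (a b : R) (s : R -> C) : Prop :=
  forall t, a < t < b -> S (s t) /\ f (s t) = (c * RtoC t)%C /\ cts (U := R_UniformSpace) s t.

Lemma noncritical_local (p l : C) : 0 < Cmod (p - z0) < r -> cdiff f p l -> l <> 0 ->
  exists d, 0 < d /\
    (forall z, Cmod (z - p) < d -> 0 < Cmod (z - z0) < r /\ exists m, cdiff f z m /\ m <> 0) /\
    (forall z w, Cmod (z - p) < d -> Cmod (w - p) < d ->
       Cmod l / 2 * Cmod (z - w) <= Cmod (f z - f w)) /\
    (forall d' y, 0 < d' <= d -> Cmod (y - f p) < Cmod l * d' / 4 ->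
       exists z, Cmod (z - p) < d' /\ f z = y).
Proof.
  intros Hp Hl Hl0. assert (Hs := noncritical_sdiff f z0 r p l f_diff Hp Hl).
  destruct (local_inverse f p l Hl0 Hs) as [d0 [Hd0 [Hinj Hsur]]].
  destruct (hol_punctured f z0 r p f_diff Hp) as [d1 [Hd1 [Hin _]]].
  assert (Hm := proj1 (Cmod_gt_0 _) Hl0).
  assert (Hm2 : 0 < Cmod l / 2) by lra.
  destruct (sdiff_near f p l _ Hm2 Hs) as [d2 [Hd2 Hnear]].
  exists (Rmin d0 (Rmin d1 d2)).
  assert (h0 := Rmin_l d0 (Rmin d1 d2)). assert (h0' := Rmin_r d0 (Rmin d1 d2)).
  assert (h1 := Rmin_l d1 d2). assert (h2 := Rmin_r d1 d2).
  split; [repeat apply Rmin_pos; assumption|]. split; [|split].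
  - intros z Hz. assert (Hz1 : 0 < Cmod (z - z0) < r) by (apply Hin; lra).
    split; [exact Hz1|]. destruct (f_diff z Hz1) as [m Hmz]. exists m. split; [exact Hmz|].
    apply Cmod_pos_neq. assert (h := Hnear z m ltac:(lra) Hmz).
    assert (h' := Cmod_rev_tri l m). rewrite Cmod_sub_sym in h'. lra.
  - intros z w Hz Hw. apply Hinj; lra.
  - intros d' y Hd' Hy. apply Hsur; lra.
Qed.

Lemma Cmod_color (t : R) : 0 <= t -> Cmod (c * RtoC t) = t.
Proof. intros Ht. rewrite Cmod_mult, c_unit, Cmod_R, Rabs_pos_eq by exact Ht. ring. Qed.

Lemma color_sub (t u : R) : Cmod (c * RtoC t - c * RtoC u) = Rabs (t - u).
Proof.
  replace (c * RtoC t - c * RtoC u)%C with (c * RtoC (t - u))%C by (rewrite RtoC_minus; ring).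
  rewrite Cmod_mult, c_unit, Cmod_R. ring.
Qed.

Lemma color_inj (t u : R) : (c * RtoC t)%C = (c * RtoC u)%C -> t = u.
Proof.
  intros E. assert (h := color_sub t u). rewrite E, Cmod_sub_0 in h.
  symmetry in h. apply Rabs_eq_0 in h. lra.
Qed.

(** The arc is the local inverse of [f] along the ray of colour [c]. By local injectivity it
    contains every coloured point close to [p], which is what makes reachability by arcs an open
    condition. *)
Lemma local_arc (p : C) : S p -> exists a b s d, 0 < d /\ is_arc a b s /\
  forall q, S q -> Cmod (q - p) < d -> exists t, a < t < b /\ s t = q.
Proof.
  intros [Hp [Hp0 [[l [Hl Hl0]] Hpc]]].
  destruct (noncritical_local p l Hp Hl Hl0) as [d [Hd [Hin [Hinj Hsur]]]].
  assert (Hm := proj1 (Cmod_gt_0 _) Hl0). assert (Ht0 := proj1 (Cmod_gt_0 _) Hp0).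
  set (t0 := Cmod (f p)) in *. set (m := Cmod l) in *.
  (* The first bound keeps [c t] in the range of the local inverse; the second keeps [t] positive,
     so that the point has colour [c]. *)
  set (e := Rmin (m * d / 4) t0).
  assert (Hmd : 0 < m * d) by now apply Rmult_lt_0_compat.
  assert (He : 0 < e) by (apply Rmin_pos; lra).
  assert (He1 : e <= m * d / 4) by apply Rmin_l. assert (He2 : e <= t0) by apply Rmin_r.
  assert (Hex : forall t, exists z, Rabs (t - t0) < e -> Cmod (z - p) < d /\ f z = (c * RtoC t)%C).
  { intros t. destruct (Rlt_le_dec (Rabs (t - t0)) e) as [h|h].
    - destruct (Hsur d (c * RtoC t)%C) as [z Hz]; [lra| |now exists z].
      rewrite Hpc, color_sub. fold m. lra.
    - exists p. lra. }
  set (s := fun t => proj1_sig (constructive_indefinite_description _ (Hex t))).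
  assert (Hs : forall t, Rabs (t - t0) < e -> Cmod (s t - p) < d /\ f (s t) = (c * RtoC t)%C).
  { intros t. unfold s. destruct (constructive_indefinite_description _ (Hex t)) as [z Hz].
    exact Hz. }
  destruct (proj1 (locally_Cmod _ _) (cdiff_cts _ _ _ Hl e He)) as [d1 [Hd1 Hc]].
  exists (t0 - e), (t0 + e), s, (Rmin d d1). split; [now apply Rmin_pos|]. split.
  - intros t Ht. assert (Hte : Rabs (t - t0) < e) by (apply Rabs_def1; lra).
    destruct (Hs t Hte) as [Hd' Hft]. destruct (Hin _ Hd') as [Hpu Hnc].
    assert (Htp : 0 < t) by lra.
    split; [|split; [exact Hft|]].
    + split; [exact Hpu|]. split; [|split; [exact Hnc|]].
      * rewrite Hft. apply Cmod_pos_neq. rewrite Cmod_color; lra.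
      * rewrite Hft, Cmod_color; [reflexivity | lra].
    + intros eps Heps. apply locally_Rabs.
      exists (Rmin (e - Rabs (t - t0)) (eps * (m / 2))).
      split; [apply Rmin_pos; [lra | apply Rmult_lt_0_compat; lra]|].
      intros u Hu. assert (U1 := Rlt_le_trans _ _ _ Hu (Rmin_l _ _)).
      assert (U2 := Rlt_le_trans _ _ _ Hu (Rmin_r _ _)).
      assert (Hue : Rabs (u - t0) < e).
      { replace (u - t0) with ((u - t) + (t - t0)) by ring.
        eapply Rle_lt_trans; [apply Rabs_triang|]. lra. }
      destruct (Hs u Hue) as [Hdu Hfu].
      assert (h := Hinj (s u) (s t) Hdu Hd'). rewrite Hfu, Hft, color_sub in h. fold m in h.
      apply (Rmult_lt_reg_l (m / 2)); [lra|]. lra.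
  - intros q [Hq [Hq0 [_ Hqc]]] Hqp.
    assert (Q1 := Rlt_le_trans _ _ _ Hqp (Rmin_l _ _)).
    assert (Q2 := Rlt_le_trans _ _ _ Hqp (Rmin_r _ _)).
    specialize (Hc q Q2). rewrite Hqc, Hpc, color_sub in Hc. fold t0 in Hc.
    exists (Cmod (f q)). assert (Hc' := Rabs_def2 _ _ Hc). split; [lra|].
    destruct (Hs _ Hc) as [Hd' Hft]. apply Cmod_sub_eq.
    assert (h := Hinj _ _ Hd' Q1). rewrite Hft, <- Hqc, Cmod_sub_0 in h. fold m in h.
    apply (Rmult_le_reg_l (m / 2)); lra.
Qed.

(** The set of parameters where the arcs agree is closed by continuity. It is open because [f] takes
    the same value on both arcs and is locally injective. *)
Lemma arc_agree (a b a' b' : R) (s s' : R -> C) (t1 t2 : R) : is_arc a b s -> is_arc a' b' s' ->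
  a < t1 < b -> a' < t1 < b' -> a < t2 < b -> a' < t2 < b' -> s t1 = s' t1 -> s t2 = s' t2.
Proof.
  intros Hs Hs' H1 H1' H2 H2' E.
  set (lo := Rmin t1 t2). set (hi := Rmax t1 t2).
  assert (Hlo : lo <= t1 /\ lo <= t2 /\ a < lo /\ a' < lo).
  { unfold lo. split; [apply Rmin_l|]. split; [apply Rmin_r|]. split; apply Rmin_glb_lt; lra. }
  assert (Hhi : t1 <= hi /\ t2 <= hi /\ hi < b /\ hi < b').
  { unfold hi. split; [apply Rmax_l|]. split; [apply Rmax_r|]. split; apply Rmax_lub_lt; lra. }
  apply (interval_clopen_all lo hi (fun t => s t = s' t) t1 t2); try lra; [| |exact E].
  - intros t Ht Et. destruct (Hs t ltac:(lra)) as [[Hp [_ [[l [Hl Hl0]] _]]] [_ Hc]].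
    destruct (Hs' t ltac:(lra)) as [_ [_ Hc']].
    destruct (noncritical_local _ l Hp Hl Hl0) as [d [Hd [_ [Hinj _]]]].
    destruct (proj1 (locally_Rabs _ _) (filter_and _ _ (Hc d Hd) (Hc' d Hd))) as [d' [Hd' Hu]].
    exists d'. split; [exact Hd'|]. intros u Hul Hut. destruct (Hu u Hut) as [U1 U2].
    rewrite <- Et in U2. apply Cmod_sub_eq.
    assert (h := Hinj _ _ U1 U2).
    destruct (Hs u ltac:(lra)) as [_ [E1 _]]. destruct (Hs' u ltac:(lra)) as [_ [E2 _]].
    rewrite E1, E2, Cmod_sub_0 in h. assert (Hm := proj1 (Cmod_gt_0 _) Hl0).
    apply (Rmult_le_reg_l (Cmod l / 2)); lra.
  - intros t Ht Hn. assert (Hp := Cmod_sub_pos _ _ Hn).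
    destruct (Hs t ltac:(lra)) as [_ [_ Hc]]. destruct (Hs' t ltac:(lra)) as [_ [_ Hc']].
    assert (He : 0 < Cmod (s t - s' t) / 2) by lra.
    destruct (proj1 (locally_Rabs _ _) (filter_and _ _ (Hc _ He) (Hc' _ He))) as [d' [Hd' Hu]].
    exists d'. split; [exact Hd'|]. intros u _ Hut Eu. destruct (Hu u Hut) as [U1 U2].
    rewrite Eu in U1. assert (T := Cmod_tri (s t) (s' u) (s' t)).
    rewrite (Cmod_sub_sym (s t) (s' u)) in T. lra.
Qed.

Lemma arc_union (a b a' b' : R) (s s' : R -> C) (t1 : R) : is_arc a b s -> is_arc a' b' s' ->
  a < t1 < b -> a' < t1 < b' -> s t1 = s' t1 ->
  exists A B u, is_arc A B u /\ (forall t, a < t < b -> A < t < B /\ u t = s t) /\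
    (forall t, a' < t < b' -> A < t < B /\ u t = s' t).
Proof.
  intros Hs Hs' H1 H1' E.
  set (u := fun t => if Rlt_dec a t then if Rlt_dec t b then s t else s' t else s' t).
  assert (Us : forall t, a < t < b -> u t = s t).
  { intros t Ht. unfold u. destruct (Rlt_dec a t); [|lra]. destruct (Rlt_dec t b); [|lra].
    reflexivity. }
  assert (Us' : forall t, a' < t < b' -> u t = s' t).
  { intros t Ht. unfold u. destruct (Rlt_dec a t); [|reflexivity].
    destruct (Rlt_dec t b); [|reflexivity].
    apply (arc_agree a b a' b' s s' t1 t Hs Hs'); auto; lra. }
  assert (A1 := Rmin_l a a'). assert (A2 := Rmin_r a a').
  assert (B1 := Rmax_l b b'). assert (B2 := Rmax_r b b').
  assert (K : forall a0 b0 s0, is_arc a0 b0 s0 -> (forall t, a0 < t < b0 -> u t = s0 t) ->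
    forall t, a0 < t < b0 -> S (u t) /\ f (u t) = (c * RtoC t)%C /\ cts (U := R_UniformSpace) u t).
  { intros a0 b0 s0 H0 E0 t Ht. destruct (H0 t Ht) as [I1 [I2 I3]].
    rewrite E0 by exact Ht. split; [exact I1|]. split; [exact I2|].
    apply (cts_ext_loc s0); [|exact I3]. apply locally_Rabs.
    exists (Rmin (t - a0) (b0 - t)). split; [apply Rmin_pos; lra|]. intros v Hv.
    assert (V1 := Rlt_le_trans _ _ _ Hv (Rmin_l _ _)).
    assert (V2 := Rlt_le_trans _ _ _ Hv (Rmin_r _ _)).
    apply Rabs_def2 in V1. apply Rabs_def2 in V2. symmetry. apply E0. lra. }
  exists (Rmin a a'), (Rmax b b'), u. split; [|split].
  - intros t [Ht1 Ht2].
    assert (Hor : a < t < b \/ a' < t < b').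
    { unfold Rmin in Ht1. unfold Rmax in Ht2.
      destruct (Rle_dec a a'), (Rle_dec b b'); destruct (Rlt_dec a t), (Rlt_dec t b);
        try (left; lra); right; lra. }
    destruct Hor as [Ht|Ht]; [now apply (K a b s) | now apply (K a' b' s')].
  - intros t Ht. split; [lra | now apply Us].
  - intros t Ht. split; [lra | now apply Us'].
Qed.

(* [|f|] is a local coordinate on the coloured set, so the points that can be joined to [p] by an
   arc parametrised by [|f|] form a relatively open and closed set. *)
Theorem connected_inj (L : C -> Prop) (p q : C) : Cconnected L -> (forall z, L z -> S z) ->
  L p -> L q -> f p = f q -> p = q.
Proof.
  intros CL LS Lp Lq Epq.
  set (A := fun z => exists a b s t t', is_arc a b s /\ (a < t < b /\ s t = p) /\
    (a < t' < b /\ s t' = z)).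
  (* Membership in [A] is constant on small pieces of the coloured set: an arc reaching one point is
     prolonged by the local arc through [z], which contains all its neighbours. *)
  assert (Step : forall z, S z -> exists d, 0 < d /\ forall x y, S x -> S y ->
    Cmod (x - z) < d -> Cmod (y - z) < d -> A x -> A y).
  { intros z Sz. destruct (local_arc z Sz) as [a [b [s [d [Hd [Hs Hcov]]]]]].
    exists d. split; [exact Hd|]. intros x y Sx Sy Hx Hy [a1 [b1 [s1 [t [t' [H1 [[Ht Ep] [Ht' Ex]]]]]]]].
    destruct (Hcov x Sx Hx) as [tx [Htx Esx]]. destruct (Hcov y Sy Hy) as [ty [Hty Esy]].
    assert (Et : t' = tx).
    { apply color_inj. destruct (H1 t' Ht') as [_ [F1 _]]. destruct (Hs tx Htx) as [_ [F2 _]].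
      rewrite <- F1, <- F2, Ex, Esx. reflexivity. }
    subst tx.
    destruct (arc_union a1 b1 a b s1 s t' H1 Hs Ht' Htx) as [A0 [B0 [u [Hu [U1 U2]]]]].
    { now rewrite Ex, Esx. }
    exists A0, B0, u, t, ty. split; [exact Hu|].
    destruct (U1 t Ht) as [V1 V2]. destruct (U2 ty Hty) as [V3 V4].
    split; (split; [assumption|]); congruence. }
  assert (Ap : A p).
  { destruct (local_arc p (LS p Lp)) as [a [b [s [d [Hd [Hs Hcov]]]]]].
    destruct (Hcov p (LS p Lp)) as [t [Ht Et]]; [rewrite Cmod_sub_0; exact Hd|].
    exists a, b, s, t, t. auto. }
  (* [A] is open and closed only relative to [S], whereas [Cconnected] speaks of open sets of the
     plane; these neighbourhoods are open and have the required traces on [S]. *)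
  set (nbh := fun (P : C -> Prop) z => exists x d, 0 < d /\ Cmod (z - x) < d /\
    forall y, S y -> Cmod (y - x) < d -> P y).
  assert (Hop : forall P, Copen (nbh P)).
  { intros P z [x [d [Hd [Hz HP]]]]. exists (d - Cmod (z - x)). split; [change Cnorm with Cmod; lra|].
    intros w Hw. exists x, d. split; [exact Hd|]. split; [|exact HP].
    change (Cmod (w - z) < d - Cmod (z - x)) in Hw.
    assert (h := Cmod_tri w z x). lra. }
  assert (Aq : A q).
  { apply NNPP. intros Hn.
    destruct (CL (nbh A) (nbh (fun z => ~ A z)) (Hop _) (Hop _)) as [z [Lz [[x [d [Hd [Hz HP]]]] [x' [d' [Hd' [Hz' HP']]]]]]].
    - intros z Lz. destruct (Step z (LS z Lz)) as [d [Hd Hst]].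
      assert (Hzz : Cmod (z - z) < d) by (rewrite Cmod_sub_0; exact Hd).
      destruct (classic (A z)) as [Az|Az]; [left|right]; exists z, d;
        split; auto; split; auto; intros y Sy Hy.
      + exact (Hst z y (LS z Lz) Sy Hzz Hy Az).
      + intros Ay. exact (Az (Hst y z Sy (LS z Lz) Hy Hzz Ay)).
    - exists p. split; [exact Lp|]. destruct (Step p (LS p Lp)) as [d [Hd Hst]].
      assert (Hzz : Cmod (p - p) < d) by (rewrite Cmod_sub_0; exact Hd).
      exists p, d. split; auto. split; auto. intros y Sy Hy.
      exact (Hst p y (LS p Lp) Sy Hzz Hy Ap).
    - exists q. split; [exact Lq|]. destruct (Step q (LS q Lq)) as [d [Hd Hst]].
      assert (Hzz : Cmod (q - q) < d) by (rewrite Cmod_sub_0; exact Hd).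
      exists q, d. split; auto. split; auto. intros y Sy Hy Ay.
      exact (Hn (Hst y q Sy (LS q Lq) Hy Hzz Ay)).
    - apply (HP' z (LS z Lz) Hz'). exact (HP z (LS z Lz) Hz). }
  (* On a single arc the value of [f] determines the parameter, so equal values force equal
     points. *)
  destruct Aq as [a [b [s [t [t' [Hs [[Ht Ep] [Ht' Eq]]]]]]]].
  assert (Et : t = t').
  { apply color_inj. destruct (Hs t Ht) as [_ [F1 _]]. destruct (Hs t' Ht') as [_ [F2 _]].
    rewrite <- F1, <- F2, Ep, Eq. exact Epq. }
  congruence.
Qed.

End Arcs.

(** * Agreement with the given definitions *)

(** The two arithmetics of pairs are convertible, so only the forms of the limit have to be
    compared; half of [e] turns the weak inequality for remainders into a strict one. *)
Lemma is_cderiv_cdiff (f : C -> C) (z l : C) : is_cderiv f z l <-> cdiff f z l.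
Proof.
  split.
  - intros H e He. destruct (H e He) as [d [Hd Hh]]. apply locally_Cmod. exists d.
    split; [exact Hd|]. intros w Hw. destruct (classic (w = z)) as [->|Hn].
    + replace (f z - f z - l * (z - z))%C with (RtoC 0) by ring.
      rewrite Cmod_0, Cmod_sub_0. lra.
    + assert (Hp := Cmod_sub_pos _ _ Hn).
      assert (h : Cmod ((f (z + (w - z))%C - f z) / (w - z) - l) < e)
        by exact (Hh (w - z)%C (conj Hp Hw)).
      replace (z + (w - z))%C with w in h by ring.
      replace (f w - f z - l * (w - z))%C
        with (((f w - f z) / (w - z) - l) * (w - z))%C
        by (field; now apply Cminus_eq_contra).
      rewrite Cmod_mult. apply Rmult_le_compat_r; lra.
  - intros H e He. assert (He2 : 0 < e / 2) by lra.
    destruct (proj1 (locally_Cmod _ _) (H _ He2)) as [d [Hd Hw]]. exists d.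
    split; [exact Hd|]. intros h0 [Hh0 Hh]. set (h := h0 : C). change (Cmod h < d) in Hh. change (0 < Cmod h) in Hh0.
    change (Cmod ((f (z + h)%C - f z) / h - l) < e). clearbody h. clear h0.
    assert (Hn : h <> RtoC 0) by now apply Cmod_pos_neq.
    specialize (Hw (z + h)%C). replace (z + h - z)%C with h in Hw by ring. specialize (Hw Hh).
    replace ((f (z + h)%C - f z) / h - l)%C with ((f (z + h)%C - f z - l * h) / h)%C
      by (field; exact Hn).
    rewrite Cmod_div by exact Hn. apply (Rmult_lt_reg_r (Cmod h)); [exact Hh0|].
    unfold Rdiv. rewrite Rmult_assoc, Rinv_l by lra. nra.
Qed.

Lemma analytic_cdiff (U : C -> Prop) (f : C -> C) :
  analytic_on U f <-> forall z, U z -> exists l, cdiff f z l.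
Proof.
  split; intros H z Hz; destruct (H z Hz) as [l Hl]; exists l; now apply is_cderiv_cdiff.
Qed.

Lemma color_set_colored (f : C -> C) (z0 : C) (r : R) (c z : C) :
  color_set f z0 r c z <-> colored f z0 r c z.
Proof.
  assert (K : f z <> RtoC 0 ->
    (phase f z = c <-> f z = (c * RtoC (Cmod (f z)))%C)).
  { intros Hn. assert (Hm := proj1 (Cmod_gt_0 _) Hn).
    assert (Hn2 : RtoC (Cmod (f z)) <> 0) by (intros E; apply RtoC_inj in E; lra).
    change (@eq C (f z / RtoC (Cmod (f z)))%C c <-> f z = (c * RtoC (Cmod (f z)))%C). split.
    - intros <-. field. exact Hn2.
    - intros E. apply (Cmult_cancel_l (RtoC (Cmod (f z)))); [exact Hn2|].
      rewrite (Cmult_comm _ c), <- E. field. exact Hn2. }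
  split; intros [Hz [Hn [[l [Hl Hl0]] Hc]]].
  - split; [exact Hz|]. split; [exact Hn|]. split.
    + exists l. split; [now apply is_cderiv_cdiff | exact Hl0].
    + now apply K.
  - split; [exact Hz|]. split; [exact Hn|]. split.
    + exists l. split; [now apply is_cderiv_cdiff | exact Hl0].
    + now apply K.
Qed.

(** * Baire's theorem *)

(** Nested closed discs, the next one inside [G n] and with at most half the radius, so that the
    centres converge geometrically. *)
Theorem baire (G : nat -> C -> Prop) : (forall n, Copen (G n)) ->
  (forall n a d, 0 < d -> exists w, Cmod (w - a) < d /\ G n w) ->
  forall a d, 0 < d -> exists w, Cmod (w - a) < d /\ forall n, G n w.
Proof.
  intros Hop Hden a d Hd.
  assert (step : forall n (p : C * R), exists q : C * R, 0 < snd p ->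
    0 < snd q <= snd p / 2 /\
    forall w, Cmod (w - fst q) <= snd q -> Cmod (w - fst p) < snd p /\ G n w).
  { intros n [b e]. simpl. destruct (Rlt_le_dec 0 e) as [He|He].
    - destruct (Hden n b e He) as [w [Hw Gw]]. destruct (Hop n w Gw) as [e1 [He1 HG]].
      (* The three bounds halve the radius, keep the closed disc inside [G n], and keep it inside
         the previous open disc. *)
      set (e2 := Rmin (e / 2) (Rmin (e1 / 2) ((e - Cmod (w - b)) / 2))).
      assert (h1 : e2 <= e / 2) by apply Rmin_l.
      assert (h2 : e2 <= e1 / 2)
        by (unfold e2; eapply Rle_trans; [apply Rmin_r | apply Rmin_l]).
      assert (h3 : e2 <= (e - Cmod (w - b)) / 2)
        by (unfold e2; eapply Rle_trans; [apply Rmin_r | apply Rmin_r]).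
      assert (h4 : 0 < e2) by (unfold e2; repeat apply Rmin_pos; lra).
      exists (w, e2). simpl. intros _. split; [lra|]. intros v Hv. split.
      + assert (h := Cmod_tri v w b). lra.
      + apply HG. change (Cmod (v - w) < e1). lra.
    - exists (b, e). intros h. lra. }
  set (nxt := fun n p => proj1_sig (constructive_indefinite_description _ (step n p))).
  set (sq := fix sq (n : nat) : C * R := match n with O => (a, d) | S m => nxt m (sq m) end).
  assert (Hsq : forall n, 0 < snd (sq n) -> 0 < snd (sq (S n)) <= snd (sq n) / 2 /\
    forall w, Cmod (w - fst (sq (S n))) <= snd (sq (S n)) ->
      Cmod (w - fst (sq n)) < snd (sq n) /\ G n w).
  { intros n. simpl. unfold nxt.
    destruct (constructive_indefinite_description _ (step n (sq n))) as [q Hq]. exact Hq. }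
  assert (Hpos : forall n, 0 < snd (sq n)).
  { induction n as [|n IH]; [exact Hd|]. apply (Hsq n IH). }
  assert (Hle : forall n, snd (sq n) <= d / 2 ^ n).
  { induction n as [|n IH]; [simpl; lra|]. destruct (Hsq n (Hpos n)) as [[_ h] _].
    assert (Hp : 0 < 2 ^ n) by (apply pow_lt; lra).
    replace (d / 2 ^ S n) with (d / 2 ^ n / 2) by (simpl; field; lra). lra. }
  assert (Hnest : forall m n w, Cmod (w - fst (sq (n + m)%nat)) <= snd (sq (n + m)%nat) ->
    Cmod (w - fst (sq n)) <= snd (sq n)).
  { induction m as [|m IH]; intros n w Hw; [now rewrite Nat.add_0_r in Hw|].
    rewrite Nat.add_succ_r in Hw. apply IH. left. now apply (Hsq _ (Hpos _)). }
  assert (Hself : forall n, Cmod (fst (sq n) - fst (sq n)) <= snd (sq n)).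
  { intros n. rewrite Cmod_sub_0. left. apply Hpos. }
  destruct (geometric_limit (fun n => fst (sq n)) d) as [l Hl].
  { intros n. eapply Rle_trans; [|apply Hle]. left. apply (Hsq n (Hpos n)). apply Hself. }
  assert (Hin : forall n, Cmod (l - fst (sq n)) <= snd (sq n)).
  { intros n. apply Rnot_lt_le. intros Hlt.
    destruct (pow2_small (2 * d) (Cmod (l - fst (sq n)) - snd (sq n))) as [N HN]; try lra.
    assert (H1 := Hnest N n _ (Hself (n + N)%nat)).
    assert (H2 := Hl (n + N)%nat). cbv beta in H2.
    assert (H3 : 2 * d / 2 ^ (n + N) <= 2 * d / 2 ^ N).
    { apply Rmult_le_compat_l; [lra|]. apply Rinv_le_contravar; [apply pow_lt; lra|].
      apply Rle_pow; [lra | lia]. }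
    assert (T := Cmod_tri l (fst (sq (n + N)%nat)) (fst (sq n))).
    rewrite (Cmod_sub_sym l (fst (sq (n + N)%nat))) in T. lra. }
  exists l. split.
  - exact (proj1 (proj2 (Hsq O (Hpos O)) l (Hin 1%nat))).
  - intros n. exact (proj2 (proj2 (Hsq n (Hpos n)) l (Hin (S n)))).
Qed.

Lemma cpair_neq (x y : R) : x <> 0 \/ y <> 0 -> (RtoC x + RtoC y * Ci)%C <> 0.
Proof.
  intros H E. assert (E1 := f_equal fst E). assert (E2 := f_equal snd E). simpl in E1, E2.
  destruct H; lra.
Qed.

(** * Behaviour near an essential singularity *)

Section Essential.
Variables (f : C -> C) (z0 : C) (r : R).
Hypothesis r_pos : 0 < r.
Hypothesis f_diff : forall z, 0 < Cmod (z - z0) < r -> exists l, cdiff f z l.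

Definition noncritical (z : C) : Prop := exists m, cdiff f z m /\ m <> 0.

Definition const_near (k z : C) : Prop :=
  exists d, 0 < d /\ forall w, Cmod (w - z) < d -> f w = k.

Lemma const_near_critical (k z : C) : const_near k z -> ~ noncritical z.
Proof.
  intros [d [Hd Hw]] [m [Hm Hm0]]. apply Hm0.
  apply (cdiff_unique f z); [exact Hm|].
  apply (cdiff_ext_loc (fun _ => k)); [|apply cdiff_const].
  apply locally_Cmod. exists d. split; [exact Hd|]. intros w H. symmetry. now apply Hw.
Qed.

(** The order of the zero of [f - f z] at [z] decides: it is infinite in the first case, and
    positive and finite in the second, where [noncritical_near] applies. *)
Lemma local_dichotomy (z : C) : 0 < Cmod (z - z0) < r ->
  const_near (f z) z \/
  exists d, 0 < d /\ forall w, 0 < Cmod (w - z) < d -> noncritical w.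
Proof.
  intros Hz. destruct (hol_punctured f z0 r z f_diff Hz) as [d [Hd [_ Hh]]].
  assert (Hh' : hol (fun w => f w - f z)%C z d).
  { intros w Hw. destruct (Hh w Hw) as [l Hl]. exists l. now apply cdiff_minus_const. }
  destruct (zero_order _ z d Hd Hh') as [H0|[k [g [Hg [Hg0 E]]]]].
  - left. exists (d / 2). split; [lra|]. intros w Hw. apply Ceq_minus. now apply H0.
  - right. destruct k as [|k].
    + exfalso. apply Hg0. assert (h := E z). simpl in h.
      replace (f z - f z)%C with (RtoC 0) in h by ring. rewrite Cmult_1_l in h. now symmetry.
    + destruct (noncritical_near f g (f z) z d k Hd Hg Hg0) as [d' [[Hd' _] Hnc]].
      * intros w _. rewrite <- E. ring.
      * now exists d'.
Qed.

(** An identity theorem along a segment. The set where [f] is locally equal to [k] is open by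
    definition; it is closed because a point where [f] is not locally constant is surrounded by
    noncritical points. *)
Lemma const_near_segment (k a b : C) :
  (forall t, 0 <= t <= 1 -> 0 < Cmod (segpt a b t - z0) < r) ->
  const_near k a -> const_near k b.
Proof.
  intros Hseg Ha.
  assert (Htr : forall P : C -> Prop, (forall z, 0 < Cmod (z - z0) < r -> P z ->
      exists d, 0 < d /\ forall w, Cmod (w - z) < d -> P w) ->
    open_in 0 1 (fun t => P (segpt a b t))).
  { intros P HP t Ht Pt. destruct (HP _ (Hseg t Ht) Pt) as [d [Hd Hw]].
    destruct (proj1 (locally_Rabs _ _) (cts_segpt a b t d Hd)) as [e [He Hs]].
    exists e. split; [exact He|]. intros s _ Hst. apply Hw. now apply Hs. }
  rewrite <- (segpt_1 a b). apply (interval_clopen 0 1 (fun t => const_near k (segpt a b t))).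
  - lra.
  - apply Htr. intros z _ [d [Hd Hw]]. exists (d / 2). split; [lra|]. intros w Hwz.
    exists (d / 2). split; [lra|]. intros v Hv. apply Hw. assert (h := Cmod_tri v w z). lra.
  - apply (Htr (fun z => ~ const_near k z)). intros z Hz Hn.
    destruct (local_dichotomy z Hz) as [[d [Hd Hw]]|[d [Hd Hw]]].
    + exists d. split; [exact Hd|]. intros w Hwz [d' [Hd' Hv]]. apply Hn.
      exists d. split; [exact Hd|]. intros v Hvz. rewrite (Hw v Hvz), <- (Hw w Hwz).
      apply Hv. rewrite Cmod_sub_0. exact Hd'.
    + exists d. split; [exact Hd|]. intros w Hwz Hc.
      destruct (classic (w = z)) as [->|Hne]; [contradiction|].
      apply (const_near_critical k w Hc). apply Hw. split; [now apply Cmod_sub_pos | exact Hwz].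
  - now rewrite segpt_0.
Qed.

(** The punctured disc is connected though not convex, so at most one detour is needed. The
    consequence is that a function locally constant somewhere has a removable singularity. *)
Lemma const_near_spread (k p q : C) : 0 < Cmod (p - z0) < r -> 0 < Cmod (q - z0) < r ->
  const_near k p -> f q = k.
Proof.
  intros Hp Hq Hk.
  assert (Hend : const_near k q -> f q = k).
  { intros [d [Hd Hw]]. apply Hw. rewrite Cmod_sub_0. exact Hd. }
  apply Hend.
  assert (Hlt : forall a b t, 0 < Cmod (a - z0) < r -> 0 < Cmod (b - z0) < r -> 0 <= t <= 1 ->
    segpt a b t <> z0 -> 0 < Cmod (segpt a b t - z0) < r).
  { intros a b t Ha Hb Ht Hne. split; [now apply Cmod_sub_pos|].
    apply (disc_convex z0 r); tauto. }
  destruct (classic (exists t, 0 <= t <= 1 /\ segpt p q t = z0)) as [[t [Ht Et]]|Hno].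
  2:{ apply (const_near_segment k p q); [|exact Hk]. intros t Ht. apply Hlt; auto.
      intros E. apply Hno. now exists t. }
  (* The segment from [p] to [q] passes through [z0]: go around through a quarter turn of [p]. *)
  set (v := (p - z0)%C). set (m := (z0 + Ci * v)%C).
  assert (Hv0 : v <> 0) by now apply Cmod_pos_neq.
  assert (Hm : 0 < Cmod (m - z0) < r).
  { unfold m. replace (z0 + Ci * v - z0)%C with (Ci * v)%C by ring.
    rewrite Cmod_mult, Cmod_Ci, Rmult_1_l. exact Hp. }
  assert (Hnz : forall (w x : C), w <> 0 -> (x - z0)%C = (v * w)%C -> x <> z0).
  { intros w x Hw E Ex. apply (Cmult_neq_0 v w Hv0 Hw). rewrite <- E, Ex. ring. }
  apply (const_near_segment k m q).
  - intros s Hs. apply Hlt; auto.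
    assert (Ht0 : t <> 0).
    { intros ->. rewrite segpt_0 in Et. rewrite Et, Cmod_sub_0 in Hp. lra. }
    assert (Ht1 : t <> 1).
    { intros ->. rewrite segpt_1 in Et. rewrite Et, Cmod_sub_0 in Hq. lra. }
    assert (Hct : RtoC t <> 0) by (intros E; apply RtoC_inj in E; contradiction).
    (* As [z0] lies strictly between [p] and [q], the vector [q - z0] is a negative multiple of [v];
       hence the points from [m] to [q] are [z0] plus [v] times a number whose real or imaginary
       part is nonzero. *)
    assert (Eq : (q - z0)%C = (v * RtoC (- ((1 - t) / t)))%C).
    { apply (Cmult_cancel_l (RtoC t)); [exact Hct|].
      rewrite RtoC_opp, RtoC_div, RtoC_minus by exact Ht0.
      transitivity (- ((1 - RtoC t) * v))%C; [|field; exact Hct].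
      assert (E := Et). unfold segpt in E.
      replace (RtoC t * (q - z0))%C with ((p + RtoC t * (q - p)) - z0 - (1 - RtoC t) * v)%C
        by (unfold v; ring).
      rewrite E. ring. }
    apply (Hnz (RtoC (s * (- ((1 - t) / t))) + RtoC (1 - s) * Ci)%C).
    + apply cpair_neq. destruct (Req_dec s 1) as [->|Hs1]; [left|right; lra].
      rewrite Rmult_1_l. apply Ropp_neq_0_compat.
      apply Rmult_integral_contrapositive. split; [lra | now apply Rinv_neq_0_compat].
    + transitivity (RtoC (1 - s) * (m - z0) + RtoC s * (q - z0))%C.
      * unfold segpt. rewrite RtoC_minus. ring.
      * rewrite Eq, RtoC_mult. unfold m. ring.
  - apply (const_near_segment k p m); [|exact Hk]. intros s Hs. apply Hlt; auto.
    apply (Hnz (RtoC (1 - s) + RtoC s * Ci)%C).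
    + apply cpair_neq. destruct (Req_dec s 0); [left; lra | now right].
    + unfold segpt, m, v. rewrite RtoC_minus. ring.
Qed.

Lemma Cpow_Defs (z : C) (n : nat) : Defs.Cpow z n = (z ^ n)%C.
Proof. induction n as [|n IH]; [reflexivity|]. simpl. rewrite IH. reflexivity. Qed.

Lemma removable_or_pole_intro (m : nat) (h : C -> C) : hol h z0 r ->
  (forall z, 0 < Cmod (z - z0) < r -> h z = ((z - z0) ^ m * f z)%C) ->
  removable_or_pole f z0 r.
Proof.
  intros Hh E. exists m, h. split; [apply analytic_cdiff; exact Hh|].
  intros z Hz. rewrite Cpow_Defs. now apply E.
Qed.

Lemma const_near_removable (k p : C) : 0 < Cmod (p - z0) < r -> const_near k p ->
  removable_or_pole f z0 r.
Proof.
  intros Hp Hk. apply (removable_or_pole_intro 0 (fun _ => k)).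
  - intros z _. exists 0. apply cdiff_const.
  - intros z Hz. rewrite (const_near_spread k p z Hp Hz Hk). simpl. ring.
Qed.

Lemma cdiff_pow_ex (z : C) (n : nat) : exists l, cdiff (fun x => (x - z0) ^ n)%C z l.
Proof.
  destruct n as [|n]; [exists 0; apply (cdiff_const (RtoC 1)) | eexists; apply cdiff_pow].
Qed.

(** The bounded function [1 / (f - a)] extends to some [G = (z - z0)^k H] with [H] free of zeros,
    and then [(z - z0)^k f = a (z - z0)^k + 1 / H]. *)
Lemma casorati_weierstrass (a : C) (rho del : R) : 0 < rho <= r -> 0 < del ->
  (forall z, 0 < Cmod (z - z0) < rho -> del <= Cmod (f z - a)) ->
  removable_or_pole f z0 r.
Proof.
  intros Hrho Hdel Hom.
  assert (Hne : forall z, 0 < Cmod (z - z0) < rho -> (f z - a)%C <> 0).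
  { intros z Hz. apply Cmod_pos_neq. specialize (Hom z Hz). lra. }
  destruct (removable (fun z => / (f z - a))%C z0 rho (/ del)) as [G [HG EG]]; try lra.
  - intros z Hz. destruct (f_diff z ltac:(lra)) as [l Hl]. eexists.
    apply (cdiff_inv (fun z => f z - a)%C); [apply cdiff_minus_const; exact Hl | now apply Hne].
  - intros z Hz. rewrite Cmod_inv by now apply Hne. apply Rinv_le_contravar; [lra | now apply Hom].
  - assert (Hz0 : forall z, 0 < Cmod (z - z0) < rho -> z <> z0).
    { intros z Hz ->. rewrite Cmod_sub_0 in Hz. lra. }
    assert (HGn : forall z, 0 < Cmod (z - z0) < rho -> G z <> 0).
    { intros z Hz E. rewrite EG in E by now apply Hz0.
      apply C1_nz. rewrite <- (Cinv_r (f z - a)) by now apply Hne. rewrite E. ring. }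
    destruct (zero_order G z0 rho ltac:(lra) HG) as [H0|[k [H [HH [Hn0 EH]]]]].
    + exfalso. assert (Em : Cmod (z0 + RtoC (rho / 4) - z0) = rho / 4).
      { replace (z0 + RtoC (rho / 4) - z0)%C with (RtoC (rho / 4)) by ring.
        rewrite Cmod_R. apply Rabs_pos_eq. lra. }
      apply (HGn (z0 + RtoC (rho / 4))%C); [rewrite Em; lra|]. apply H0. rewrite Em. lra.
    + assert (HHn : forall z, Cmod (z - z0) < rho -> H z <> 0).
      { intros z Hz. destruct (classic (z = z0)) as [->|Hn]; [exact Hn0|].
        intros E. apply (HGn z); [split; [now apply Cmod_sub_pos | exact Hz]|].
        rewrite EH, E. ring. }
      (* The extension lives on the disc of radius [rho] only, while the witness must be analytic up
         to [r]; farther out the product itself is used. *)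
      set (h := fun z => if Rlt_dec (Cmod (z - z0)) rho
        then (a * (z - z0) ^ k + / H z)%C else ((z - z0) ^ k * f z)%C).
      assert (Eh : forall z, 0 < Cmod (z - z0) < r -> h z = ((z - z0) ^ k * f z)%C).
      { intros z Hz. unfold h. destruct (Rlt_dec (Cmod (z - z0)) rho) as [Hl|Hl]; [|reflexivity].
        assert (Hzr : 0 < Cmod (z - z0) < rho) by lra.
        assert (Hp : ((z - z0) ^ k)%C <> 0) by (apply Cpow_nz, Cmod_pos_neq; lra).
        assert (E := EH z). rewrite EG in E by now apply Hz0.
        assert (Ef : f z = (a + / (/ (f z - a)))%C) by (field; now apply Hne).
        rewrite Ef, E. field. split; [now apply HHn | exact Hp]. }
      apply (removable_or_pole_intro k h); [|exact Eh].
      intros z Hz. destruct (Rlt_le_dec (Cmod (z - z0)) rho) as [Hl|Hl].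
      * destruct (HH z Hl) as [l1 Hl1]. destruct (cdiff_pow_ex z k) as [l2 Hl2].
        eexists. apply (cdiff_ext_loc (fun z => a * (z - z0) ^ k + / H z)%C).
        { apply locally_Cmod. exists (rho - Cmod (z - z0)). split; [lra|]. intros w Hw.
          assert (T := Cmod_tri w z z0). unfold h.
          destruct (Rlt_dec (Cmod (w - z0)) rho); [reflexivity | lra]. }
        apply (cdiff_plus (fun z => a * (z - z0) ^ k)%C (fun z => / H z)%C).
        -- apply (cdiff_scal a (fun z => (z - z0) ^ k)%C). exact Hl2.
        -- apply cdiff_inv; [exact Hl1 | now apply HHn].
      * assert (Hzp : 0 < Cmod (z - z0) < r) by lra.
        destruct (f_diff z Hzp) as [l1 Hl1]. destruct (cdiff_pow_ex z k) as [l2 Hl2].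
        destruct (hol_punctured f z0 r z f_diff Hzp) as [d [Hd [Hin _]]].
        eexists. apply (cdiff_ext_loc (fun z => (z - z0) ^ k * f z)%C).
        { apply locally_Cmod. exists d. split; [exact Hd|]. intros w Hw.
          symmetry. now apply Eh, Hin. }
        apply (cdiff_mult (fun z => (z - z0) ^ k)%C f); [exact Hl2 | exact Hl1].
Qed.

(** Casorati-Weierstrass gives some point [z] with [f z] near [a]. As [f] is nowhere locally
    constant, a small displacement makes the point noncritical. *)
Lemma essential_dense : essential_singularity f z0 r ->
  forall rho a del, 0 < rho <= r -> 0 < del ->
  exists z, 0 < Cmod (z - z0) < rho /\ noncritical z /\ Cmod (f z - a) < del.
Proof.
  intros Hes rho a del Hrho Hdel. apply NNPP. intros Hno. apply Hes.
  apply (casorati_weierstrass a rho del Hrho Hdel).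
  intros z Hz. apply Rnot_lt_le. intros Hlt.
  assert (Hzr : 0 < Cmod (z - z0) < r) by lra.
  destruct (local_dichotomy z Hzr) as [Hc|[d [Hd Hnc]]].
  - apply Hes. exact (const_near_removable _ _ Hzr Hc).
  - destruct (f_diff z Hzr) as [l Hl].
    assert (He : 0 < del - Cmod (f z - a)) by lra.
    destruct (proj1 (locally_Cmod _ _) (cdiff_cts _ _ _ Hl _ He)) as [e [He' Hcts]].
    (* The displacement is small enough for noncriticality, for the value of [f], and for staying in
       the punctured disc. *)
    set (m := Rmin (Rmin d e) (Rmin (Cmod (z - z0)) (rho - Cmod (z - z0))) / 2).
    assert (Hm : 0 < Rmin (Rmin d e) (Rmin (Cmod (z - z0)) (rho - Cmod (z - z0))))
      by (repeat apply Rmin_pos; lra).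
    assert (m1 : m < d).
    { assert (h1 := Rmin_l (Rmin d e) (Rmin (Cmod (z - z0)) (rho - Cmod (z - z0)))).
      assert (h2 := Rmin_l d e). unfold m. lra. }
    assert (m2 : m < e).
    { assert (h1 := Rmin_l (Rmin d e) (Rmin (Cmod (z - z0)) (rho - Cmod (z - z0)))).
      assert (h2 := Rmin_r d e). unfold m. lra. }
    assert (m3 : m < Cmod (z - z0) /\ m < rho - Cmod (z - z0)).
    { assert (h1 := Rmin_r (Rmin d e) (Rmin (Cmod (z - z0)) (rho - Cmod (z - z0)))).
      assert (h2 := Rmin_l (Cmod (z - z0)) (rho - Cmod (z - z0))).
      assert (h3 := Rmin_r (Cmod (z - z0)) (rho - Cmod (z - z0))). unfold m. lra. }
    assert (m0 : 0 < m) by (unfold m; lra).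
    set (w := (z + RtoC m)%C).
    assert (Ew : Cmod (w - z) = m).
    { unfold w. replace (z + RtoC m - z)%C with (RtoC m) by ring. rewrite Cmod_R.
      apply Rabs_pos_eq. lra. }
    apply Hno. exists w. split; [|split].
    + assert (h1 := Cmod_tri z w z0). rewrite (Cmod_sub_sym z w) in h1.
      assert (h2 := Cmod_tri w z z0). lra.
    + apply Hnc. lra.
    + assert (h := Hcts w ltac:(lra)). assert (T := Cmod_tri (f w) (f z) a). lra.
Qed.

(** A weak form of Picard's theorem: [G n] collects the values taken at noncritical points within
    [r / (n + 1)] of [z0], and any common element of all [G n] will do. *)
Lemma essential_value : essential_singularity f z0 r ->
  exists w : C, w <> 0 /\ forall rho, 0 < rho ->
    exists z, 0 < Cmod (z - z0) < rho /\ Cmod (z - z0) < r /\ noncritical z /\ f z = w.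
Proof.
  intros Hes.
  assert (Hrn : forall n, 0 < r / (INR n + 1) <= r).
  { intros n. assert (hn := pos_INR n). split; [apply Rdiv_lt_0_compat; lra|].
    apply (Rmult_le_reg_r (INR n + 1)); [lra|]. unfold Rdiv. rewrite Rmult_assoc, Rinv_l by lra.
    nra. }
  set (G := fun n y => exists z, 0 < Cmod (z - z0) < r / (INR n + 1) /\ noncritical z /\ f z = y).
  (* The disc of radius 1/2 about 1 excludes the value 0, which has no phase. *)
  destruct (baire G) with (a := RtoC 1) (d := 1/2) as [w [Hw HG]].
  - intros n y [z [Hz [[l [Hl Hl0]] Ey]]]. specialize (Hrn n).
    destruct (noncritical_local f z0 r f_diff z l ltac:(lra) Hl Hl0) as [d [Hd [Hin [_ Hsur]]]].
    (* The preimages of nearby values must remain within [r / (INR n + 1)] of [z0]. *)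
    set (d' := Rmin d (r / (INR n + 1) - Cmod (z - z0))).
    assert (Hd' : 0 < d') by (apply Rmin_pos; lra).
    assert (h1 : d' <= d) by apply Rmin_l.
    assert (h2 : d' <= r / (INR n + 1) - Cmod (z - z0)) by apply Rmin_r.
    assert (Hm := proj1 (Cmod_gt_0 _) Hl0).
    exists (Cmod l * d' / 4). split.
    { apply Rdiv_lt_0_compat; [|lra]. now apply Rmult_lt_0_compat. }
    intros y' Hy'. rewrite <- Ey in Hy'.
    destruct (Hsur d' y' (conj Hd' h1) Hy') as [z' [Hz' E']].
    destruct (Hin z' ltac:(lra)) as [Hp Hnc].
    exists z'. split; [|split; [exact Hnc | exact E']].
    split; [lra|]. assert (T := Cmod_tri z' z z0). lra.
  - intros n a d Hd. destruct (essential_dense Hes _ a d (Hrn n) Hd) as [z [Hz [Hnc Hza]]].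
    exists (f z). split; [exact Hza|]. exists z. auto.
  - lra.
  - exists w. split.
    + intros ->. replace (0 - 1)%C with (- (1))%C in Hw by ring. rewrite Cmod_m1 in Hw. lra.
    + intros rho Hrho. destruct (archimed (r / rho)) as [Ha _].
      assert (Hq : 0 < r / rho) by (apply Rdiv_lt_0_compat; lra).
      assert (Hup : (0 <= up (r / rho))%Z) by (apply le_IZR; lra).
      set (n := Z.to_nat (up (r / rho))).
      assert (En : INR n = IZR (up (r / rho))) by (unfold n; rewrite INR_IZR_INZ, Z2Nat.id; auto).
      destruct (HG n) as [z [Hz [Hnc E]]]. specialize (Hrn n). exists z.
      assert (r / (INR n + 1) <= rho).
      { apply (Rmult_le_reg_r (INR n + 1)); [lra|]. unfold Rdiv.
        rewrite Rmult_assoc, Rinv_l by lra. rewrite <- En in Ha.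
        apply (Rmult_lt_compat_r rho) in Ha; [|lra].
        unfold Rdiv in Ha. rewrite Rmult_assoc, Rinv_l in Ha by lra. nra. }
      split; [lra|]. split; [lra|]. auto.
Qed.

(** The colour is that of the recurring value [w]. Two points with value [w] in one component would
    lie in a common connected coloured set and coincide by [connected_inj]. *)
Theorem essential_many_lines : essential_singularity f z0 r ->
  exists c, Cmod c = 1 /\ forall eps, 0 < eps ->
    infinitely_many_sets (fun L => isochromatic_line f z0 r c L /\
      exists z, L z /\ cdisc z0 eps z).
Proof.
  intros Hes. destruct (essential_value Hes) as [w [Hw0 Hw]].
  assert (Hm := proj1 (Cmod_gt_0 _) Hw0).
  assert (Hmc : RtoC (Cmod w) <> 0) by (intros E; apply RtoC_inj in E; lra).
  set (c := (w / RtoC (Cmod w))%C).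
  assert (Hc : Cmod c = 1).
  { unfold c. rewrite Cmod_div, Cmod_R, Rabs_pos_eq by (exact Hmc || lra). field. lra. }
  exists c. split; [exact Hc|]. intros eps Heps n.
  assert (Hex : forall e, exists z, 0 < e -> 0 < Cmod (z - z0) < e /\ colored f z0 r c z /\ f z = w).
  { intros e. destruct (Rlt_le_dec 0 e) as [He|He]; [|exists z0; lra].
    destruct (Hw e He) as [z [Hz [Hzr [Hnc E]]]]. exists z. intros _. split; [exact Hz|].
    split; [|exact E]. split; [lra|]. rewrite E. split; [exact Hw0|]. split; [exact Hnc|].
    unfold c. field. exact Hmc. }
  set (F := fun e => proj1_sig (constructive_indefinite_description _ (Hex e))).
  assert (HF : forall e, 0 < e ->
    0 < Cmod (F e - z0) < e /\ colored f z0 r c (F e) /\ f (F e) = w).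
  { intros e. unfold F. destruct (constructive_indefinite_description _ (Hex e)) as [z Hz].
    exact Hz. }
  (* Each point is chosen nearer to [z0] than its predecessor, which makes all of them distinct. *)
  set (p := fix p (n : nat) : C := match n with O => F eps | S k => F (Cmod (p k - z0)) end).
  assert (Hp : forall k, 0 < Cmod (p k - z0) < eps /\ colored f z0 r c (p k) /\ f (p k) = w).
  { induction k as [|k [IH _]]; [now apply HF|].
    destruct (HF (Cmod (p k - z0)) ltac:(lra)) as [H1 H2]. split; [simpl; lra | exact H2]. }
  assert (Hdec : forall k, Cmod (p (S k) - z0) < Cmod (p k - z0)).
  { intros k. destruct (Hp k) as [H1 _]. apply (HF (Cmod (p k - z0))). lra. }
  assert (Hlt : forall j i, (i < j)%nat -> Cmod (p j - z0) < Cmod (p i - z0)).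
  { intros j i Hij. induction Hij as [|j Hij IH]; [apply Hdec|].
    eapply Rlt_trans; [apply Hdec | exact IH]. }
  assert (Hset : forall k, color_set f z0 r c (p k)) by (intros k; apply color_set_colored, Hp).
  exists (fun i => component (color_set f z0 r c) (p i)). split.
  - intros i _. split; [now apply component_correct|].
    exists (p i). split; [now apply component_refl|]. apply (Hp i).
  - intros i j _ _ Hij E.
    assert (Hj : component (color_set f z0 r c) (p i) (p j)).
    { rewrite E. now apply component_refl. }
    destruct Hj as [M [CM [SM [Mi Mj]]]].
    assert (Epp : p i = p j).
    { apply (connected_inj f z0 c r f_diff Hc M); auto.
      - intros z Mz. now apply color_set_colored, SM.
      - destruct (Hp i) as [_ [_ ->]]. destruct (Hp j) as [_ [_ ->]]. reflexivity. }
    destruct (Nat.lt_gt_cases i j) as [Hd _]. destruct (Hd Hij) as [h|h];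
      apply Hlt in h; rewrite Epp in h; lra.
Qed.

End Essential.

(** * Behaviour near a removable singularity or a pole *)

Fixpoint polyfun (n : nat) (P : C -> C) : Prop :=
  match n with
  | O => exists a, forall z, P z = a
  | S m => exists a Q, polyfun m Q /\ forall z, P z = (a + z * Q z)%C
  end.

Lemma polyfun_add (n : nat) (P Q : C -> C) :
  polyfun n P -> polyfun n Q -> polyfun n (fun z => P z + Q z)%C.
Proof.
  revert P Q. induction n as [|n IH]; intros P Q.
  - intros [a Ha] [b Hb]. exists (a + b)%C. intros z. now rewrite Ha, Hb.
  - intros [a [P' [HP' Ha]]] [b [Q' [HQ' Hb]]]. exists (a + b)%C, (fun z => P' z + Q' z)%C.
    split; [now apply IH|]. intros z. rewrite Ha, Hb. ring.
Qed.

Lemma polyfun_scal (n : nat) (k : C) (P : C -> C) :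
  polyfun n P -> polyfun n (fun z => k * P z)%C.
Proof.
  revert P. induction n as [|n IH]; intros P.
  - intros [a Ha]. exists (k * a)%C. intros z. now rewrite Ha.
  - intros [a [P' [HP' Ha]]]. exists (k * a)%C, (fun z => k * P' z)%C.
    split; [now apply IH|]. intros z. rewrite Ha. ring.
Qed.

Lemma polyfun_S (n : nat) (P : C -> C) : polyfun n P -> polyfun (S n) P.
Proof.
  revert P. induction n as [|n IH]; intros P.
  - intros [a Ha]. exists a, (fun _ => RtoC 0). split; [now exists (RtoC 0)|].
    intros z. rewrite Ha. ring.
  - intros [a [P' [HP' Ha]]]. exists a, P'. split; [now apply IH | exact Ha].
Qed.

Lemma polyfun_factor (n : nat) (P : C -> C) (b : C) : polyfun (S n) P ->
  exists Q, polyfun n Q /\ forall z, P z = (P b + (z - b) * Q z)%C.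
Proof.
  revert P. induction n as [|n IH]; intros P [a [Q [HQ Ha]]].
  - destruct HQ as [q Hq]. exists (fun _ => q). split; [now exists q|].
    intros z. rewrite !Ha, !Hq. ring.
  - destruct (IH Q HQ) as [Q' [HQ' E]].
    (* From [z Q(z) - b Q(b) = (z - b) Q(z) + b (Q(z) - Q(b))]. *)
    exists (fun z => Q z + b * Q' z)%C. split.
    + apply polyfun_add; [exact HQ|]. now apply polyfun_scal, polyfun_S.
    + intros z. rewrite !Ha, (E z). ring.
Qed.

(** The point [y] certifies that [P] is not identically zero, and after splitting off a root it
    certifies the same for the quotient. *)
Lemma polyfun_roots (n : nat) (P : C -> C) (y : C) : polyfun n P -> P y <> 0 ->
  exists l, forall z, P z = 0 -> In z l.
Proof.
  revert P. induction n as [|n IH]; intros P HP Hy.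
  - destruct HP as [a Ha]. exists nil. intros z Hz. apply Hy. rewrite Ha in *. exact Hz.
  - destruct (classic (exists b, P b = 0)) as [[b Hb]|Hno].
    + destruct (polyfun_factor n P b HP) as [Q [HQ E]]. rewrite Hb in E.
      destruct (IH Q HQ) as [l Hl].
      * intros E0. apply Hy. rewrite E, E0. ring.
      * exists (b :: l). intros z Hz. destruct (classic (z = b)) as [->|Hn]; [now left|].
        right. apply Hl. apply (Cmult_cancel_l (z - b)); [now apply Cminus_eq_contra|].
        rewrite E in Hz. rewrite Cplus_0_l in Hz. rewrite Hz. ring.
    + exists nil. intros z Hz. apply Hno. now exists z.
Qed.

Lemma nth_roots_finite (k : nat) (v : C) : v <> 0 ->
  exists l, forall w, (w ^ S k)%C = v -> In w l.
Proof.
  intros Hv. assert (Hp : forall n, polyfun n (fun w => w ^ n)%C).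
  { induction n as [|n IH]; [now exists (RtoC 1)|].
    exists (RtoC 0), (fun w => w ^ n)%C. split; [exact IH|]. intros z. simpl. ring. }
  destruct (polyfun_roots (S k) (fun w => - v + w * w ^ k)%C 0) as [l Hl].
  - exists (- v)%C, (fun w => w ^ k)%C. split; [apply Hp | reflexivity].
  - intros E. apply Hv. replace v with (- (- v + 0 * 0 ^ k))%C by ring. rewrite E. ring.
  - exists l. intros w Hw. apply Hl. rewrite <- Hw. simpl. ring.
Qed.

(** The factor [z - z0] turns a Lipschitz bound into strict differentiability at [z0]. Thus the
    chart below can be built from a root that is only known to be Lipschitz. *)
Lemma lipschitz_sdiff (G : C -> C) (z0 : C) (d K : R) : 0 < d -> 0 < K ->
  (forall z w, Cmod (z - z0) < d -> Cmod (w - z0) < d -> Cmod (G z - G w) <= K * Cmod (z - w)) ->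
  sdiff (fun z => (z - z0) * G z)%C z0 (G z0).
Proof.
  intros Hd HK HG e He. assert (Hq : 0 < e / (2 * K)) by (apply Rdiv_lt_0_compat; lra).
  exists (Rmin d (e / (2 * K))). split; [now apply Rmin_pos|]. intros z w Hz Hw.
  assert (Z1 := Rlt_le_trans _ _ _ Hz (Rmin_l _ _)).
  assert (Z2 := Rlt_le_trans _ _ _ Hz (Rmin_r _ _)).
  assert (W1 := Rlt_le_trans _ _ _ Hw (Rmin_l _ _)).
  assert (W2 := Rlt_le_trans _ _ _ Hw (Rmin_r _ _)).
  replace ((z - z0) * G z - (w - z0) * G w - G z0 * (z - w))%C
    with ((z - w) * (G z - G z0) + (w - z0) * (G z - G w))%C by ring.
  eapply Rle_trans; [apply Cmod_triangle|]. rewrite !Cmod_mult.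
  assert (H1 := HG z z0 Z1 ltac:(rewrite Cmod_sub_0; exact Hd)).
  assert (H2 := HG z w Z1 W1).
  apply (Rmult_lt_compat_r (2 * K)) in Z2; [|lra].
  apply (Rmult_lt_compat_r (2 * K)) in W2; [|lra].
  replace (e / (2 * K) * (2 * K)) with e in Z2, W2 by (field; lra).
  assert (h0 := Cmod_ge_0 (z - w)). assert (h1 := Cmod_ge_0 (w - z0)).
  assert (Cmod (z - w) * Cmod (G z - G z0) <= Cmod (z - w) * (e / 2))
    by (apply Rmult_le_compat_l; lra).
  assert (Cmod (w - z0) * Cmod (G z - G w) <= Cmod (w - z0) * (K * Cmod (z - w)))
    by (apply Rmult_le_compat_l; lra).
  assert (Cmod (w - z0) * K * Cmod (z - w) <= e / 2 * Cmod (z - w))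
    by (apply Rmult_le_compat_r; lra).
  lra.
Qed.

(** The branch near 1 is the local inverse of the power function, and its Lipschitz constant is the
    reciprocal of the lower bound in [local_inverse]. *)
Lemma local_root (k : nat) : exists (psi : C -> C) (e K : R), 0 < e /\ 0 < K /\
  (forall v, Cmod (v - 1) < e -> (psi v ^ S k)%C = v) /\
  (forall v w, Cmod (v - 1) < e -> Cmod (w - 1) < e -> Cmod (psi v - psi w) <= K * Cmod (v - w)).
Proof.
  set (p := fun x : C => ((x - 0) ^ S k)%C).
  set (l := (RtoC (INR (S k)) * (1 - 0) ^ k)%C).
  assert (Hl : cdiff p 1 l) by apply cdiff_pow.
  assert (Hl0 : l <> 0).
  { apply Cmult_neq_0.
    - intros E. apply RtoC_inj in E. rewrite S_INR in E. assert (h := pos_INR k). lra.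
    - apply Cpow_nz. replace (1 - 0)%C with (RtoC 1) by ring. apply C1_nz. }
  assert (Hs : sdiff p 1 l).
  { destruct (hol_sdiff p 1 1 Rlt_0_1) as [m Hm].
    - intros z _. eexists. apply cdiff_pow.
    - rewrite (cdiff_unique p 1 l m Hl (sdiff_cdiff _ _ _ Hm)). exact Hm. }
  destruct (local_inverse p 1 l Hl0 Hs) as [d [Hd [Hinj Hsur]]].
  assert (Hm := proj1 (Cmod_gt_0 _) Hl0).
  set (e := Cmod l * d / 4).
  assert (He : 0 < e) by (unfold e; apply Rdiv_lt_0_compat; [now apply Rmult_lt_0_compat | lra]).
  assert (Hp1 : p 1 = 1).
  { unfold p. replace (1 - 0)%C with (RtoC 1) by ring. apply Cpow_1_l. }
  assert (Hex : forall v, exists w, Cmod (v - 1) < e -> Cmod (w - 1) < d /\ p w = v).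
  { intros v. destruct (Rlt_le_dec (Cmod (v - 1)) e) as [h|h].
    - destruct (Hsur d v ltac:(lra)) as [w Hw]; [rewrite Hp1; exact h | now exists w].
    - exists (RtoC 0). lra. }
  set (psi := fun v => proj1_sig (constructive_indefinite_description _ (Hex v))).
  assert (Hpsi : forall v, Cmod (v - 1) < e -> Cmod (psi v - 1) < d /\ p (psi v) = v).
  { intros v. unfold psi. destruct (constructive_indefinite_description _ (Hex v)) as [w Hw].
    exact Hw. }
  exists psi, e, (2 / Cmod l). split; [exact He|]. split; [apply Rdiv_lt_0_compat; lra|]. split.
  - intros v Hv. destruct (Hpsi v Hv) as [_ E]. unfold p in E.
    rewrite <- E at 2. f_equal. ring.
  - intros v w Hv Hw. destruct (Hpsi v Hv) as [H1 E1]. destruct (Hpsi w Hw) as [H2 E2].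
    assert (h := Hinj _ _ H1 H2). rewrite E1, E2 in h.
    apply (Rmult_le_reg_l (Cmod l / 2)); [lra|].
    replace (Cmod l / 2 * (2 / Cmod l * Cmod (v - w))) with (Cmod (v - w)) by (field; lra).
    exact h.
Qed.

(** Division by [g z0] brings the argument of the root close to 1, so [phi] is [z - z0] times a root
    of [g z / g z0]. Its derivative at [z0] is a root of 1 and hence nonzero. *)
Lemma root_chart (g : C -> C) (z0 : C) (rad : R) (k : nat) : 0 < rad -> hol g z0 rad ->
  g z0 <> 0 -> exists (phi : C -> C) (l : C) (d : R), 0 < d /\ l <> 0 /\ sdiff phi z0 l /\
    phi z0 = 0 /\
    forall z, Cmod (z - z0) < d -> ((z - z0) ^ S k * g z)%C = (g z0 * phi z ^ S k)%C.
Proof.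
  intros Hr Hg Hg0. destruct (local_root k) as [psi [e [K [He [HK [Hpsi Hlip]]]]]].
  destruct (hol_sdiff g z0 rad Hr Hg) as [lg Hlg].
  destruct (sdiff_lipschitz g z0 lg Hlg) as [d1 [Hd1 Hlg1]].
  assert (Hm := proj1 (Cmod_gt_0 _) Hg0). set (m := Cmod (g z0)) in *.
  assert (hl := Cmod_ge_0 lg). set (B := (Cmod lg + 1) / m).
  assert (HB : 0 < B) by (apply Rdiv_lt_0_compat; lra).
  assert (HBl : forall z w, Cmod (z - z0) < d1 -> Cmod (w - z0) < d1 ->
    Cmod (g z / g z0 - g w / g z0) <= B * Cmod (z - w)).
  { intros z w Hz Hw.
    replace (g z / g z0 - g w / g z0)%C with ((g z - g w) / g z0)%C by (field; exact Hg0).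
    rewrite Cmod_div by exact Hg0. fold m. specialize (Hlg1 z w Hz Hw).
    unfold B. apply (Rmult_le_reg_r m); [exact Hm|].
    replace ((Cmod lg + 1) / m * Cmod (z - w) * m) with ((Cmod lg + 1) * Cmod (z - w))
      by (field; lra).
    unfold Rdiv. rewrite Rmult_assoc, Rinv_l by lra. lra. }
  set (d := Rmin d1 (e / B)).
  assert (Hq : 0 < e / B) by (apply Rdiv_lt_0_compat; lra).
  assert (Hd : 0 < d) by now apply Rmin_pos.
  assert (h1 : d <= d1) by apply Rmin_l. assert (h2 : d <= e / B) by apply Rmin_r.
  assert (Hz0 : Cmod (z0 - z0) < d) by (rewrite Cmod_sub_0; exact Hd).
  assert (Hin : forall z, Cmod (z - z0) < d -> Cmod (g z / g z0 - 1) < e).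
  { intros z Hz. replace (RtoC 1) with (g z0 / g z0)%C by (field; exact Hg0).
    eapply Rle_lt_trans; [apply HBl; lra|].
    assert (h3 : Cmod (z - z0) < e / B) by lra.
    apply (Rmult_lt_compat_l B) in h3; [|exact HB].
    replace (B * (e / B)) with e in h3 by (field; lra). exact h3. }
  set (G := fun z => psi (g z / g z0)%C).
  assert (HGl : forall z w, Cmod (z - z0) < d -> Cmod (w - z0) < d ->
    Cmod (G z - G w) <= (K * B) * Cmod (z - w)).
  { intros z w Hz Hw. unfold G. eapply Rle_trans; [apply Hlip; now apply Hin|].
    rewrite Rmult_assoc. apply Rmult_le_compat_l; [lra|]. apply HBl; lra. }
  exists (fun z => (z - z0) * G z)%C, (G z0), d.
  split; [exact Hd|]. split; [|split; [|split]].
  - intros E. assert (h := Hpsi _ (Hin z0 Hz0)). fold (G z0) in h. rewrite E in h.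
    apply C1_nz. replace (RtoC 1) with (g z0 / g z0)%C by (field; exact Hg0).
    rewrite <- h. simpl. ring.
  - apply (lipschitz_sdiff G z0 d (K * B)); [exact Hd | now apply Rmult_lt_0_compat | exact HGl].
  - ring.
  - intros z Hz. rewrite Cpow_mult_l. unfold G. rewrite Hpsi by now apply Hin.
    field. exact Hg0.
Qed.

Definition on_ray (c y : C) : Prop := y <> 0 /\ y = (c * RtoC (Cmod y))%C.

Lemma on_ray_intro (c : C) (t : R) : Cmod c = 1 -> 0 < t -> on_ray c (c * RtoC t)%C.
Proof.
  intros Hc Ht. assert (E : Cmod (c * RtoC t) = t).
  { rewrite Cmod_mult, Hc, Cmod_R, Rabs_pos_eq by lra. ring. }
  split; [apply Cmod_pos_neq; lra | now rewrite E].
Qed.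

Lemma pow_le_self (x : R) (k : nat) : 0 <= x <= 1 -> 0 <= x ^ S k <= x.
Proof.
  intros Hx. induction k as [|k IH]; [simpl; lra|].
  change (x ^ S (S k)) with (x * x ^ S k). nra.
Qed.

(* In the chart [phi] the set of points where [a + g0 * phi^(k+1)] lies on a given ray is, near
   [z0], a finite union of straight rays issuing from the origin. *)
Lemma rays_cover (g : C -> C) (a z0 c : C) (rad : R) (k : nat) : 0 < rad -> hol g z0 rad ->
  g z0 <> 0 -> Cmod c = 1 ->
  exists (eps : R) (l : list C) (A : C -> C -> Prop), 0 < eps /\
    (forall w, Cmod w = 1 -> Cconnected (A w)) /\
    forall z, 0 < Cmod (z - z0) < eps -> on_ray c (a + (z - z0) ^ S k * g z)%C ->
      exists w, In w l /\ Cmod w = 1 /\ A w z /\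
        forall y, A w y -> 0 < Cmod (y - z0) < rad /\ on_ray c (a + (y - z0) ^ S k * g y)%C.
Proof.
  intros Hr Hg Hg0 Hc.
  destruct (root_chart g z0 rad k Hr Hg Hg0) as [phi [l [d1 [Hd1 [Hl0 [Hphi [Hphi0 Eg]]]]]]].
  destruct (local_inverse phi z0 l Hl0 Hphi) as [d2 [Hd2 [Hinj Hsur]]].
  assert (Hml := proj1 (Cmod_gt_0 _) Hl0). assert (Hmg := proj1 (Cmod_gt_0 _) Hg0).
  set (ml := Cmod l) in *. set (mg := Cmod (g z0)) in *.
  set (d := Rmin rad (Rmin d1 d2)).
  assert (Hd : 0 < d) by (unfold d; repeat apply Rmin_pos; assumption).
  assert (hd0 : d <= rad) by apply Rmin_l.
  assert (hd1 : d <= d1) by (unfold d; eapply Rle_trans; [apply Rmin_r | apply Rmin_l]).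
  assert (hd2 : d <= d2) by (unfold d; eapply Rle_trans; [apply Rmin_r | apply Rmin_r]).
  assert (Hz0 : Cmod (z0 - z0) < d) by (rewrite Cmod_sub_0; exact Hd).
  (* If [a] is off the closed ray of colour [c], then by continuity no point near [z0] has that
     colour and the empty list suffices. The remaining case includes [a = 0]. *)
  destruct (classic (a = (c * RtoC (Cmod a))%C)) as [Ea|Ea].
  2:{ set (e := Cmod (a - c * RtoC (Cmod a)) / 2).
      assert (He : 0 < e) by (assert (h := Cmod_sub_pos _ _ Ea); unfold e; lra).
      destruct (Hg z0) as [lg Hlg]; [rewrite Cmod_sub_0; exact Hr|].
      assert (Hct : ctsC (fun z => a + (z - z0) ^ S k * g z)%C z0).
      { apply (cts_plus (U := C_UniformSpace)); [apply cts_const|].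
        apply (cts_mult (U := C_UniformSpace)); [|exact (cdiff_cts _ _ _ Hlg)].
        apply (cts_pow (U := C_UniformSpace)).
        apply (cts_minus (U := C_UniformSpace)); [apply cts_id | apply cts_const]. }
      destruct (proj1 (locally_Cmod _ _) (Hct e He)) as [eps [Heps Hz]].
      exists eps, nil, (fun _ _ => False). split; [exact Heps|]. split.
      - intros w _ O1 O2 _ _ _ [x [[] _]].
      - intros z [_ Hzz] [_ Hray]. exfalso. specialize (Hz z Hzz). simpl Cpow in Hz.
        replace (a + (z0 - z0) * (z0 - z0) ^ k * g z0)%C with a in Hz by ring.
        change ((z - z0) * (z - z0) ^ k)%C with ((z - z0) ^ S k)%C in Hz.
        set (b := (a + (z - z0) ^ S k * g z)%C) in *.
        assert (T : Cmod (a - c * RtoC (Cmod a)) <= Cmod (b - a) + Rabs (Cmod b - Cmod a)).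
        { replace (a - c * RtoC (Cmod a))%C
            with (- (b - a) + (b - c * RtoC (Cmod a)))%C by ring.
          eapply Rle_trans; [apply Cmod_triangle|]. rewrite Cmod_opp. apply Rplus_le_compat_l.
          rewrite Hray at 1.
          replace (c * RtoC (Cmod b) - c * RtoC (Cmod a))%C with (c * RtoC (Cmod b - Cmod a))%C
            by (rewrite RtoC_minus; ring).
          rewrite Cmod_mult, Hc, Cmod_R. lra. }
        assert (T2 : Rabs (Cmod b - Cmod a) <= Cmod (b - a)).
        { apply Rabs_le. assert (h1 := Cmod_rev_tri b a). assert (h2 := Cmod_rev_tri a b).
          rewrite (Cmod_sub_sym a b) in h2. lra. }
        unfold e in Hz. lra. }
  set (al := Cmod a) in *. assert (Hal : 0 <= al) by apply Cmod_ge_0.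
  (* The bound 1 ensures [u ^ S k <= u]; the other one keeps [t w] in the range of the local inverse
     of [phi]. *)
  set (e0 := Rmin 1 (ml * d / 4)).
  assert (He0 : 0 < e0).
  { apply Rmin_pos; [lra|]. apply Rdiv_lt_0_compat; [now apply Rmult_lt_0_compat | lra]. }
  (* For nonzero [a], rays along which the modulus decreases must stop before the value reaches 0;
     the bound [mg * e <= al] guarantees this. *)
  assert (He : exists e, 0 < e <= e0 /\ (0 < al -> mg * e <= al)).
  { destruct (Rle_lt_or_eq_dec 0 al Hal) as [h|h].
    - exists (Rmin e0 (al / mg)). assert (Hq : 0 < al / mg) by now apply Rdiv_lt_0_compat.
      split; [split; [now apply Rmin_pos | apply Rmin_l]|]. intros _.
      apply Rle_trans with (mg * (al / mg)); [apply Rmult_le_compat_l; [lra | apply Rmin_r]|].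
      right. field. lra.
    - exists e0. split; [lra|]. lra. }
  destruct He as [e [[He He'] Hale]].
  assert (he1 : e0 <= 1) by apply Rmin_l. assert (he2 : e0 <= ml * d / 4) by apply Rmin_r.
  assert (Hex : forall w t, exists z, Cmod w = 1 -> 0 < t < e ->
    Cmod (z - z0) < d /\ phi z = (RtoC t * w)%C).
  { intros w t. destruct (classic (Cmod w = 1 /\ 0 < t < e)) as [[Hw Ht]|Hn].
    - destruct (Hsur d (RtoC t * w)%C ltac:(lra)) as [z Hz]; [|now exists z].
      rewrite Hphi0. replace (RtoC t * w - 0)%C with (RtoC t * w)%C by ring.
      rewrite Cmod_mult, Hw, Cmod_R, Rabs_pos_eq by lra. fold ml. lra.
    - exists z0. intros H1 H2. exfalso. auto. }
  set (s := fun w t => proj1_sig (constructive_indefinite_description _ (Hex w t))).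
  assert (Hs : forall w t, Cmod w = 1 -> 0 < t < e ->
    Cmod (s w t - z0) < d /\ phi (s w t) = (RtoC t * w)%C).
  { intros w t. unfold s. destruct (constructive_indefinite_description _ (Hex w t)) as [z Hz].
    exact Hz. }
  (* A direction [w] carries values on the line through 0 and [c] exactly when [w ^ S k] is [v] or
     [- v], according to whether the modulus increases or decreases along it. *)
  set (v := (c * RtoC mg / g z0)%C).
  assert (Hmgc : RtoC mg <> 0) by (intros E; apply RtoC_inj in E; lra).
  assert (Hc0 : c <> 0) by (apply Cmod_pos_neq; lra).
  assert (Hv : v <> 0).
  { intros E. apply (Cmult_neq_0 c (RtoC mg) Hc0 Hmgc).
    replace (c * RtoC mg)%C with (v * g z0)%C by (unfold v; field; exact Hg0).
    rewrite E. ring. }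
  assert (Hv' : (- v)%C <> 0).
  { intros E. apply Hv. replace v with (- - v)%C by ring. rewrite E. ring. }
  destruct (nth_roots_finite k v Hv) as [l1 Hl1].
  destruct (nth_roots_finite k (- v) Hv') as [l2 Hl2].
  destruct (proj1 (locally_Cmod _ _) (cdiff_cts _ _ _ (sdiff_cdiff _ _ _ Hphi) e He))
    as [d3 [Hd3 Hcp]].
  exists (Rmin d d3), (l1 ++ l2), (fun w z => exists t, 0 < t < e /\ z = s w t).
  split; [now apply Rmin_pos|]. split.
  - intros w Hw. apply curve_connected. intros t Ht eps Heps.
    destruct (Hs w t Hw Ht) as [Hst Est].
    apply locally_Rabs. exists (Rmin (Rmin t (e - t)) (eps * (ml / 2))).
    split; [repeat apply Rmin_pos; try lra; apply Rmult_lt_0_compat; lra|].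
    intros u Hu. assert (U1 := Rlt_le_trans _ _ _ Hu (Rmin_l _ _)).
    assert (U2 := Rlt_le_trans _ _ _ Hu (Rmin_r _ _)).
    assert (U3 := Rlt_le_trans _ _ _ U1 (Rmin_l _ _)).
    assert (U4 := Rlt_le_trans _ _ _ U1 (Rmin_r _ _)).
    apply Rabs_def2 in U3. apply Rabs_def2 in U4.
    destruct (Hs w u Hw ltac:(lra)) as [Hsu Esu].
    assert (h := Hinj (s w u) (s w t) ltac:(lra) ltac:(lra)). rewrite Esu, Est in h.
    replace (RtoC u * w - RtoC t * w)%C with (RtoC (u - t) * w)%C in h
      by (rewrite RtoC_minus; ring).
    rewrite Cmod_mult, Hw, Cmod_R, Rmult_1_r in h. fold ml in h.
    apply (Rmult_lt_reg_l (ml / 2)); [lra|]. lra.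
  - intros z [Hz0' Hz] Hray.
    assert (Z1 := Rlt_le_trans _ _ _ Hz (Rmin_l _ _)).
    assert (Z2 := Rlt_le_trans _ _ _ Hz (Rmin_r _ _)).
    assert (Hpz := Hcp z Z2). rewrite Hphi0 in Hpz.
    replace (phi z - 0)%C with (phi z) in Hpz by ring.
    assert (Hpp : 0 < Cmod (phi z)).
    { assert (h := Hinj z z0 ltac:(lra) ltac:(lra)). rewrite Hphi0 in h. fold ml in h.
      replace (phi z - 0)%C with (phi z) in h by ring. nra. }
    set (t := Cmod (phi z)) in *.
    assert (Htc : RtoC t <> 0) by (intros E; apply RtoC_inj in E; lra).
    set (w := (phi z / RtoC t)%C).
    assert (Hw : Cmod w = 1).
    { unfold w. rewrite Cmod_div, Cmod_R, Rabs_pos_eq by (exact Htc || lra).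
      fold t. field. lra. }
    assert (Epz : phi z = (RtoC t * w)%C) by (unfold w; field; exact Htc).
    assert (Ev : forall u x, Cmod (x - z0) < d -> phi x = (RtoC u * w)%C ->
      (a + (x - z0) ^ S k * g x)%C = (c * RtoC al + RtoC (u ^ S k) * (g z0 * w ^ S k))%C).
    { intros u x Hx Ex. rewrite Ea at 1. rewrite Eg by lra. rewrite Ex, Cpow_mult_l, <- RtoC_pow.
      fold al. ring. }
    assert (Htk : 0 < t ^ S k) by (apply pow_lt; lra).
    (* Comparing the modulus [tau] of the value with [al] gives the sign. The negative sign needs
       [al > 0], since then [tau < al]. *)
    assert (Hsign : exists sg, (sg = 1 \/ (sg = -1 /\ 0 < al)) /\
      (g z0 * w ^ S k)%C = (c * RtoC (sg * mg))%C).
    { destruct Hray as [_ Hray]. rewrite (Ev t z Z1 Epz) in Hray.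
      set (tau := Cmod (c * RtoC al + RtoC (t ^ S k) * (g z0 * w ^ S k))) in *.
      assert (Htau : 0 <= tau) by apply Cmod_ge_0.
      assert (Htkc : RtoC (t ^ S k) <> 0) by (intros E; apply RtoC_inj in E; lra).
      assert (E1 : (RtoC (t ^ S k) * (g z0 * w ^ S k))%C = (c * RtoC (tau - al))%C).
      { rewrite RtoC_minus.
        replace (c * (RtoC tau - RtoC al))%C with (c * RtoC tau - c * RtoC al)%C by ring.
        rewrite <- Hray. ring. }
      assert (E2 := f_equal Cmod E1).
      rewrite !Cmod_mult, Cmod_pow, Hw, Hc, !Cmod_R, pow1 in E2. fold mg in E2.
      rewrite (Rabs_pos_eq (t ^ S k)) in E2 by lra.
      destruct (Rle_lt_dec 0 (tau - al)) as [h|h].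
      - exists 1. split; [now left|]. rewrite Rabs_pos_eq in E2 by exact h.
        apply (Cmult_cancel_l (RtoC (t ^ S k))); [exact Htkc|]. rewrite E1.
        replace (tau - al) with (t ^ S k * mg) by lra. rewrite !RtoC_mult. ring.
      - exists (-1). split; [right; lra|]. rewrite Rabs_left in E2 by exact h.
        apply (Cmult_cancel_l (RtoC (t ^ S k))); [exact Htkc|]. rewrite E1.
        replace (tau - al) with (t ^ S k * (-1 * mg)) by lra. rewrite !RtoC_mult. ring. }
    destruct Hsign as [sg [Hsg Esg]].
    exists w. split; [|split; [exact Hw|]; split].
    + apply in_or_app. destruct Hsg as [->|[-> _]]; [left; apply Hl1 | right; apply Hl2];
        apply (Cmult_cancel_l (g z0)); try exact Hg0; rewrite Esg, RtoC_mult; unfold v;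
        field; exact Hg0.
    (* The given point is the one on the ray with parameter [t], because [phi] is injective near
       [z0]. *)
    + exists t. split; [lra|]. destruct (Hs w t Hw ltac:(lra)) as [Hst Est].
      apply Cmod_sub_eq. assert (h := Hinj z (s w t) ltac:(lra) ltac:(lra)).
      rewrite Est, <- Epz, Cmod_sub_0 in h. fold ml in h.
      apply (Rmult_le_reg_l (ml / 2)); lra.
    + intros y [u [Hu ->]]. destruct (Hs w u Hw Hu) as [Hsu Esu]. split.
      * split; [|lra]. apply Cmod_sub_pos. intros E. rewrite E, Hphi0 in Esu.
        apply (f_equal Cmod) in Esu.
        rewrite Cmod_0, Cmod_mult, Hw, Cmod_R, Rabs_pos_eq in Esu by lra. lra.
      * rewrite (Ev u _ Hsu Esu), Esg.
        replace (c * RtoC al + RtoC (u ^ S k) * (c * RtoC (sg * mg)))%C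
          with (c * RtoC (al + u ^ S k * (sg * mg)))%C
          by (rewrite RtoC_plus, !RtoC_mult; ring).
        apply on_ray_intro; [exact Hc|].
        assert (Huk : 0 < u ^ S k) by (apply pow_lt; lra).
        assert (Huk' := pow_le_self u k ltac:(lra)).
        destruct Hsg as [->|[-> Hap]].
        -- assert (0 < u ^ S k * mg) by now apply Rmult_lt_0_compat. lra.
        -- assert (u ^ S k * mg < e * mg) by (apply Rmult_lt_compat_r; lra).
           specialize (Hale Hap). lra.
Qed.

Section Tame.
Variables (f : C -> C) (z0 c : C) (r : R).
Hypothesis r_pos : 0 < r.
Hypothesis c_unit : Cmod c = 1.

Let lines (eps : R) (L : C -> Prop) : Prop :=
  isochromatic_line f z0 r c L /\ exists z, L z /\ cdisc z0 eps z.

(** With one line more than there are listed directions, two lines meet the same connected coloured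
    ray and coincide. A separate colour [c'] for the model allows a pole to be treated through
    [1 / f]. *)
Lemma finitely_many_lines (g : C -> C) (a c' : C) (rad : R) (k : nat) : 0 < rad <= r ->
  hol g z0 rad -> g z0 <> 0 -> Cmod c' = 1 ->
  (forall z, 0 < Cmod (z - z0) < rad -> noncritical f z /\
     (on_ray c (f z) <-> on_ray c' (a + (z - z0) ^ S k * g z)%C)) ->
  exists eps, 0 < eps /\ ~ infinitely_many_sets (lines eps).
Proof.
  intros Hrad Hg Hg0 Hc' Hray.
  destruct (rays_cover g a z0 c' rad k ltac:(lra) Hg Hg0 Hc') as [e [l [A [He [HA Hcov]]]]].
  exists (Rmin e rad). split; [apply Rmin_pos; lra|]. intros Hinf.
  set (n := S (length l)). destruct (Hinf n) as [Ls [HL Hdist]].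
  assert (Hw : forall i, exists w, (i < n)%nat -> In w l /\
    Cconnected (A w) /\ (forall y, A w y -> color_set f z0 r c y) /\ exists z, A w z /\ Ls i z).
  { intros i. destruct (classic (i < n)%nat) as [Hi|Hi]; [|exists (RtoC 0); tauto].
    destruct (HL i Hi) as [[HLn [HLs _]] [z [Lz Hz]]].
    assert (Hzc := proj1 (color_set_colored _ _ _ _ _) (HLs z Lz)).
    destruct Hzc as [Hzr [Hz0 [_ Hzray]]]. change (Cmod (z - z0) < Rmin e rad) in Hz.
    assert (Z1 := Rlt_le_trans _ _ _ Hz (Rmin_l _ _)).
    assert (Z2 := Rlt_le_trans _ _ _ Hz (Rmin_r _ _)).
    destruct (Hcov z ltac:(lra)) as [w [Hwl [Hw1 [Hwz Hwy]]]].
    { apply (Hray z ltac:(lra)). split; assumption. }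
    exists w. intros _. split; [exact Hwl|]. split; [now apply HA|].
    split; [|now exists z]. intros y Hy. destruct (Hwy y Hy) as [Hyr Hyy].
    apply color_set_colored. destruct (Hray y Hyr) as [Hnc Hiff].
    destruct (proj2 Hiff Hyy) as [R1 R2].
    split; [lra|]. split; [exact R1|]. split; [exact Hnc | exact R2]. }
  set (W := fun i => proj1_sig (constructive_indefinite_description _ (Hw i))).
  assert (HW : forall i, (i < n)%nat -> In (W i) l /\
    Cconnected (A (W i)) /\ (forall y, A (W i) y -> color_set f z0 r c y) /\
    exists z, A (W i) z /\ Ls i z).
  { intros i. unfold W. destruct (constructive_indefinite_description _ (Hw i)) as [w Hww].
    exact Hww. }
  assert (Hnd : NoDup (map W (seq 0 n))).
  { apply Injective_map_NoDup_in; [|apply seq_NoDup].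
    intros i j Hi Hj E. apply in_seq in Hi. apply in_seq in Hj.
    apply NNPP. intros Hij. apply (Hdist i j ltac:(lia) ltac:(lia) Hij).
    destruct (HW i ltac:(lia)) as [_ [HC [HS [x [Ax Lx]]]]].
    destruct (HW j ltac:(lia)) as [_ [_ [_ [y [Ay Ly]]]]]. rewrite <- E in Ay.
    destruct (HL i ltac:(lia)) as [HLi _]. destruct (HL j ltac:(lia)) as [HLj _].
    exact (component_unique _ (A (W i)) _ _ x y HLi HLj HC HS Ax Lx Ay Ly). }
  assert (Hincl : incl (map W (seq 0 n)) l).
  { intros w Hin. apply in_map_iff in Hin. destruct Hin as [i [<- Hi]]. apply in_seq in Hi.
    apply HW. lia. }
  assert (h := NoDup_incl_length Hnd Hincl). rewrite length_map, length_seq in h.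
  unfold n in h. lia.
Qed.

Lemma no_lines (eps : R) :
  (forall z, 0 < Cmod (z - z0) < eps -> ~ (f z <> 0 /\ noncritical f z)) ->
  ~ infinitely_many_sets (lines eps).
Proof.
  intros Hno Hinf. destruct (Hinf 1%nat) as [Ls [HL _]].
  destruct (HL O ltac:(lia)) as [[_ [HLs _]] [z [Lz Hz]]].
  destruct (proj1 (color_set_colored _ _ _ _ _) (HLs z Lz)) as [Hzr [Hz0 [Hnc _]]].
  change (Cmod (z - z0) < eps) in Hz. apply (Hno z); [lra|]. split; assumption.
Qed.

(** The order of the zero of [g - g z0] at [z0] separates the constant case, where all nearby points
    are critical, from the model [a + (z - z0)^(k+1) g2]. *)
Lemma removable_lines (g : C -> C) : hol g z0 r ->
  (forall z, 0 < Cmod (z - z0) < r -> f z = g z) ->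
  exists eps, 0 < eps /\ ~ infinitely_many_sets (lines eps).
Proof.
  intros Hg Ef. set (a := g z0).
  assert (Hg' : hol (fun z => g z - a)%C z0 r).
  { intros w Hw. destruct (Hg w Hw) as [l Hl]. exists l. now apply cdiff_minus_const. }
  destruct (zero_order _ z0 r r_pos Hg') as [H0|[k [g2 [Hg2 [Hg20 E]]]]].
  - exists (r / 2). split; [lra|]. apply no_lines. intros z Hz [_ Hnc].
    refine (const_near_critical f a z _ Hnc).
    exists (Rmin (Cmod (z - z0)) (r / 2 - Cmod (z - z0))). split; [apply Rmin_pos; lra|].
    intros w Hw. assert (W1 := Rlt_le_trans _ _ _ Hw (Rmin_l _ _)).
    assert (W2 := Rlt_le_trans _ _ _ Hw (Rmin_r _ _)).
    assert (T1 := Cmod_tri z w z0). rewrite (Cmod_sub_sym z w) in T1.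
    assert (T2 := Cmod_tri w z z0).
    rewrite Ef by lra. apply Ceq_minus. apply H0. lra.
  - destruct k as [|k].
    { exfalso. apply Hg20. assert (h := E z0). unfold a in h. simpl in h.
      replace (g z0 - g z0)%C with (RtoC 0) in h by ring. rewrite Cmult_1_l in h. now symmetry. }
    assert (Ef2 : forall z, 0 < Cmod (z - z0) < r -> f z = (a + (z - z0) ^ S k * g2 z)%C).
    { intros z Hz. rewrite Ef, <- E by exact Hz. ring. }
    destruct (noncritical_near f g2 a z0 r k r_pos Hg2 Hg20 Ef2) as [d [Hd Hnc]].
    apply (finitely_many_lines g2 a c d k); auto.
    + intros z Hz. apply Hg2. lra.
    + intros z Hz. split; [now apply Hnc|]. rewrite Ef2 by lra. tauto.
Qed.

Lemma on_ray_inv (y : C) : y <> 0 -> (on_ray c y <-> on_ray (/ c) (/ y)).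
Proof.
  intros Hy. assert (Hm := proj1 (Cmod_gt_0 _) Hy).
  assert (Hc0 : c <> 0) by (apply Cmod_pos_neq; lra).
  assert (Hmc : RtoC (Cmod y) <> 0) by (intros E; apply RtoC_inj in E; lra).
  assert (Hiy : (/ y)%C <> 0).
  { apply Cmod_pos_neq. rewrite Cmod_inv by exact Hy. now apply Rinv_0_lt_compat. }
  unfold on_ray. rewrite Cmod_inv, RtoC_inv by (exact Hy || lra). split.
  - intros [_ E]. split; [exact Hiy|]. rewrite E at 1. field. split; assumption.
  - intros [_ E]. split; [exact Hy|].
    replace y with (/ / y)%C at 1 by (field; exact Hy). rewrite E. field. split; assumption.
Qed.

(** Inversion exchanges the colours [c] and [/ c] and turns the pole into a zero, which is the model
    with [a = 0]. Noncriticality returns from [1 / f] to [f] by inverting once more. *)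
Lemma pole_lines (g : C -> C) (k : nat) : hol g z0 r -> g z0 <> 0 ->
  (forall z, 0 < Cmod (z - z0) < r -> ((z - z0) ^ S k * f z)%C = g z) ->
  exists eps, 0 < eps /\ ~ infinitely_many_sets (lines eps).
Proof.
  intros Hg Hg0 Ef. destruct (Hg z0) as [lg Hlg]; [rewrite Cmod_sub_0; exact r_pos|].
  assert (Hmg := proj1 (Cmod_gt_0 _) Hg0).
  destruct (proj1 (locally_Cmod _ _) (cdiff_cts _ _ _ Hlg _ Hmg)) as [d1 [Hd1 Hn]].
  set (d2 := Rmin r d1). assert (Hd2 : 0 < d2) by now apply Rmin_pos.
  assert (h1 : d2 <= r) by apply Rmin_l. assert (h2 : d2 <= d1) by apply Rmin_r.
  assert (Hgn : forall z, Cmod (z - z0) < d2 -> g z <> 0).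
  { intros z Hz E. assert (h := Hn z ltac:(lra)). rewrite E in h.
    replace (0 - g z0)%C with (- g z0)%C in h by ring. rewrite Cmod_opp in h. lra. }
  set (G := fun z => (/ g z)%C).
  assert (HG : hol G z0 d2).
  { intros z Hz. destruct (Hg z ltac:(lra)) as [l Hl]. eexists.
    apply cdiff_inv; [exact Hl | now apply Hgn]. }
  assert (Hi : forall z, 0 < Cmod (z - z0) < d2 ->
    f z <> 0 /\ (/ f z)%C = (0 + (z - z0) ^ S k * G z)%C).
  { intros z Hz. assert (E := Ef z ltac:(lra)). assert (Hgz := Hgn z ltac:(lra)).
    assert (Hp : ((z - z0) ^ S k)%C <> 0) by (apply Cpow_nz, Cmod_pos_neq; lra).
    assert (Hf0 : f z <> 0) by (intros E0; apply Hgz; rewrite <- E, E0; ring).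
    split; [exact Hf0|]. unfold G. rewrite <- E. field. split; assumption. }
  assert (Hcn : Cmod (/ c) = 1).
  { rewrite Cmod_inv, c_unit by (apply Cmod_pos_neq; lra). lra. }
  assert (HG0 : G z0 <> 0).
  { unfold G. apply Cmod_pos_neq. rewrite Cmod_inv by exact Hg0. now apply Rinv_0_lt_compat. }
  destruct (noncritical_near (fun z => / f z)%C G 0 z0 d2 k Hd2 HG HG0) as [d [Hd Hnc]].
  { intros z Hz. now apply Hi. }
  apply (finitely_many_lines G 0 (/ c) d k); auto; [lra| |].
  - intros z Hz. apply HG. lra.
  - intros z Hz. destruct (Hi z ltac:(lra)) as [Hf0 E]. split.
    + destruct (Hnc z Hz) as [m [Hm Hm0]].
      assert (Hif : (/ f z)%C <> 0).
      { apply Cmod_pos_neq. rewrite Cmod_inv by exact Hf0. apply Rinv_0_lt_compat.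
        now apply Cmod_gt_0. }
      assert (Hd' := cdiff_inv (fun z => / f z)%C z m Hm Hif). cbv beta in Hd'.
      exists (- m / (/ f z * / f z))%C. split.
      * refine (cdiff_ext_loc _ _ _ _ _ Hd'). apply locally_Cmod.
        exists (Rmin (Cmod (z - z0)) (d - Cmod (z - z0))). split; [apply Rmin_pos; lra|].
        intros w Hw. assert (W1 := Rlt_le_trans _ _ _ Hw (Rmin_l _ _)).
        assert (W2 := Rlt_le_trans _ _ _ Hw (Rmin_r _ _)).
        assert (T1 := Cmod_tri z w z0). rewrite (Cmod_sub_sym z w) in T1.
        assert (T2 := Cmod_tri w z z0).
        field. apply (Hi w). lra.
      * replace (- m / (/ f z * / f z))%C with (- m * (f z * f z))%C by (field; exact Hf0).
        apply Cmult_neq_0; [|now apply Cmult_neq_0].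
        intros E0. apply Hm0. replace m with (- - m)%C by ring. rewrite E0. ring.
    + rewrite (on_ray_inv (f z) Hf0), E. tauto.
Qed.

(** The order [k] of the zero of [h = (z - z0)^m f] is compared with [m]: the singularity is
    removable if [m <= k], and otherwise a pole of order [m - k]. *)
Theorem tame_few_lines : removable_or_pole f z0 r ->
  exists eps, 0 < eps /\ ~ infinitely_many_sets (lines eps).
Proof.
  intros [m [h [Hh Eh]]].
  assert (Hhol : hol h z0 r) by exact (proj1 (analytic_cdiff _ _) Hh).
  assert (Eh' : forall z, 0 < Cmod (z - z0) < r -> ((z - z0) ^ m * f z)%C = h z).
  { intros z Hz. rewrite <- Cpow_Defs. symmetry. now apply Eh. }
  assert (Hpn : forall z n, 0 < Cmod (z - z0) < r -> ((z - z0) ^ n)%C <> 0)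
    by (intros z n Hz; apply Cpow_nz, Cmod_pos_neq; lra).
  destruct (zero_order h z0 r r_pos Hhol) as [H0|[k [g [Hg [Hg0 E]]]]].
  - exists (r / 2). split; [lra|]. apply no_lines. intros z Hz [Hf0 _].
    apply (Cmult_neq_0 ((z - z0) ^ m) (f z)); [apply Hpn; lra | exact Hf0|].
    rewrite Eh' by lra. apply H0. lra.
  - destruct (Nat.le_gt_cases m k) as [Hmk|Hmk].
    + apply (removable_lines (fun z => (z - z0) ^ (k - m) * g z)%C).
      * intros z Hz. destruct (Hg z Hz) as [l1 Hl1]. destruct (cdiff_pow_ex z0 z (k - m)) as [l2 Hl2].
        eexists. apply (cdiff_mult (fun z => (z - z0) ^ (k - m))%C g); eassumption.
      * intros z Hz. apply (Cmult_cancel_l ((z - z0) ^ m)); [now apply Hpn|].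
        rewrite Eh', E by exact Hz. rewrite Cmult_assoc, <- Cpow_add_r.
        replace (m + (k - m))%nat with k by lia. reflexivity.
    (* The pole order is passed as a predecessor, since [pole_lines] speaks of the exponent
       [S k]. *)
    + apply (pole_lines g (m - k - 1)); auto.
      intros z Hz. apply (Cmult_cancel_l ((z - z0) ^ k)); [now apply Hpn|].
      rewrite Cmult_assoc, <- Cpow_add_r, <- E.
      replace (k + S (m - k - 1))%nat with m by lia. now apply Eh'.
Qed.

End Tame.

Theorem theorem2 (f : Cplx -> Cplx) (z0 : Cplx) (r : R) (hr : 0 < r)
  (hf : analytic_on (punctured_disc z0 r) f) :
  essential_singularity f z0 r <->
  exists c : Cplx, Cnorm c = 1 /\
    forall eps : R, 0 < eps ->
      infinitely_many_sets (fun L => isochromatic_line f z0 r c L /\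
                                     exists z, L z /\ cdisc z0 eps z).
Proof.
  split.
  - apply essential_many_lines; [exact hr|]. exact (proj1 (analytic_cdiff _ _) hf).
  - intros [c [Hc Hinf]] Htame.
    destruct (tame_few_lines f z0 c r hr Hc Htame) as [eps [Heps Hfin]].
    exact (Hfin (Hinf eps Heps)).
Qed.
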